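(* Let $\mathbf{C}$ be a compact dagger theory with an environment structure $\mathbf{C}_p$ which has the superposition properties. Then there is an embedding of dagger theories $$\mathrm{Quant}_S\hookrightarrow\mathbf{C}$$ for some commutative involutive semi-ring $S$ with $\mathbf{C}_p(I,I)\simeq S^{\mathrm{pos}}$ as monoids.
   Context: **Dagger categories.** A dagger category has an identity-on-objects contravariant functor $(-)^\dagger$ with $f^{\dagger\dagger}=f$; it is dagger symmetric monoidal if it is symmetric monoidal with $(f\otimes g)^\dagger=f^\dagger\otimes g^\dagger$ and unitary coherence isomorphisms. Effects and scalars are morphisms $A\to I$ and $I\to I$. $f$ is an isometry if $f^\dagger f=\mathrm{id}$, unitary if also $ff^\dagger=\mathrm{id}$; $f$ is positive if $f=g^\dagger g$ for some $g$. Morphisms $f:A\to B$, $g:C\to B$ are orthogonal if $g^\dagger f=0$. It is dagger compact if each object $A$ has an object $A^*$ and a state $\cup_A:I\to A^*\otimes A$ such that $\cup_A$ and $\cap_A=\cup_A^\dagger\circ\sigma:A\otimes A^*\to I$ ($\sigma$ the swap) satisfy the snake equations. For $f:A\to B$, $f^*:B^*\to A^*$ is its transpose and $f_*=(f^\dagger)^*$. **Dagger theories.** A dagger theory is a dagger symmetric monoidal category with a chosen effect $\top_A:A\to I$ (''discarding'') for each $A$, with $\top_{A\otimes B}=\top_A\otimes\top_B$ and $\top_I=\mathrm{id}_I$. It is compact if it is dagger compact and $(\top_{A^*}\otimes\mathrm{id}_A)\circ\cup_A=\top_A^\dagger$ for all $A$. An embedding of dagger theories is a faithful dagger symmetric monoidal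 functor $F$ preserving discarding ($\top_{F(A)}=\phi\circ F(\top_A)$ with $\phi:F(I)\simeq I$ the structure isomorphism) and preserving zero morphisms when they exist. $g:A\to B\otimes C$ is a dilation of $f:A\to B$ if $(\mathrm{id}_B\otimes\top_C)\circ g=f$. An environment structure on a compact dagger theory $\mathbf{C}$ is a dagger compact subcategory $\mathbf{C}_p$ such that every morphism of $\mathbf{C}$ has a dilation in $\mathbf{C}_p$, and for all $f:A\to B$, $g:A\to C$ in $\mathbf{C}_p$: $f^\dagger f=g^\dagger g\iff\top_B\circ f=\top_C\circ g$. **Superposition properties.** In a dagger category with zero morphisms, a phased dagger biproduct of $A,B$ is an object $A\dot\oplus B$ with orthogonal isometries $\kappa_A:A\to A\dot\oplus B$, $\kappa_B:B\to A\dot\oplus B$ such that: (i) for all $f:A\to C$, $g:B\to C$ there is some $h:A\dot\oplus B\to C$ with $h\kappa_A=f$, $h\kappa_B=g$; (ii) any two such $h,h'$ satisfy $h'=h\circ U$ for some phase, i.e. an endomorphism $U$ of $A\dot\oplus B$ with $U\kappa_A=\kappa_A$, $U\kappa_B=\kappa_B$; (iii) if $U$ is a phase so is $U^\dagger$. Having finite phased dagger biproducts means having binary ones and a zero object. A morphism $f:A\dot\oplus B\to C\dot\oplus D$ is diagonal if $f\kappa_A=\kappa_Cf_A$ and $f\kappa_B=\kappa_Df_B$ for some $f_A,f_B$. A dagger compact category has the superposition properties if every non-zero object $A$ has an isometry $I\to A$, it has finite phased dagger biproducts, and for all phases $U$ and positive diagonal morphisms $p,q$ on $A\dot\oplus B$: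 $p=q\circ U\Rightarrow p=q$. **The theories $\mathrm{Quant}_S$.** For a commutative semi-ring $S$ with an involution (a semi-ring automorphism $\dagger$ with $s^{\dagger\dagger}=s$), $\mathrm{Mat}_S$ is the dagger compact category with objects natural numbers, morphisms $n\to m$ the $n\times m$ matrices over $S$ with matrix composition, $(M^\dagger)_{i,j}=(M_{j,i})^\dagger$, and $\otimes$ the Kronecker product. For a dagger compact category $\mathbf{B}$, $\mathrm{CPM}(\mathbf{B})$ has the same objects, and morphisms $A\to B$ are the morphisms $A^*\otimes A\to B^*\otimes B$ of $\mathbf{B}$ obtained from $f_*\otimes f$, for some $f:A\to C\otimes B$, by contracting the $C^*,C$ outputs with the cap; discarding is $\top_A=\cup_A^\dagger:A^*\otimes A\to I$; composition, dagger and (up to reordering wires) tensor are as in $\mathbf{B}$. $\mathrm{Quant}_S:=\mathrm{CPM}(\mathrm{Mat}_S)$; its morphisms $n\to m$ are matrices $\sum_{i=1}^k (M_i)_*\otimes M_i$ with $M_i$ an $n\times m$ matrix over $S$ and $(M_i)_*$ its entrywise involution. $S^{\mathrm{pos}}=\{s^\dagger s\mid s\in S\}$, a monoid under multiplication; $\mathbf{C}_p(I,I)$ is a monoid under composition. *)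

(* Defs.v *)
From HB Require Import structures.
From mathcomp Require Import all_boot all_algebra.
From mathcomp Require Import boolp.
From mathcomp Require Import mxtens.

Set Implicit Arguments.
Unset Strict Implicit.
Unset Printing Implicit Defensive.

Import GRing.Theory.

Declare Scope cat_scope.
Delimit Scope cat_scope with cat.
Local Open Scope cat_scope.

Reserved Notation "g ∘ f" (at level 40, left associativity).
Reserved Notation "A ⊗ B" (at level 38, left associativity).
Reserved Notation "f ⊠ g" (at level 38, left associativity).
Reserved Notation "f ^†" (at level 1, format "f ^†").

Record category := Category {
  obj :> Type;
  hom : obj -> obj -> Type;
  idm : forall A, hom A A;
  comp : forall A B C, hom B C -> hom A B -> hom A C;
  comp1m : forall A B (f : hom A B), comp (idm B) f = f;
  compm1 : forall A B (f : hom A B), comp f (idm A) = f;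
  compA : forall A B C D (h : hom C D) (g : hom B C) (f : hom A B),
    comp h (comp g f) = comp (comp h g) f }.

Arguments idm {c} A.
Arguments comp {c A B C} g f.
Notation "g ∘ f" := (comp g f) : cat_scope.

Record dagger_category := DaggerCategory {
  dc_cat :> category;
  dag : forall A B : dc_cat, hom A B -> hom B A;
  dag1 : forall A : dc_cat, dag (idm A) = idm A;
  dag_comp : forall (A B C : dc_cat) (g : hom B C) (f : hom A B),
    dag (g ∘ f) = dag f ∘ dag g;
  dagK : forall (A B : dc_cat) (f : hom A B), dag (dag f) = f }.

Arguments dag {d A B} f.
Notation "f ^†" := (dag f) : cat_scope.

Definition isometry (C : dagger_category) (A B : C) (f : hom A B) : Prop :=
  f^† ∘ f = idm A.

Definition unitary (C : dagger_category) (A B : C) (f : hom A B) : Prop :=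
  isometry f /\ f ∘ f^† = idm B.

Definition positive (C : dagger_category) (A : C) (f : hom A A) : Prop :=
  exists (B : C) (g : hom A B), f = g^† ∘ g.

(* The coherence isomorphisms are unitary, so their inverses are their daggers. *)
Record dsm_category := DsmCategory {
  dsm_dc :> dagger_category;
  Iob : dsm_dc;
  tens : dsm_dc -> dsm_dc -> dsm_dc where "A ⊗ B" := (tens A B);
  tensm : forall A B C D : dsm_dc,
    hom A B -> hom C D -> hom (A ⊗ C) (B ⊗ D) where "f ⊠ g" := (tensm f g);
  assoc : forall A B C : dsm_dc, hom (A ⊗ B ⊗ C) (A ⊗ (B ⊗ C));
  lunit : forall A : dsm_dc, hom (Iob ⊗ A) A;
  runit : forall A : dsm_dc, hom (A ⊗ Iob) A;
  swap : forall A B : dsm_dc, hom (A ⊗ B) (B ⊗ A);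
  tensm1 : forall A B : dsm_dc, idm A ⊠ idm B = idm (A ⊗ B);
  tensm_comp : forall (A B C A' B' C' : dsm_dc)
      (g : hom B C) (f : hom A B) (g' : hom B' C') (f' : hom A' B'),
    (g ∘ f) ⊠ (g' ∘ f') = (g ⊠ g') ∘ (f ⊠ f');
  dag_tensm : forall (A B C D : dsm_dc) (f : hom A B) (g : hom C D),
    (f ⊠ g)^† = f^† ⊠ g^†;
  assoc_unitary : forall A B C, unitary (assoc A B C);
  lunit_unitary : forall A, unitary (lunit A);
  runit_unitary : forall A, unitary (runit A);
  swap_unitary : forall A B, unitary (swap A B);
  assoc_nat : forall (A B C A' B' C' : dsm_dc)
      (f : hom A A') (g : hom B B') (h : hom C C'),
    assoc A' B' C' ∘ (f ⊠ g ⊠ h) = (f ⊠ (g ⊠ h)) ∘ assoc A B C;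
  lunit_nat : forall (A B : dsm_dc) (f : hom A B),
    lunit B ∘ (idm Iob ⊠ f) = f ∘ lunit A;
  runit_nat : forall (A B : dsm_dc) (f : hom A B),
    runit B ∘ (f ⊠ idm Iob) = f ∘ runit A;
  swap_nat : forall (A B A' B' : dsm_dc) (f : hom A A') (g : hom B B'),
    swap A' B' ∘ (f ⊠ g) = (g ⊠ f) ∘ swap A B;
  pentagon : forall A B C D : dsm_dc,
    assoc A B (C ⊗ D) ∘ assoc (A ⊗ B) C D =
    (idm A ⊠ assoc B C D) ∘ assoc A (B ⊗ C) D ∘ (assoc A B C ⊠ idm D);
  triangle : forall A B : dsm_dc,
    (idm A ⊠ lunit B) ∘ assoc A Iob B = runit A ⊠ idm B;
  hexagon : forall A B C : dsm_dc,
    assoc B C A ∘ swap A (B ⊗ C) ∘ assoc A B C =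
    (idm B ⊠ swap A C) ∘ assoc B A C ∘ (swap A B ⊠ idm C);
  swapK : forall A B : dsm_dc, swap B A ∘ swap A B = idm (A ⊗ B) }.

Arguments Iob {d}.
Arguments tens {d} A B.
Arguments tensm {d A B C D} f g.
Arguments assoc {d} A B C.
Arguments lunit {d} A.
Arguments runit {d} A.
Arguments swap {d} A B.
Notation "A ⊗ B" := (tens A B) : cat_scope.
Notation "f ⊠ g" := (tensm f g) : cat_scope.

(* [cap_of c] is the effect dagger(c) ∘ swap obtained from a state c. *)
Definition cap_of (C : dsm_category) (A A' : C) (c : hom Iob (A' ⊗ A)) :
  hom (A ⊗ A') Iob := c^† ∘ swap A A'.

Record dcompact_category := DcompactCategory {
  dcc_dsm :> dsm_category;
  dual : dcc_dsm -> dcc_dsm;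
  cup : forall A : dcc_dsm, hom Iob (dual A ⊗ A);
  snake : forall A : dcc_dsm,
    lunit A ∘ (cap_of (cup A) ⊠ idm A) ∘ (assoc A (dual A) A)^†
      ∘ (idm A ⊠ cup A) ∘ (runit A)^† = idm A;
  snake_dual : forall A : dcc_dsm,
    runit (dual A) ∘ (idm (dual A) ⊠ cap_of (cup A)) ∘ assoc (dual A) A (dual A)
      ∘ (cup A ⊠ idm (dual A)) ∘ (lunit (dual A))^† = idm (dual A) }.

Arguments dual {d} A.
Arguments cup {d} A.

Definition cap (C : dcompact_category) (A : C) : hom (A ⊗ dual A) Iob :=
  cap_of (cup A).
Arguments cap {C} A.

Definition zero_family (C : category) (z : forall A B : C, hom A B) : Prop :=
  forall A B D : C,
    (forall f : hom A B, z B D ∘ f = z A D) /\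
    (forall g : hom B D, g ∘ z A B = z A D).

(* A category has at most one zero family. *)
Definition is_zero (C : category) (A B : C) (f : hom A B) : Prop :=
  exists2 z : forall A B : C, hom A B, zero_family z & f = z A B.

Definition zero_object (C : category) (Z : C) : Prop :=
  forall A : C, (exists! f : hom Z A, True) /\ (exists! f : hom A Z, True).

Definition orthogonal (C : dagger_category) (A B D : C)
  (f : hom A B) (g : hom D B) : Prop := is_zero (g^† ∘ f).

Definition fixes_both (C : category) (A B W : C)
    (kA : hom A W) (kB : hom B W) (U : hom W W) : Prop :=
  U ∘ kA = kA /\ U ∘ kB = kB.

Record phased_dbiproduct (C : dagger_category) (A B : C) := PhasedDbiproduct {
  pb_obj :> C;
  pb_inl : hom A pb_obj;
  pb_inr : hom B pb_obj;
  pb_inl_iso : isometry pb_inl;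
  pb_inr_iso : isometry pb_inr;
  pb_orth : orthogonal pb_inl pb_inr;
  pb_ex : forall (D : C) (f : hom A D) (g : hom B D),
    exists h : hom pb_obj D, h ∘ pb_inl = f /\ h ∘ pb_inr = g;
  pb_uniq : forall (D : C) (h h' : hom pb_obj D),
    h ∘ pb_inl = h' ∘ pb_inl -> h ∘ pb_inr = h' ∘ pb_inr ->
    exists2 U : hom pb_obj pb_obj, fixes_both pb_inl pb_inr U & h' = h ∘ U;
  pb_dag : forall U : hom pb_obj pb_obj,
    fixes_both pb_inl pb_inr U -> fixes_both pb_inl pb_inr U^† }.

Definition is_phase (C : dagger_category) (A B : C)
    (W : phased_dbiproduct A B) (U : hom W W) : Prop :=
  fixes_both (pb_inl W) (pb_inr W) U.

Definition diagonal (C : dagger_category) (A B A' B' : C)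
    (W : phased_dbiproduct A B) (W' : phased_dbiproduct A' B')
    (f : hom W W') : Prop :=
  (exists fA : hom A A', f ∘ pb_inl W = pb_inl W' ∘ fA) /\
  (exists fB : hom B B', f ∘ pb_inr W = pb_inr W' ∘ fB).

Definition finite_phased_dbiproducts (C : dagger_category) : Prop :=
  (exists Z : C, zero_object Z) /\
  (forall A B : C, inhabited (phased_dbiproduct A B)).

Definition superposition_properties (C : dcompact_category) : Prop :=
  [/\ forall A : C, ~ zero_object A -> exists f : hom Iob A, isometry f,
      finite_phased_dbiproducts C
    & forall (A B : C) (W : phased_dbiproduct A B) (U p q : hom W W),
        is_phase U -> positive p -> diagonal p -> positive q -> diagonal q ->
        p = q ∘ U -> p = q].

Record discarding (C : dsm_category) := Discarding {
  disc_mor : forall A : C, hom A Iob;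
  disc_mor_tens : forall A B : C,
    disc_mor (A ⊗ B) = lunit Iob ∘ (disc_mor A ⊠ disc_mor B);
  disc_mor_unit : disc_mor Iob = idm Iob }.

Record dagger_theory := DaggerTheory {
  dt_dsm :> dsm_category;
  dt_disc : discarding dt_dsm }.

Definition disc (C : dagger_theory) (A : C) : hom A Iob := disc_mor (dt_disc C) A.
Arguments disc {C} A.

Record compact_dagger_theory := CompactDaggerTheory {
  cdt_dcc :> dcompact_category;
  cdt_disc : discarding cdt_dcc;
  cdt_cup : forall A : cdt_dcc,
    lunit A ∘ (disc_mor cdt_disc (dual A) ⊠ idm A) ∘ cup A
      = (disc_mor cdt_disc A)^† }.

Coercion cdt_dt (C : compact_dagger_theory) : dagger_theory :=
  DaggerTheory (cdt_disc C).

Definition dilation (C : dagger_theory) (A B D : C)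
    (f : hom A B) (g : hom A (B ⊗ D)) : Prop :=
  runit B ∘ (idm B ⊠ disc D) ∘ g = f.

(* [phi2] and [phi0] are the structure isomorphisms
   F A ⊗ F B ≅ F (A ⊗ B) and F I ≅ I. *)
Record dsm_functor (C D : dsm_category) := DsmFunctor {
  fob :> C -> D;
  fmor : forall A B : C, hom A B -> hom (fob A) (fob B);
  phi2 : forall A B : C, hom (fob A ⊗ fob B) (fob (A ⊗ B));
  phi0 : hom (fob Iob) Iob;
  fmor1 : forall A : C, fmor (idm A) = idm (fob A);
  fmor_comp : forall (A B E : C) (g : hom B E) (f : hom A B),
    fmor (g ∘ f) = fmor g ∘ fmor f;
  fmor_dag : forall (A B : C) (f : hom A B), fmor f^† = (fmor f)^†;
  phi2_unitary : forall A B : C, unitary (phi2 A B);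
  phi0_unitary : unitary phi0;
  phi2_nat : forall (A B A' B' : C) (f : hom A A') (g : hom B B'),
    phi2 A' B' ∘ (fmor f ⊠ fmor g) = fmor (f ⊠ g) ∘ phi2 A B;
  phi2_assoc : forall A B E : C,
    fmor (assoc A B E) ∘ phi2 (A ⊗ B) E ∘ (phi2 A B ⊠ idm (fob E)) =
    phi2 A (B ⊗ E) ∘ (idm (fob A) ⊠ phi2 B E) ∘ assoc (fob A) (fob B) (fob E);
  phi2_lunit : forall A : C,
    fmor (lunit A) ∘ phi2 Iob A = lunit (fob A) ∘ (phi0 ⊠ idm (fob A));
  phi2_runit : forall A : C,
    fmor (runit A) ∘ phi2 A Iob = runit (fob A) ∘ (idm (fob A) ⊠ phi0);
  phi2_swap : forall A B : C,
    fmor (swap A B) ∘ phi2 A B = phi2 B A ∘ swap (fob A) (fob B) }.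

Record dt_embedding (C D : dagger_theory) := DtEmbedding {
  emb_fun :> dsm_functor C D;
  emb_faithful : forall (A B : C) (f g : hom A B),
    fmor emb_fun f = fmor emb_fun g -> f = g;
  emb_disc : forall A : C,
    disc (emb_fun A) = phi0 emb_fun ∘ fmor emb_fun (disc A);
  emb_zero : forall (A B : C) (f : hom A B),
    is_zero f -> is_zero (fmor emb_fun f) }.

(* A dagger compact subcategory, given by the morphisms it contains.  It has all
   objects: this is forced in an environment structure, since the dilation of
   each identity lies in the subcategory. *)
Record dcompact_subcategory (C : dcompact_category) := DcompactSubcategory {
  pure : forall A B : C, hom A B -> Prop;
  pure1 : forall A : C, pure (idm A);
  pure_comp : forall (A B D : C) (g : hom B D) (f : hom A B),
    pure g -> pure f -> pure (g ∘ f);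
  pure_dag : forall (A B : C) (f : hom A B), pure f -> pure f^†;
  pure_tensm : forall (A B A' B' : C) (f : hom A B) (g : hom A' B'),
    pure f -> pure g -> pure (f ⊠ g);
  pure_assoc : forall A B D : C, pure (assoc A B D);
  pure_lunit : forall A : C, pure (lunit A);
  pure_runit : forall A : C, pure (runit A);
  pure_swap : forall A B : C, pure (swap A B);
  pure_cup : forall A : C, pure (cup A) }.

Arguments pure {C} d {A B} f.

Section SubCategory.
Variables (C : dcompact_category) (P : dcompact_subcategory C).

Definition sub_hom (A B : C) : Type := {f : hom A B | pure P f}.

Lemma sub_homP (A B : C) (f g : sub_hom A B) : sval f = sval g -> f = g.
Proof. by case: f g => f pf [g pg] /= e; subst g; congr exist; apply: Prop_irrelevance. Qed.

Definition sub_category : category.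
Proof.
refine (@Category C sub_hom
  (fun A => exist _ _ (pure1 P A))
  (fun A B D g f => exist _ _ (pure_comp (svalP g) (svalP f))) _ _ _).
- by move=> A B f; apply: sub_homP; apply: comp1m.
- by move=> A B f; apply: sub_homP; apply: compm1.
- by move=> A B D E h g f; apply: sub_homP; apply: compA.
Defined.

Definition sub_dagger_category : dagger_category.
Proof.
refine (@DaggerCategory sub_category
  (fun A B f => exist _ _ (pure_dag (svalP f))) _ _ _).
- by move=> A; apply: sub_homP; apply: dag1.
- by move=> A B D g f; apply: sub_homP; apply: dag_comp.
- by move=> A B f; apply: sub_homP; apply: dagK.
Defined.

Lemma sub_unitary (A B : sub_dagger_category) (f : hom A B) :
  unitary (sval f) -> unitary f.
Proof. by case=> h1 h2; split; apply: sub_homP. Qed.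

Definition sub_dsm_category : dsm_category.
Proof.
refine (@DsmCategory sub_dagger_category (@Iob C) (@tens C)
  (fun A B D E f g => exist _ _ (pure_tensm (svalP f) (svalP g)))
  (fun A B D => exist _ _ (pure_assoc P A B D))
  (fun A => exist _ _ (pure_lunit P A))
  (fun A => exist _ _ (pure_runit P A))
  (fun A B => exist _ _ (pure_swap P A B)) _ _ _ _ _ _ _ _ _ _ _ _ _ _ _).
- by move=> *; apply: sub_homP; apply: tensm1.
- by move=> *; apply: sub_homP; apply: tensm_comp.
- by move=> *; apply: sub_homP; apply: dag_tensm.
- by move=> *; apply: sub_unitary; apply: assoc_unitary.
- by move=> *; apply: sub_unitary; apply: lunit_unitary.
- by move=> *; apply: sub_unitary; apply: runit_unitary.
- by move=> *; apply: sub_unitary; apply: swap_unitary.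
- by move=> *; apply: sub_homP; apply: assoc_nat.
- by move=> *; apply: sub_homP; apply: lunit_nat.
- by move=> *; apply: sub_homP; apply: runit_nat.
- by move=> *; apply: sub_homP; apply: swap_nat.
- by move=> *; apply: sub_homP; apply: pentagon.
- by move=> *; apply: sub_homP; apply: triangle.
- by move=> *; apply: sub_homP; apply: hexagon.
- by move=> *; apply: sub_homP; apply: swapK.
Defined.

Definition sub_dcompact : dcompact_category.
Proof.
refine (@DcompactCategory sub_dsm_category (@dual C)
  (fun A => exist _ _ (pure_cup P A)) _ _).
- by move=> *; apply: sub_homP; apply: snake.
- by move=> *; apply: sub_homP; apply: snake_dual.
Defined.

End SubCategory.

Record environment_structure (C : compact_dagger_theory) := EnvironmentStructure {
  env_sub : dcompact_subcategory C;
  env_dilation : forall (A B : C) (f : hom A B),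
    exists (D : C) (g : hom A (B ⊗ D)), pure env_sub g /\ dilation (C := C) f g;
  env_eq : forall (A B D : C) (f : hom A B) (g : hom A D),
    pure env_sub f -> pure env_sub g ->
    (f^† ∘ f = g^† ∘ g <-> disc (C := C) B ∘ f = disc (C := C) D ∘ g) }.

Definition env_cat (C : compact_dagger_theory) (E : environment_structure C) :
  dcompact_category := sub_dcompact (env_sub E).

Section CPM.
Variable B : dcompact_category.
Implicit Types X Y Z W : B.

(* The transpose of an effect on X ⊗ Y, as a morphism into the dual of X. *)
Definition bend X Y (e : hom (X ⊗ Y) Iob) : hom Y (dual X) :=
  runit (dual X) ∘ (idm (dual X) ⊠ e) ∘ assoc (dual X) X Y
    ∘ (cup X ⊠ idm Y) ∘ (lunit Y)^†.

Definition transpose X Y (f : hom X Y) : hom (dual Y) (dual X) :=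
  bend (cap Y ∘ (f ⊠ idm (dual Y))).

Definition conj X Y (f : hom X Y) : hom (dual X) (dual Y) := transpose f^†.

Definition midswap X Y Z W : hom (X ⊗ Y ⊗ (Z ⊗ W)) (X ⊗ Z ⊗ (Y ⊗ W)) :=
  (assoc X Z (Y ⊗ W))^†
    ∘ (idm X ⊠ (assoc Z Y W ∘ (swap Y Z ⊠ idm W) ∘ (assoc Y Z W)^†))
    ∘ assoc X Y (Z ⊗ W).

Definition dual_tens X Y : hom (dual X ⊗ dual Y) (dual (X ⊗ Y)) :=
  bend (lunit Iob ∘ (cap X ⊠ cap Y) ∘ midswap X Y (dual X) (dual Y)).

Definition dbl X : B := dual X ⊗ X.

Definition dblm X Y (f : hom X Y) : hom (dbl X) (dbl Y) := conj f ⊠ f.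

(* The reordering of wires relating the doubles of X, Y and X ⊗ Y. *)
Definition dbl_tens X Y : hom (dbl X ⊗ dbl Y) (dbl (X ⊗ Y)) :=
  (dual_tens X Y ⊠ idm (X ⊗ Y)) ∘ midswap (dual X) X (dual Y) Y.

(* f_* ⊗ f with the outputs Z^*, Z contracted. *)
Definition cpm X Y Z (f : hom X (Z ⊗ Y)) : hom (dbl X) (dbl Y) :=
  lunit (dbl Y) ∘ ((cup Z)^† ⊠ idm (dbl Y)) ∘ (dbl_tens Z Y)^† ∘ dblm f.

Definition is_cpm X Y (q : hom (dbl X) (dbl Y)) : Prop :=
  exists (Z : B) (f : hom X (Z ⊗ Y)), q = cpm f.

Definition cpm_tensm X Y Z W (q : hom (dbl X) (dbl Y)) (r : hom (dbl Z) (dbl W)) :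
  hom (dbl (X ⊗ Z)) (dbl (Y ⊗ W)) :=
  dbl_tens Y W ∘ (q ⊠ r) ∘ (dbl_tens X Z)^†.

(* The codomain of a morphism to I in CPM is the double of I; cup I identifies it
   with I. *)
Definition cpm_disc X : hom (dbl X) (dbl Iob) := cup Iob ∘ (cup X)^†.

Definition cpm_hom X Y : Type := {q : hom (dbl X) (dbl Y) | is_cpm q}.

Lemma cpm_homP X Y (f g : cpm_hom X Y) : sval f = sval g -> f = g.
Proof. by case: f g => f pf [g pg] /= e; subst g; congr exist; apply: Prop_irrelevance. Qed.

End CPM.

Local Close Scope cat_scope.
Local Open Scope ring_scope.

Record involutive_semiring := InvolutiveSemiring {
  isr :> comPzSemiRingType;
  inv : {rmorphism isr -> isr};
  invK : involutive inv }.

Arguments inv : clear implicits.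

Section Matrices.
Variable S : involutive_semiring.
Local Notation Mx m n := 'M[isr S]_(m, n).

Local Notation idx := (@mxtens_index _ _).
Local Notation uidx := (@mxtens_unindex _ _).

Definition dagmx m n (M : Mx m n) : Mx n m := \matrix_(i, j) inv S (M j i).

(* The library's [tensmx] requires a ring of entries. *)
Definition kron m n p q (M : Mx m n) (N : Mx p q) : Mx (m * p) (n * q) :=
  \matrix_(i, j) (M (uidx i).1 (uidx j).1 * N (uidx i).2 (uidx j).2).

Definition fmx m n (f : 'I_m -> 'I_n) : Mx m n :=
  \matrix_(i, j) (f i == j)%:R.

Lemma fmxE m n (f : 'I_m -> 'I_n) i j : fmx f i j = (f i == j)%:R.
Proof. by rewrite mxE. Qed.

Lemma kronE m n p q (M : Mx m n) (N : Mx p q) i j k l :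
  kron M N (idx (i, j)) (idx (k, l)) = M i k * N j l.
Proof. by rewrite mxE !mxtens_indexK. Qed.

Lemma idx_eq m n (i k : 'I_m) (j l : 'I_n) :
  (idx (i, j) == idx (k, l)) = (i == k) && (j == l).
Proof. by rewrite (can_eq (@mxtens_indexK m n)). Qed.

Lemma sum_idx m n (F : 'I_(m * n) -> S) :
  \sum_k F k = \sum_i \sum_j F (idx (i, j)).
Proof.
rewrite pair_big /=; apply: (reindex (fun p => idx (p.1, p.2))).
exists uidx; first by move=> [i j] _; rewrite mxtens_indexK.
by move=> k _; rewrite -[RHS]mxtens_unindexK; case: (uidx k).
Qed.

Lemma sum_dl (m : nat) (a : 'I_m) (F : 'I_m -> S) :
  \sum_i (a == i)%:R * F i = F a.
Proof.
rewrite (bigD1 a) //= eqxx mul1r big1 ?addr0 // => i ne.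
by rewrite eq_sym (negPf ne) mul0r.
Qed.

Lemma sum_dr (m : nat) (a : 'I_m) (F : 'I_m -> S) :
  \sum_i F i * (i == a)%:R = F a.
Proof. by rewrite -(sum_dl a F); apply: eq_bigr => i _; rewrite mulrC eq_sym. Qed.

Lemma fmx_mull m n p (f : 'I_m -> 'I_n) (A : Mx n p) i j :
  (fmx f *m A) i j = A (f i) j.
Proof. by rewrite mxE -(sum_dl (f i) (A^~ j)); apply: eq_bigr => k _; rewrite mxE. Qed.

Lemma fmx_mulr m n p (f : 'I_n -> 'I_p) g (A : Mx m n) :
  cancel f g -> cancel g f -> forall i j, (A *m fmx f) i j = A i (g j).
Proof.
move=> fK gK i j; rewrite mxE -(sum_dr (g j) (A i)); apply: eq_bigr => k _.
by rewrite mxE (can2_eq fK gK).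
Qed.

Lemma fmx_comp m n p (f : 'I_m -> 'I_n) (g : 'I_n -> 'I_p) :
  fmx f *m fmx g = fmx (g \o f).
Proof. by apply/matrixP => i j; rewrite fmx_mull !mxE. Qed.

Lemma fmx_id n : 1%:M = fmx (@id 'I_n).
Proof. by apply/matrixP => i j; rewrite !mxE. Qed.

Lemma eq_fmx m n (f g : 'I_m -> 'I_n) : f =1 g -> fmx f = fmx g.
Proof. by move=> e; apply/matrixP => i j; rewrite !mxE e. Qed.

Lemma dag_fmx m n (f : 'I_m -> 'I_n) g :
  cancel f g -> cancel g f -> dagmx (fmx f) = fmx g.
Proof.
move=> fK gK; apply/matrixP => i j.
by rewrite !mxE rmorph_nat (can2_eq fK gK) eq_sym.
Qed.

Definition tfun m n p q (f : 'I_m -> 'I_n) (g : 'I_p -> 'I_q)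
  (x : 'I_(m * p)) : 'I_(n * q) := idx (f (uidx x).1, g (uidx x).2).

Lemma kron_fmx m n p q (f : 'I_m -> 'I_n) (g : 'I_p -> 'I_q) :
  kron (fmx f) (fmx g) = fmx (tfun f g).
Proof.
apply/matrixP => i j; case: {i}(mxtens_indexP i) => i i'; case: {j}(mxtens_indexP j) => j j'.
by rewrite kronE !mxE /tfun mxtens_indexK idx_eq -natrM mulnb.
Qed.

Lemma kron_mul m n p m' n' p' (A : Mx m n) (B : Mx n p)
    (A' : Mx m' n') (B' : Mx n' p') :
  kron (A *m B) (A' *m B') = kron A A' *m kron B B'.
Proof.
apply/matrixP => i j; case: {i}(mxtens_indexP i) => i i'; case: {j}(mxtens_indexP j) => j j'.
rewrite kronE !mxE sum_idx big_distrl /=; apply: eq_bigr => k _.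
by rewrite big_distrr; apply: eq_bigr => l _ /=; rewrite !kronE mulrACA.
Qed.

Lemma dag_kron m n p q (M : Mx m n) (N : Mx p q) :
  dagmx (kron M N) = kron (dagmx M) (dagmx N).
Proof. by apply/matrixP => i j; rewrite !mxE rmorphM. Qed.

Lemma dag_mul m n p (A : Mx m n) (B : Mx n p) :
  dagmx (A *m B) = dagmx B *m dagmx A.
Proof.
apply/matrixP => i j; rewrite !mxE rmorph_sum; apply: eq_bigr => k _.
by rewrite !mxE rmorphM mulrC.
Qed.

Lemma dagmxK m n (M : Mx m n) : dagmx (dagmx M) = M.
Proof. by apply/matrixP => i j; rewrite !mxE invK. Qed.

Lemma dagmx1 n : dagmx 1%:M = 1%:M :> Mx n n.
Proof. by rewrite fmx_id; apply: dag_fmx. Qed.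

Lemma kron1 m n : kron 1%:M 1%:M = 1%:M :> Mx (m * n) (m * n).
Proof.
rewrite !fmx_id kron_fmx; apply: eq_fmx => x; rewrite /tfun.
by case: {x}(mxtens_indexP x) => i j; rewrite mxtens_indexK.
Qed.

Definition aidx m n p (x : 'I_(m * n * p)) : 'I_(m * (n * p)) :=
  idx ((uidx (uidx x).1).1, idx ((uidx (uidx x).1).2, (uidx x).2)).
Definition aidxV m n p (x : 'I_(m * (n * p))) : 'I_(m * n * p) :=
  idx (idx ((uidx x).1, (uidx (uidx x).2).1), (uidx (uidx x).2).2).
Definition sidx m n (x : 'I_(m * n)) : 'I_(n * m) :=
  idx ((uidx x).2, (uidx x).1).
Definition lidx n (x : 'I_(1 * n)) : 'I_n := (uidx x).2.
Definition lidxV n (x : 'I_n) : 'I_(1 * n) := idx (ord0, x).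
Definition ridx n (x : 'I_(n * 1)) : 'I_n := (uidx x).1.
Definition ridxV n (x : 'I_n) : 'I_(n * 1) := idx (x, ord0).

Lemma aidxE m n p i j k :
  @aidx m n p (idx (idx (i, j), k)) = idx (i, idx (j, k)).
Proof. by rewrite /aidx !mxtens_indexK. Qed.
Lemma aidxVE m n p i j k :
  @aidxV m n p (idx (i, idx (j, k))) = idx (idx (i, j), k).
Proof. by rewrite /aidxV !mxtens_indexK. Qed.
Lemma sidxE m n i j : @sidx m n (idx (i, j)) = idx (j, i).
Proof. by rewrite /sidx mxtens_indexK. Qed.
Lemma lidxE n i j : @lidx n (idx (i, j)) = j.
Proof. by rewrite /lidx mxtens_indexK. Qed.
Lemma ridxE n i j : @ridx n (idx (i, j)) = i.
Proof. by rewrite /ridx mxtens_indexK. Qed.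
Lemma tfunE m n p q (f : 'I_m -> 'I_n) (g : 'I_p -> 'I_q) i j :
  tfun f g (idx (i, j)) = idx (f i, g j).
Proof. by rewrite /tfun mxtens_indexK. Qed.

Lemma tfunK m n p q (f : 'I_m -> 'I_n) (g : 'I_p -> 'I_q) f' g' :
  cancel f f' -> cancel g g' -> cancel (tfun f g) (tfun f' g').
Proof.
move=> fK gK x; case: {x}(mxtens_indexP x) => i j.
by rewrite /tfun !mxtens_indexK fK gK.
Qed.

Definition idxE := (aidxE, aidxVE, sidxE, lidxE, ridxE, tfunE).

Lemma aidxK m n p : cancel (@aidx m n p) (@aidxV m n p).
Proof.
move=> x; case: {x}(mxtens_indexP x) => x k; case: {x}(mxtens_indexP x) => i j.
by rewrite !idxE.
Qed.
Lemma aidxVK m n p : cancel (@aidxV m n p) (@aidx m n p).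
Proof.
move=> x; case: {x}(mxtens_indexP x) => i x; case: {x}(mxtens_indexP x) => j k.
by rewrite !idxE.
Qed.
Lemma sidxK m n : cancel (@sidx m n) (@sidx n m).
Proof. by move=> x; case: {x}(mxtens_indexP x) => i j; rewrite !idxE. Qed.
Lemma lidxK n : cancel (@lidx n) (@lidxV n).
Proof. by move=> x; case: {x}(mxtens_indexP x) => i j; rewrite idxE /lidxV [i]ord1. Qed.
Lemma lidxVK n : cancel (@lidxV n) (@lidx n).
Proof. by move=> x; rewrite /lidxV idxE. Qed.
Lemma ridxK n : cancel (@ridx n) (@ridxV n).
Proof. by move=> x; case: {x}(mxtens_indexP x) => i j; rewrite idxE /ridxV [j]ord1. Qed.
Lemma ridxVK n : cancel (@ridxV n) (@ridx n).
Proof. by move=> x; rewrite /ridxV idxE. Qed.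

(* A morphism n -> m is an n × m matrix, so that g ∘ f is the product f *m g. *)
Definition Mat_category : category :=
  @Category nat (fun n m => Mx n m) (fun n => 1%:M) (fun _ _ _ g f => f *m g)
    (fun _ _ f => mulmx1 f) (fun _ _ f => mul1mx f)
    (fun _ _ _ _ h g f => esym (mulmxA f g h)).

Definition Mat_dagger_category : dagger_category :=
  @DaggerCategory Mat_category dagmx dagmx1
    (fun _ _ _ g f => dag_mul f g) dagmxK.

Lemma fmx_unitary (m n : Mat_dagger_category) (f : 'I_m -> 'I_n) g :
  cancel f g -> cancel g f -> @unitary Mat_dagger_category m n (fmx f).
Proof.
move=> fK gK; rewrite /unitary /isometry /= (dag_fmx fK gK).
by split; rewrite fmx_comp fmx_id; apply: eq_fmx.
Qed.

Lemma Mat_assoc_nat (A B C A' B' C' : nat)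
    (f : Mx A A') (g : Mx B B') (h : Mx C C') :
  kron (kron f g) h *m fmx (@aidx A' B' C') =
  fmx (@aidx A B C) *m kron f (kron g h).
Proof.
apply/matrixP => x y.
case: {x}(mxtens_indexP x) => x k; case: {x}(mxtens_indexP x) => i j.
case: {y}(mxtens_indexP y) => i' y; case: {y}(mxtens_indexP y) => j' k'.
rewrite (fmx_mulr _ (@aidxK _ _ _) (@aidxVK _ _ _)) fmx_mull !idxE !kronE.
by rewrite mulrA.
Qed.

Lemma Mat_lunit_nat (A B : nat) (f : Mx A B) :
  kron 1%:M f *m fmx (@lidx B) = fmx (@lidx A) *m f.
Proof.
apply/matrixP => x y; case: {x}(mxtens_indexP x) => i j.
rewrite (fmx_mulr _ (@lidxK _) (@lidxVK _)) fmx_mull idxE kronE [i]ord1 !mxE.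
by rewrite mul1r.
Qed.

Lemma Mat_runit_nat (A B : nat) (f : Mx A B) :
  kron f 1%:M *m fmx (@ridx B) = fmx (@ridx A) *m f.
Proof.
apply/matrixP => x y; case: {x}(mxtens_indexP x) => i j.
rewrite (fmx_mulr _ (@ridxK _) (@ridxVK _)) fmx_mull idxE kronE [j]ord1 !mxE.
by rewrite mulr1.
Qed.

Lemma Mat_swap_nat (A B A' B' : nat) (f : Mx A A') (g : Mx B B') :
  kron f g *m fmx (@sidx A' B') = fmx (@sidx A B) *m kron g f.
Proof.
apply/matrixP => x y; case: {x}(mxtens_indexP x) => i j; case: {y}(mxtens_indexP y) => k l.
by rewrite (fmx_mulr _ (@sidxK _ _) (@sidxK _ _)) fmx_mull !idxE !kronE mulrC.
Qed.

Lemma Mat_pentagon (A B C D : nat) :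
  fmx (@aidx (A * B) C D) *m fmx (@aidx A B (C * D)) =
  kron (fmx (@aidx A B C)) 1%:M *m
    (fmx (@aidx A (B * C) D) *m kron 1%:M (fmx (@aidx B C D))).
Proof.
rewrite !fmx_id !kron_fmx !fmx_comp; apply: eq_fmx => x.
case: {x}(mxtens_indexP x) => x l; case: {x}(mxtens_indexP x) => x k.
by case: {x}(mxtens_indexP x) => i j; rewrite /= !idxE.
Qed.

Lemma Mat_triangle (A B : nat) :
  fmx (@aidx A 1 B) *m kron 1%:M (fmx (@lidx B)) = kron (fmx (@ridx A)) 1%:M.
Proof.
rewrite !fmx_id !kron_fmx !fmx_comp; apply: eq_fmx => x.
case: {x}(mxtens_indexP x) => x k; case: {x}(mxtens_indexP x) => i j.
by rewrite /= !idxE.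
Qed.

Lemma Mat_hexagon (A B C : nat) :
  fmx (@aidx A B C) *m (fmx (@sidx A (B * C)) *m fmx (@aidx B C A)) =
  kron (fmx (@sidx A B)) 1%:M *m
    (fmx (@aidx B A C) *m kron 1%:M (fmx (@sidx A C))).
Proof.
rewrite !fmx_id !kron_fmx !fmx_comp; apply: eq_fmx => x.
case: {x}(mxtens_indexP x) => x k; case: {x}(mxtens_indexP x) => i j.
by rewrite /= !idxE.
Qed.

Lemma Mat_swapK (A B : nat) :
  fmx (@sidx A B) *m fmx (@sidx B A) = 1%:M.
Proof. by rewrite fmx_comp fmx_id; apply: eq_fmx; apply: sidxK. Qed.

Definition Mat_dsm : dsm_category :=
  @DsmCategory Mat_dagger_category 1%N muln
    (fun _ _ _ _ f g => kron f g)
    (fun A B C => fmx (@aidx A B C)) (fun A => fmx (@lidx A))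
    (fun A => fmx (@ridx A)) (fun A B => fmx (@sidx A B))
    kron1 (fun _ _ _ _ _ _ g f g' f' => kron_mul f g f' g')
    (fun _ _ _ _ f g => dag_kron f g)
    (fun A B C => fmx_unitary (@aidxK A B C) (@aidxVK A B C))
    (fun A => fmx_unitary (@lidxK A) (@lidxVK A))
    (fun A => fmx_unitary (@ridxK A) (@ridxVK A))
    (fun A B => fmx_unitary (@sidxK A B) (@sidxK B A))
    (fun _ _ _ _ _ _ f g h => Mat_assoc_nat f g h)
    (fun _ _ f => Mat_lunit_nat f) (fun _ _ f => Mat_runit_nat f)
    (fun _ _ _ _ f g => Mat_swap_nat f g)
    Mat_pentagon Mat_triangle Mat_hexagon Mat_swapK.

Definition cupmx n : Mx 1 (n * n) :=
  \matrix_(i, j) ((uidx j).1 == (uidx j).2)%:R.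
Definition capmx n : Mx (n * n) 1 :=
  \matrix_(i, j) ((uidx i).1 == (uidx i).2)%:R.

Lemma cupmxE n i j k : cupmx n i (idx (j, k)) = (j == k)%:R.
Proof. by rewrite mxE mxtens_indexK. Qed.
Lemma capmxE n i j k : capmx n (idx (j, k)) i = (j == k)%:R.
Proof. by rewrite mxE mxtens_indexK. Qed.

Lemma dag_cupmx n : dagmx (cupmx n) = capmx n.
Proof. by apply/matrixP => i j; rewrite !mxE rmorph_nat. Qed.

Lemma Mat_capE n : @cap_of Mat_dsm n n (cupmx n) = capmx n.
Proof.
rewrite /cap_of /= dag_cupmx; apply/matrixP => x y.
by case: {x}(mxtens_indexP x) => i j; rewrite fmx_mull idxE !capmxE eq_sym.
Qed.

Lemma mx_bend (m n : nat) (e : Mx (m * n) 1) :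
  dagmx (fmx (@lidx n)) *m (kron (cupmx m) 1%:M *m
    (fmx (@aidx m m n) *m (kron 1%:M e *m fmx (@ridx m)))) =
  \matrix_(j, i) e (idx (i, j)) ord0.
Proof.
apply/matrixP => j i.
rewrite (dag_fmx (@lidxK n) (@lidxVK n)) fmx_mull [RHS]mxE mxE sum_idx.
rewrite -[RHS](sum_dl i (fun k => e (idx (k, j)) ord0)) sum_idx.
rewrite (bigD1 i) //= [X in _ + X]big1 ?addr0.
  apply: eq_bigr => k _.
  rewrite (bigD1 j) //= [X in _ + X]big1 ?addr0.
    rewrite fmx_mull (fmx_mulr _ (@ridxK _) (@ridxVK _)) idxE !kronE cupmxE.
    by rewrite !mxE !eqxx mulr1 mul1r.
  by move=> l ne; rewrite kronE [1%:M j l]mxE eq_sym (negPf ne) mulr0 mul0r.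
move=> k ne; rewrite big1 // => l _; rewrite big1 // => j' _.
rewrite fmx_mull (fmx_mulr _ (@ridxK _) (@ridxVK _)) idxE !kronE.
by rewrite [1%:M k i]mxE (negPf ne) mul0r mulr0.
Qed.

Lemma Mat_snake_dual (n : nat) :
  dagmx (fmx (@lidx n)) *m (kron (cupmx n) 1%:M *m
    (fmx (@aidx n n n) *m (kron 1%:M (@cap_of Mat_dsm n n (cupmx n)) *m
    fmx (@ridx n)))) = 1%:M.
Proof.
rewrite Mat_capE mx_bend; apply/matrixP => i j.
by rewrite mxE capmxE mxE eq_sym.
Qed.

Lemma Mat_snake (n : nat) :
  dagmx (fmx (@ridx n)) *m (kron 1%:M (cupmx n) *m
    (dagmx (fmx (@aidx n n n)) *m (kron (@cap_of Mat_dsm n n (cupmx n)) 1%:M *m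
    fmx (@lidx n)))) = 1%:M.
Proof.
have -> : 1%:M = dagmx 1%:M :> Mx n n by rewrite dagmx1.
rewrite -[in RHS](Mat_snake_dual n) Mat_capE !dag_mul !dag_kron !dagmxK !dagmx1.
have -> : dagmx (capmx n) = cupmx n by rewrite -dag_cupmx dagmxK.
by rewrite dag_cupmx !mulmxA.
Qed.

Definition Mat_dcompact : dcompact_category.
Proof.
refine (@DcompactCategory Mat_dsm id cupmx _ _) => n.
- exact: Mat_snake.
- exact: Mat_snake_dual.
Defined.

End Matrices.

Section Quant.
Variable S : involutive_semiring.
Local Notation Mx m n := 'M[isr S]_(m, n).
Local Notation Mat := (Mat_dcompact S).
Local Notation idx := (@mxtens_index _ _).
Local Notation uidx := (@mxtens_unindex _ _).
Local Notation fmx := (fmx S).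

(* [dmx M] is (M)_* ⊗ M, with (M)_* the entrywise involution of M. *)
Definition dmx m n (M : Mx m n) : Mx (m * m) (n * n) :=
  kron (map_mx (inv S) M) M.

Lemma Mat_bendE (m n : nat) (e : Mx (m * n) 1) :
  @bend Mat m n e = \matrix_(j, i) e (idx (i, j)) ord0.
Proof. exact: mx_bend. Qed.

Lemma Mat_transposeE (m n : nat) (f : Mx m n) : @transpose Mat m n f = f^T.
Proof.
rewrite /transpose Mat_bendE; apply/matrixP => j i.
rewrite /cap /= Mat_capE !mxE sum_idx.
rewrite -[RHS](sum_dr j (f i)); apply: eq_bigr => k _.
rewrite -[RHS](sum_dl j (fun l => f i k * (k == l)%:R)).
by apply: eq_bigr => l _; rewrite kronE capmxE [1%:M _ _]mxE mulrAC mulrC.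
Qed.

Lemma Mat_conjE (m n : nat) (f : Mx m n) :
  @conj Mat m n f = map_mx (inv S) f.
Proof.
by rewrite /conj Mat_transposeE; apply/matrixP => i j; rewrite !mxE.
Qed.

Lemma Mat_dblmE (m n : nat) (f : Mx m n) : @dblm Mat m n f = dmx f.
Proof. by rewrite /dblm Mat_conjE. Qed.

Definition msidx a b c d (x : 'I_(a * b * (c * d))) : 'I_(a * c * (b * d)) :=
  idx (idx ((uidx (uidx x).1).1, (uidx (uidx x).2).1),
       idx ((uidx (uidx x).1).2, (uidx (uidx x).2).2)).

Lemma msidxE a b c d i j k l :
  @msidx a b c d (idx (idx (i, j), idx (k, l))) = idx (idx (i, k), idx (j, l)).
Proof. by rewrite /msidx !mxtens_indexK. Qed.

Lemma msidxK a b c d : cancel (@msidx a b c d) (@msidx a c b d).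
Proof.
move=> x; case: {x}(mxtens_indexP x) => x y.
case: {x}(mxtens_indexP x) => i j; case: {y}(mxtens_indexP y) => k l.
by rewrite !msidxE.
Qed.

Lemma Mat_midswapE (a b c d : nat) :
  @midswap Mat a b c d = fmx (@msidx a b c d).
Proof.
rewrite /midswap /= !(dag_fmx _ (@aidxK _ _ _) (@aidxVK _ _ _)) !fmx_id.
rewrite !(fmx_comp, kron_fmx); apply: eq_fmx => x.
case: {x}(mxtens_indexP x) => x y.
case: {x}(mxtens_indexP x) => i j; case: {y}(mxtens_indexP y) => k l.
by rewrite /= !(msidxE, idxE, mxtens_indexK).
Qed.

Lemma Mat_dual_tensE (m n : nat) : @dual_tens Mat m n = 1%:M.
Proof.
rewrite /dual_tens Mat_midswapE Mat_bendE /cap /= !Mat_capE; apply/matrixP => x y.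
case: {x}(mxtens_indexP x) => i j; case: {y}(mxtens_indexP y) => k l.
rewrite mxE fmx_mull msidxE (fmx_mulr _ (@lidxK _) (@lidxVK _)).
by rewrite kronE !capmxE mxE idx_eq -natrM mulnb [k == i]eq_sym [l == j]eq_sym.
Qed.

Lemma Mat_dbl_tensE (m n : nat) : @dbl_tens Mat m n = fmx (@msidx m m n n).
Proof.
rewrite /dbl_tens Mat_dual_tensE Mat_midswapE /= kron1; apply: mulmx1.
Qed.

Lemma Mat_cpmE (n k m : nat) (f : Mx n (k * m)) :
  @cpm Mat n m k f = \sum_c dmx (\matrix_(x, y) f x (idx (c, y))).
Proof.
rewrite /cpm Mat_dbl_tensE Mat_dblmE /= dag_cupmx.
rewrite (dag_fmx _ (@msidxK _ _ _ _) (@msidxK _ _ _ _)).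
apply/matrixP => x y; case: {x}(mxtens_indexP x) => x' x.
case: {y}(mxtens_indexP y) => y' y.
rewrite mxE sum_idx sum_idx summxE; apply: eq_bigr => c _.
rewrite /dmx kronE !mxE -(sum_dr y' (fun z => inv S (f x' (idx (c, z))))) mulr_suml.
apply: eq_bigr => z' _; rewrite sum_idx.
rewrite -(sum_dr c (fun b => inv S (f x' (idx (c, z'))) * (z' == y')%:R
                             * f x (idx (b, y)))).
apply: eq_bigr => b _.
rewrite -(sum_dr y (fun z => inv S (f x' (idx (c, z'))) * (z' == y')%:R
                             * f x (idx (b, z)))) mulr_suml.
apply: eq_bigr => z _.
rewrite kronE fmx_mull msidxE (fmx_mulr _ (@lidxK _) (@lidxVK _)) kronE capmxE.
rewrite !mxE idx_eq -mulnb natrM eq_sym -!mulrA; congr (_ * _).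
by rewrite [RHS]mulrCA; congr (_ * _); rewrite mulrC mulrA.
Qed.

(* The morphisms of CPM(Mat_S) are the finite sums of matrices (M_i)_* ⊗ M_i. *)
Lemma Mat_cpmP (n m : nat) (q : Mx (n * n) (m * m)) :
  @is_cpm Mat n m q <->
  exists (k : nat) (M : 'I_k -> Mx n m), q = \sum_i dmx (M i).
Proof.
split=> [[k [f ->]]|[k [M ->]]].
  by exists k, (fun c => \matrix_(x, y) f x (idx (c, y))); exact: Mat_cpmE.
exists k, (\matrix_(x, y) M (uidx y).1 x (uidx y).2); rewrite Mat_cpmE.
apply: eq_bigr => c _; congr dmx; apply/matrixP => x y.
by rewrite !mxE mxtens_indexK.
Qed.

Lemma cpm_sum (T : finType) (n m : nat) (M : T -> Mx n m) :
  @is_cpm Mat n m (\sum_t dmx (M t)).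
Proof.
apply/Mat_cpmP; exists #|T|, (fun i => M (enum_val i)).
by rewrite -(big_enum_val (fun t => dmx (M t))) /=; apply: eq_bigl.
Qed.

Lemma dmx_mul (m n p : nat) (f : Mx m n) (g : Mx n p) :
  dmx (f *m g) = dmx f *m dmx g.
Proof.
rewrite /dmx -kron_mul; congr kron; apply/matrixP => i j.
by rewrite !mxE rmorph_sum; apply: eq_bigr => k _; rewrite !mxE rmorphM.
Qed.

Lemma dmx_dag (m n : nat) (f : Mx m n) : dmx (dagmx f) = dagmx (dmx f).
Proof.
by rewrite /dmx dag_kron; congr kron; apply/matrixP => i j; rewrite !mxE.
Qed.

Lemma dmx_fmx (m n : nat) (f : 'I_m -> 'I_n) : dmx (fmx f) = fmx (tfun f f).
Proof.
rewrite /dmx -kron_fmx; congr kron.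
by apply/matrixP => i j; rewrite !mxE rmorph_nat.
Qed.

Lemma dmx1 (n : nat) : dmx 1%:M = 1%:M :> Mx (n * n) (n * n).
Proof. by rewrite -kron1 /dmx map_mx1. Qed.

Lemma cpm_dmx (n m : nat) (f : Mx n m) : @is_cpm Mat n m (dmx f).
Proof.
have -> : dmx f = \sum_(t : unit) dmx f by rewrite big_const card_unit /= addr0.
exact: cpm_sum.
Qed.

Lemma cpm_comp (n m p : nat) (r : Mx (m * m) (p * p)) (q : Mx (n * n) (m * m)) :
  @is_cpm Mat m p r -> @is_cpm Mat n m q -> @is_cpm Mat n p (q *m r).
Proof.
case/Mat_cpmP=> k [M ->] /Mat_cpmP[l [N ->]].
rewrite mulmx_suml; under eq_bigr => i _ do rewrite mulmx_sumr.
rewrite pair_big /=; under eq_bigr => i _ do rewrite -dmx_mul.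
exact: cpm_sum.
Qed.

Lemma dagmx_sum (I : finType) (n m : nat) (F : I -> Mx n m) :
  dagmx (\sum_i F i) = \sum_i dagmx (F i).
Proof.
apply/matrixP => i j; rewrite !mxE !summxE rmorph_sum.
by apply: eq_bigr => k _; rewrite mxE.
Qed.

Lemma cpm_dag (n m : nat) (q : Mx (n * n) (m * m)) :
  @is_cpm Mat n m q -> @is_cpm Mat m n (dagmx q).
Proof.
case/Mat_cpmP=> k [M ->]; rewrite dagmx_sum.
by under eq_bigr => i _ do rewrite -dmx_dag; exact: cpm_sum.
Qed.

Lemma dag_msidx (a b c d : nat) :
  dagmx (fmx (@msidx a b c d)) = fmx (@msidx a c b d).
Proof. exact: (dag_fmx _ (@msidxK _ _ _ _) (@msidxK _ _ _ _)). Qed.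

Lemma msidx_mul (a b c d : nat) :
  fmx (@msidx a b c d) *m fmx (@msidx a c b d) = 1%:M.
Proof. by rewrite fmx_comp fmx_id; apply: eq_fmx; exact: msidxK. Qed.

Definition qtens (n m n' m' : nat) (q : Mx (n * n) (m * m))
    (r : Mx (n' * n') (m' * m')) : Mx (n * n' * (n * n')) (m * m' * (m * m')) :=
  @cpm_tensm Mat n m n' m' q r.

Lemma qtens_def (n m n' m' : nat) (q : Mx (n * n) (m * m))
    (r : Mx (n' * n') (m' * m')) :
  qtens q r = fmx (@msidx n n' n n') *m (kron q r *m fmx (@msidx m m m' m')).
Proof. by rewrite /qtens /cpm_tensm !Mat_dbl_tensE /= dag_msidx. Qed.

Lemma qtensE (n m n' m' : nat) (q : Mx (n * n) (m * m))
    (r : Mx (n' * n') (m' * m')) i k i' k' j l j' l' :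
  qtens q r (idx (idx (i', k'), idx (i, k))) (idx (idx (j', l'), idx (j, l))) =
  q (idx (i', i)) (idx (j', j)) * r (idx (k', k)) (idx (l', l)).
Proof.
rewrite qtens_def fmx_mull (fmx_mulr _ (@msidxK _ _ _ _) (@msidxK _ _ _ _)).
by rewrite !msidxE kronE.
Qed.

Lemma qtens_dmx (n m n' m' : nat) (f : Mx n m) (g : Mx n' m') :
  qtens (dmx f) (dmx g) = dmx (kron f g).
Proof.
apply/matrixP => x y.
case: {x}(mxtens_indexP x) => x x'; case: {y}(mxtens_indexP y) => y y'.
case: {x}(mxtens_indexP x) => i j; case: {y}(mxtens_indexP y) => k l.
case: {x'}(mxtens_indexP x') => i' j'; case: {y'}(mxtens_indexP y') => k' l'.
rewrite qtensE /dmx !kronE mulrACA; congr (_ * _).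
by rewrite !mxE !mxtens_indexK rmorphM.
Qed.

Lemma cpm_tens (n m n' m' : nat) (q : Mx (n * n) (m * m))
    (r : Mx (n' * n') (m' * m')) :
  @is_cpm Mat n m q -> @is_cpm Mat n' m' r ->
  @is_cpm Mat (n * n')%N (m * m')%N (qtens q r).
Proof.
case/Mat_cpmP=> k [M ->] /Mat_cpmP[l [N ->]].
have -> : qtens (\sum_i dmx (M i)) (\sum_i dmx (N i)) =
          \sum_(p : 'I_k * 'I_l) dmx (kron (M p.1) (N p.2)).
  under [RHS]eq_bigr => p _ do rewrite -qtens_dmx.
  apply/matrixP => x y; rewrite summxE.
  case: {x}(mxtens_indexP x) => x x'; case: {y}(mxtens_indexP y) => y y'.
  case: {x}(mxtens_indexP x) => i j; case: {y}(mxtens_indexP y) => i1 j1.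
  case: {x'}(mxtens_indexP x') => i' j'; case: {y'}(mxtens_indexP y') => i1' j1'.
  rewrite qtensE !summxE mulr_suml.
  under eq_bigr => a _ do rewrite mulr_sumr.
  by rewrite pair_big /=; apply: eq_bigr => a _; rewrite qtensE.
exact: cpm_sum.
Qed.

Lemma qtens1 (n m : nat) :
  qtens 1%:M 1%:M = 1%:M :> Mx (n * m * (n * m)) (n * m * (n * m)).
Proof. by rewrite qtens_def kron1 mul1mx msidx_mul. Qed.

Lemma qtens_mul (m n p m' n' p' : nat)
    (A : Mx (m * m) (n * n)) (B : Mx (n * n) (p * p))
    (A' : Mx (m' * m') (n' * n')) (B' : Mx (n' * n') (p' * p')) :
  qtens (A *m B) (A' *m B') = qtens A A' *m qtens B B'.
Proof.
rewrite !qtens_def kron_mul -!mulmxA [fmx _ *m (fmx _ *m _)]mulmxA.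
by rewrite msidx_mul mul1mx.
Qed.

Lemma dag_qtens (m n m' n' : nat) (q : Mx (m * m) (n * n))
    (r : Mx (m' * m') (n' * n')) :
  dagmx (qtens q r) = qtens (dagmx q) (dagmx r).
Proof. by rewrite !qtens_def !dag_mul !dag_msidx dag_kron mulmxA. Qed.

Lemma cpm_disc_cpm (n : nat) : @is_cpm Mat n 1%N (@cpm_disc Mat n).
Proof.
have -> : @cpm_disc Mat n = \sum_(c < n) dmx (\matrix_(x, y) (x == c)%:R).
  rewrite /cpm_disc /= dag_cupmx; apply/matrixP => x y.
  case: {x}(mxtens_indexP x) => i j; case: {y}(mxtens_indexP y) => k l.
  rewrite mxE big_ord1 capmxE cupmxE [k]ord1 [l]ord1 eqxx mulr1 summxE.
  rewrite -(sum_dl i (fun c => (c == j)%:R)); apply: eq_bigr => c _.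
  by rewrite /dmx kronE !mxE rmorph_nat [c == j]eq_sym.
exact: cpm_sum.
Qed.

Lemma cpm_discE (n : nat) i j k :
  @cpm_disc Mat n (idx (i, j)) k = (i == j)%:R.
Proof.
case: {k}(mxtens_indexP k) => k l; rewrite /cpm_disc /= dag_cupmx.
by rewrite mxE big_ord1 capmxE cupmxE [k]ord1 [l]ord1 eqxx mulr1.
Qed.

Lemma qtens_assoc (A B C A' B' C' : nat) (f : Mx (A * A) (A' * A'))
    (g : Mx (B * B) (B' * B')) (h : Mx (C * C) (C' * C')) :
  qtens (qtens f g) h *m dmx (fmx (@aidx A' B' C')) =
  dmx (fmx (@aidx A B C)) *m qtens f (qtens g h).
Proof.
rewrite !dmx_fmx; apply/matrixP => x y.
case: {x}(mxtens_indexP x) => x x'.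
case: {x}(mxtens_indexP x) => x k; case: {x}(mxtens_indexP x) => i j.
case: {x'}(mxtens_indexP x') => x k'; case: {x}(mxtens_indexP x) => i' j'.
case: {y}(mxtens_indexP y) => y y'.
case: {y}(mxtens_indexP y) => i1 y; case: {y}(mxtens_indexP y) => j1 k1.
case: {y'}(mxtens_indexP y') => i1' y; case: {y}(mxtens_indexP y) => j1' k1'.
have aK := tfunK (@aidxK A' B' C') (@aidxK A' B' C').
have aVK := tfunK (@aidxVK A' B' C') (@aidxVK A' B' C').
by rewrite (fmx_mulr _ aK aVK) fmx_mull !idxE !qtensE mulrA.
Qed.

Lemma qtens_lunit (A B : nat) (f : Mx (A * A) (B * B)) :
  qtens 1%:M f *m dmx (fmx (@lidx B)) = dmx (fmx (@lidx A)) *m f.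
Proof.
rewrite !dmx_fmx; apply/matrixP => x y.
case: {x}(mxtens_indexP x) => x x'; case: {y}(mxtens_indexP y) => y y'.
case: {x}(mxtens_indexP x) => i j; case: {x'}(mxtens_indexP x') => i' j'.
have lK := tfunK (@lidxK B) (@lidxK B).
have lVK := tfunK (@lidxVK B) (@lidxVK B).
rewrite (fmx_mulr _ lK lVK) fmx_mull !idxE /lidxV qtensE [i]ord1 [i']ord1.
by rewrite !mxE eqxx mul1r.
Qed.

Lemma qtens_runit (A B : nat) (f : Mx (A * A) (B * B)) :
  qtens f 1%:M *m dmx (fmx (@ridx B)) = dmx (fmx (@ridx A)) *m f.
Proof.
rewrite !dmx_fmx; apply/matrixP => x y.
case: {x}(mxtens_indexP x) => x x'; case: {y}(mxtens_indexP y) => y y'.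
case: {x}(mxtens_indexP x) => i j; case: {x'}(mxtens_indexP x') => i' j'.
have rK := tfunK (@ridxK B) (@ridxK B).
have rVK := tfunK (@ridxVK B) (@ridxVK B).
rewrite (fmx_mulr _ rK rVK) fmx_mull !idxE /ridxV qtensE [j]ord1 [j']ord1.
by rewrite [1%:M _ _]mxE eqxx mulr1.
Qed.

Lemma qtens_swap (A B A' B' : nat) (f : Mx (A * A) (A' * A'))
    (g : Mx (B * B) (B' * B')) :
  qtens f g *m dmx (fmx (@sidx A' B')) = dmx (fmx (@sidx A B)) *m qtens g f.
Proof.
rewrite !dmx_fmx; apply/matrixP => x y.
case: {x}(mxtens_indexP x) => x x'; case: {y}(mxtens_indexP y) => y y'.
case: {x}(mxtens_indexP x) => i j; case: {x'}(mxtens_indexP x') => i' j'.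
case: {y}(mxtens_indexP y) => k l; case: {y'}(mxtens_indexP y') => k' l'.
have sK := tfunK (@sidxK A' B') (@sidxK A' B').
have sVK := tfunK (@sidxK B' A') (@sidxK B' A').
by rewrite (fmx_mulr _ sK sVK) fmx_mull !idxE !qtensE mulrC.
Qed.

Definition Quant_hom (n m : nat) : Type := @cpm_hom Mat n m.

Definition Quant_of (n m : nat) (q : Mx (n * n) (m * m))
  (h : @is_cpm Mat n m q) : Quant_hom n m := exist _ q h.

(* The image of a morphism of Mat_S under M |-> (M)_* ⊗ M. *)
Definition Quant_pure (n m : nat) (f : Mx n m) : Quant_hom n m :=
  exist _ (@dblm Mat n m f) (eq_ind_r _ (cpm_dmx f) (Mat_dblmE f)).

Definition Quant_category : category.
Proof.
refine (@Category nat Quant_hom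
  (fun n => Quant_of (eq_ind _ _ (cpm_dmx 1%:M) _ (dmx1 n)))
  (fun _ _ _ g f => Quant_of (cpm_comp (svalP g) (svalP f))) _ _ _).
- by move=> A B f; apply: cpm_homP; apply: (comp1m (c := Mat)).
- by move=> A B f; apply: cpm_homP; apply: (compm1 (c := Mat)).
- by move=> A B C D h g f; apply: cpm_homP; apply: (compA (c := Mat)).
Defined.

Definition Quant_dagger_category : dagger_category.
Proof.
refine (@DaggerCategory Quant_category
  (fun _ _ f => Quant_of (cpm_dag (svalP f))) _ _ _).
- by move=> A; apply: cpm_homP; apply: (dag1 (d := Mat)).
- by move=> A B C g f; apply: cpm_homP; apply: (dag_comp (d := Mat)).
- by move=> A B f; apply: cpm_homP; apply: (dagK (d := Mat)).
Defined.

Lemma Quant_unitary (A B : nat) (f : Mx A B) :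
  @unitary Mat A B f -> @unitary Quant_dagger_category A B (Quant_pure f).
Proof.
rewrite /unitary /isometry /= => -[h1 h2]; split; apply: cpm_homP => /=.
  by rewrite Mat_dblmE -dmx_dag -dmx_mul h1 dmx1.
by rewrite Mat_dblmE -dmx_dag -dmx_mul h2 dmx1.
Qed.

Definition Quant_dsm : dsm_category.
Proof.
refine (@DsmCategory Quant_dagger_category 1%N muln
  (fun _ _ _ _ f g => Quant_of (cpm_tens (svalP f) (svalP g)))
  (fun A B C => Quant_pure (@assoc Mat A B C))
  (fun A => Quant_pure (@lunit Mat A))
  (fun A => Quant_pure (@runit Mat A))
  (fun A B => Quant_pure (@swap Mat A B))
  _ _ _ _ _ _ _ _ _ _ _ _ _ _ _).
- by move=> A B; apply: cpm_homP; apply: qtens1.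
- by move=> A B C A' B' C' g f g' f'; apply: cpm_homP; apply: qtens_mul.
- by move=> A B C D f g; apply: cpm_homP; apply: dag_qtens.
- by move=> A B C; apply: Quant_unitary; apply: assoc_unitary.
- by move=> A; apply: Quant_unitary; apply: lunit_unitary.
- by move=> A; apply: Quant_unitary; apply: runit_unitary.
- by move=> A B; apply: Quant_unitary; apply: swap_unitary.
- move=> A B C A' B' C' f g h; apply: cpm_homP; rewrite /= !Mat_dblmE.
  exact: qtens_assoc.
- by move=> A B f; apply: cpm_homP; rewrite /= !Mat_dblmE; apply: qtens_lunit.
- by move=> A B f; apply: cpm_homP; rewrite /= !Mat_dblmE; apply: qtens_runit.
- move=> A B A' B' f g; apply: cpm_homP; rewrite /= !Mat_dblmE.
  exact: qtens_swap.
- move=> A B C D; apply: cpm_homP; rewrite /= !Mat_dblmE -(dmx1 A) -(dmx1 D).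
  by rewrite !qtens_dmx -!dmx_mul Mat_pentagon.
- move=> A B; apply: cpm_homP; rewrite /= !Mat_dblmE -(dmx1 A) -(dmx1 B).
  by rewrite !qtens_dmx -!dmx_mul Mat_triangle.
- move=> A B C; apply: cpm_homP; rewrite /= !Mat_dblmE -(dmx1 B) -(dmx1 C).
  by rewrite !qtens_dmx -!dmx_mul Mat_hexagon.
- move=> A B; apply: cpm_homP; rewrite /= !Mat_dblmE.
  by rewrite -!dmx_mul Mat_swapK dmx1.
Defined.

Definition Quant_discarding : discarding Quant_dsm.
Proof.
refine (@Discarding Quant_dsm (fun A => Quant_of (cpm_disc_cpm A)) _ _).
- move=> A B; apply: cpm_homP; rewrite /= Mat_dblmE dmx_fmx.
  apply/matrixP => x y; rewrite (fmx_mulr _ (tfunK (@lidxK 1) (@lidxK 1))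
    (tfunK (@lidxVK 1) (@lidxVK 1))).
  case: {x}(mxtens_indexP x) => x x'; case: {y}(mxtens_indexP y) => y y'.
  case: {x}(mxtens_indexP x) => i j; case: {x'}(mxtens_indexP x') => i' j'.
  by rewrite cpm_discE tfunE /lidxV qtensE !cpm_discE idx_eq -natrM mulnb.
- apply: cpm_homP; apply/matrixP => x y /=.
  case: {x}(mxtens_indexP x) => i j; case: {y}(mxtens_indexP y) => k l.
  by rewrite cpm_discE mxE idx_eq [i]ord1 [j]ord1 [k]ord1 [l]ord1 !eqxx.
Defined.

(* Quant_S = CPM(Mat_S), with the hom-sets, composition, dagger, tensor and
   discarding of the section CPM taken in Mat_S. *)
Definition Quant : dagger_theory := DaggerTheory Quant_discarding.

Definition Spos : Type := {s : S | exists t : S, s = inv S t * t}.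

Lemma Spos1_proof : exists t : S, 1 = inv S t * t.
Proof. by exists 1; rewrite rmorph1 mulr1. Qed.

Lemma SposM_proof (x y : Spos) : exists t : S, sval x * sval y = inv S t * t.
Proof.
case: x y => [x [s xE]] [y [t yE]] /=.
by exists (s * t); rewrite xE yE rmorphM mulrACA.
Qed.

Definition Spos1 : Spos := exist _ 1 Spos1_proof.
Definition SposM (x y : Spos) : Spos := exist _ (sval x * sval y) (SposM_proof x y).

End Quant.

Definition monoid_isomorphic (M N : Type) (oneM : M) (mulM : M -> M -> M)
    (oneN : N) (mulN : N -> N -> N) : Prop :=
  exists phi : M -> N,
    [/\ bijective phi, phi oneM = oneN
      & forall x y : M, phi (mulM x y) = mulN (phi x) (phi y)].

Definition scalars_iso_Spos (C : dcompact_category) (S : involutive_semiring) :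
    Prop :=
  monoid_isomorphic (idm (Iob (d := C))) (fun g f : hom Iob Iob => comp g f)
    (Spos1 S) (@SposM S).

(* Main.v *)
From HB Require Import structures.
From mathcomp Require Import all_boot all_algebra.
From mathcomp Require Import boolp.
From mathcomp Require Import mxtens.
Require Import Defs.

(* Write [P] for the pure subcategory, [A+] for a phased biproduct of [A] and [I], and
   [T] for [I+].  An endomorphism of [P] between objects [I ∔ ... ∔ I] should be a matrix
   up to phases; fixing the summand [I] of [A+ -> B+] removes the phase ambiguity, so
   that the pointed maps [A+ -> B+] form a category with dagger biproducts lying over
   [P], and the semiring [S] is its monoid of scalars, the pointed maps [T -> T].
   Everything rests on the phases being scalars: by compactness the phases of [X ⊗ T]
   are the [1 ⊗ v], and each biproduct [W] embeds into [W ⊗ T], diagonally and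
   naturally.  Sums of pointed maps are [f + g = Delta† (f ⊗ g) Delta], where
   [Delta : A+ -> A+ ⊗ A+] is the coproduct [x |-> x ⊗ 1 + 1 ⊗ x].  Pointed maps between
   sums of copies of [I] are then matrices over [S], and they project onto [P], giving a
   dagger monoidal functor [Qm] from matrices to [P].
   A morphism of [Quant S] is [sum_c (M_c)_* ⊗ M_c] for a matrix [M : n -> m * k], and
   it is sent to [Qm M] with the output of dimension [k] discarded.  After bending wires,
   two such images agree iff [Qm (M M†) = Qm (N N†)], by the environment axiom, iff
   [M M† = N N†], by the last superposition property, iff the morphisms of [Quant S]
   agree: so the functor is well defined and faithful. *)

Set Implicit Arguments.
Unset Strict Implicit.
Unset Printing Implicit Defensive.

Import GRing.Theory.

Local Open Scope cat_scope.

(** * Kets in a dagger symmetric monoidal category *)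

(** The obstacle is that a map out of [A ∔ B] is determined by its components only up to a phase, so
    copairing, and with it any sum of morphisms or scalars, is not a function on the pure category.
    The summand [Iob] added in [pl A] serves as a phase reference; a scalar of the pure category has
    many lifts to [S], and only [s^† s] does not depend on the lift, whence [S^pos]. The last
    superposition property makes phases unitary. Two devices then turn equality up to a phase into
    equality: [pb_range], where an idempotent absorbs the phase, and [pb_eq_sec], where a retraction
    does. They are applied repeatedly, because each structure map obtained from [pb_ex] is itself
    free up to a phase. Bending is forced by the form of the environment axiom: it compares
    morphisms whose whole output is discarded, so an output that is kept must first become an
    input. *)

(* Composites are kept associated to the left; [pre] rewrites inside them. *)
Lemma pre (C : category) (A B D : C) (g : hom B D) (f : hom A B) (h : hom A D) :
  g ∘ f = h -> forall (X : C) (x : hom D X), x ∘ g ∘ f = x ∘ h.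
Proof. by move=> <- X x; rewrite compA. Qed.

Lemma pre3 (C : category) (A B D E : C) (h : hom D E) (g : hom B D)
  (f : hom A B) (k : hom A E) :
  h ∘ g ∘ f = k -> forall (X : C) (x : hom E X), x ∘ h ∘ g ∘ f = x ∘ k.
Proof. by move=> <- X x; rewrite !compA. Qed.

Lemma id_coiso (C : dagger_category) (A : C) : idm A ∘ (idm A)^† = idm A.
Proof. by rewrite dag1 comp1m. Qed.

Section DaggerCategories.
Variable C : dagger_category.
Implicit Types A B D X : C.

Lemma iso_inj A B X (f : hom A B) (x y : hom X A) :
  f^† ∘ f = idm A -> f ∘ x = f ∘ y -> x = y.
Proof. by move=> i e; rewrite -[x]comp1m -[y]comp1m -i -!compA e. Qed.

Lemma coiso_inj A B X (f : hom A B) (x y : hom B X) :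
  f ∘ f^† = idm B -> x ∘ f = y ∘ f -> x = y.
Proof. by move=> i e; rewrite -[x]compm1 -[y]compm1 -i !compA e. Qed.

Lemma dag_inj A B (f g : hom A B) : f^† = g^† -> f = g.
Proof. by move=> e; rewrite -[f]dagK e dagK. Qed.

Lemma iso_comp A B D (g : hom B D) (f : hom A B) :
  g^† ∘ g = idm B -> f^† ∘ f = idm A -> (g ∘ f)^† ∘ (g ∘ f) = idm A.
Proof. by move=> ig i; rewrite dag_comp compA (pre ig) compm1. Qed.

Lemma shift_l A B X (f : hom A B) (x : hom X A) (y : hom X B) :
  f^† ∘ f = idm A -> f ∘ x = y -> x = f^† ∘ y.
Proof. by move=> i <-; rewrite compA i comp1m. Qed.

Lemma shift_r A B X (f : hom A B) (x : hom B X) (y : hom A X) :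
  f ∘ f^† = idm B -> x ∘ f = y -> x = y ∘ f^†.
Proof. by move=> i <-; rewrite -compA i compm1. Qed.

End DaggerCategories.

Section Kets.
Variable C : dsm_category.
Implicit Types A B D X Y : C.

Lemma assocK A B D : (assoc A B D)^† ∘ assoc A B D = idm _.
Proof. by case: (assoc_unitary A B D). Qed.
Lemma assocVK A B D : assoc A B D ∘ (assoc A B D)^† = idm _.
Proof. by case: (assoc_unitary A B D). Qed.
Lemma lunitK A : (lunit A)^† ∘ lunit A = idm _.
Proof. by case: (lunit_unitary A). Qed.
Lemma lunitVK A : lunit A ∘ (lunit A)^† = idm _.
Proof. by case: (lunit_unitary A). Qed.
Lemma runitK A : (runit A)^† ∘ runit A = idm _.
Proof. by case: (runit_unitary A). Qed.
Lemma runitVK A : runit A ∘ (runit A)^† = idm _.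
Proof. by case: (runit_unitary A). Qed.

Lemma dag_swap A B : (swap A B)^† = swap B A.
Proof.
by rewrite (shift_l (proj1 (swap_unitary A B)) (swapK B A)) compm1.
Qed.

Lemma tens_inter A B D A' B' D' (g : hom B D) (f : hom A B) (g' : hom B' D')
  (f' : hom A' B') : (g ⊠ g') ∘ (f ⊠ f') = (g ∘ f) ⊠ (g' ∘ f').
Proof. by rewrite tensm_comp. Qed.

Lemma tens_split A B A' B' (f : hom A B) (g : hom A' B') :
  f ⊠ g = (f ⊠ idm _) ∘ (idm _ ⊠ g).
Proof. by rewrite tens_inter compm1 comp1m. Qed.

Lemma tens_split' A B A' B' (f : hom A B) (g : hom A' B') :
  f ⊠ g = (idm _ ⊠ g) ∘ (f ⊠ idm _).
Proof. by rewrite tens_inter compm1 comp1m. Qed.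

Lemma lunitV_nat A B (f : hom A B) :
  (idm Iob ⊠ f) ∘ (lunit A)^† = (lunit B)^† ∘ f.
Proof.
by apply: dag_inj; rewrite !dag_comp dag_tensm !dagK dag1 lunit_nat.
Qed.

Lemma runitV_nat A B (f : hom A B) :
  (f ⊠ idm Iob) ∘ (runit A)^† = (runit B)^† ∘ f.
Proof.
by apply: dag_inj; rewrite !dag_comp dag_tensm !dagK dag1 runit_nat.
Qed.

Lemma assocV_nat A B D A' B' D' (f : hom A A') (g : hom B B') (h : hom D D') :
  (assoc A' B' D')^† ∘ (f ⊠ (g ⊠ h)) = (f ⊠ g ⊠ h) ∘ (assoc A B D)^†.
Proof.
by apply: dag_inj; rewrite !dag_comp !dag_tensm !dagK assoc_nat.
Qed.

Lemma tensI_inj A B (f g : hom A B) : idm Iob ⊠ f = idm Iob ⊠ g -> f = g.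
Proof.
move=> e; apply: (coiso_inj (lunitVK A)).
by rewrite -!lunit_nat e.
Qed.

Lemma Itens_inj A B (f g : hom A B) : f ⊠ idm Iob = g ⊠ idm Iob -> f = g.
Proof.
move=> e; apply: (coiso_inj (runitVK A)).
by rewrite -!runit_nat e.
Qed.

Lemma tens_iso A B A' B' (f : hom A B) (g : hom A' B') :
  f^† ∘ f = idm A -> g^† ∘ g = idm A' -> (f ⊠ g)^† ∘ (f ⊠ g) = idm _.
Proof. by move=> i j; rewrite dag_tensm tens_inter i j tensm1. Qed.

Lemma tens_coiso A B A' B' (f : hom A B) (g : hom A' B') :
  f ∘ f^† = idm B -> g ∘ g^† = idm B' -> (f ⊠ g) ∘ (f ⊠ g)^† = idm _.
Proof. by move=> i j; rewrite dag_tensm tens_inter i j tensm1. Qed.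

(* Kelly's derivation of the redundant coherence conditions. *)
Lemma lunit_assoc A B : lunit (A ⊗ B) ∘ assoc Iob A B = lunit A ⊠ idm B.
Proof.
apply: tensI_inj.
apply: (coiso_inj (assocVK _ _ _)).
apply: (coiso_inj (tens_coiso (assocVK Iob Iob A) (id_coiso B))).
have -> : idm Iob ⊠ (lunit (A ⊗ B) ∘ assoc Iob A B) =
  (idm Iob ⊠ lunit (A ⊗ B)) ∘ (idm Iob ⊠ assoc Iob A B).
  by rewrite tens_inter comp1m.
rewrite (pre3 (esym (pentagon _ _ _ _))) compA triangle -tensm1 -assoc_nat.
by rewrite -triangle -assoc_nat -compA tens_inter comp1m.
Qed.

Lemma runit_assoc A B : (idm A ⊠ runit B) ∘ assoc A B Iob = runit (A ⊗ B).
Proof.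
apply: Itens_inj; apply: (iso_inj (assocK _ _ _)).
rewrite -triangle -[in RHS]tensm1 compA.
have -> : ((idm A ⊠ runit B) ∘ assoc A B Iob) ⊠ idm Iob =
  ((idm A ⊠ runit B) ⊠ idm Iob) ∘ (assoc A B Iob ⊠ idm Iob).
  by rewrite tens_inter comp1m.
rewrite compA assoc_nat -triangle assoc_nat (pre (pentagon _ _ _ _)) !compA.
by rewrite tens_inter comp1m.
Qed.

Lemma lunit_tensI A : lunit (Iob ⊗ A) = idm Iob ⊠ lunit A.
Proof. by apply: (iso_inj (lunitK A)); rewrite lunit_nat. Qed.

Lemma lunitI : lunit Iob = runit (Iob : C).
Proof.
by apply: Itens_inj; rewrite -triangle -lunit_tensI lunit_assoc.
Qed.

(** The hexagon with two unit objects, reduced by the triangle; [x] is unitary and can be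
    cancelled. *)
Lemma lunit_swap A : lunit A ∘ swap A Iob = runit A.
Proof.
set x := lunit A ∘ swap A Iob.
have xi : x ∘ x^† = idm _.
  by rewrite dag_comp dag_swap compA (pre (swapK _ _)) compm1 lunitVK.
have xk : x^† ∘ x = idm _.
  by rewrite dag_comp dag_swap compA (pre (lunitK _)) compm1 swapK.
apply: Itens_inj; apply: (iso_inj xk).
have -> : x ∘ (x ⊠ idm Iob) = x ∘ (lunit A ⊠ idm Iob) ∘ (swap A Iob ⊠ idm Iob).
  by rewrite -compA tens_inter comp1m.
rewrite -lunit_assoc compA -lunit_nat.
have -> : idm Iob ⊠ x = (idm Iob ⊠ lunit A) ∘ (idm Iob ⊠ swap A Iob).
  by rewrite tens_inter comp1m.
have := pre3 (esym (hexagon A Iob Iob)) (lunit A ∘ (idm Iob ⊠ lunit A)).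
rewrite !compA => ->.
rewrite (pre (triangle _ _)) -lunitI (pre (esym (swap_nat _ _))) compA.
by rewrite (pre (triangle _ _)).
Qed.

(* Locked, like the other composites below: rewriting with [compA] would unfold it. *)
Definition rk X (p : hom Iob X) A : hom A (A ⊗ X) :=
  locked ((idm A ⊠ p) ∘ (runit A)^†).
Definition lk X (p : hom Iob X) A : hom A (X ⊗ A) :=
  locked ((p ⊠ idm A) ∘ (lunit A)^†).

Lemma rkE X (p : hom Iob X) A : rk p A = (idm A ⊠ p) ∘ (runit A)^†.
Proof. by rewrite /rk -lock. Qed.
Lemma lkE X (p : hom Iob X) A : lk p A = (p ⊠ idm A) ∘ (lunit A)^†.
Proof. by rewrite /lk -lock. Qed.

Lemma tens_rk A B X Y (f : hom A B) (g : hom X Y) (p : hom Iob X) :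
  (f ⊠ g) ∘ rk p A = rk (g ∘ p) B ∘ f.
Proof.
by rewrite !rkE compA tens_inter compm1 (tens_split' f) -compA runitV_nat compA.
Qed.

Lemma tens_lk A B X Y (f : hom A B) (g : hom X Y) (p : hom Iob X) :
  (g ⊠ f) ∘ lk p A = lk (g ∘ p) B ∘ f.
Proof.
by rewrite !lkE compA tens_inter compm1 (tens_split _ f) -compA lunitV_nat compA.
Qed.

Lemma tens1_rk A X Y (g : hom X Y) (p : hom Iob X) :
  (idm A ⊠ g) ∘ rk p A = rk (g ∘ p) A.
Proof. by rewrite tens_rk compm1. Qed.
Lemma rk_nat A B X (f : hom A B) (p : hom Iob X) :
  (f ⊠ idm X) ∘ rk p A = rk p B ∘ f.
Proof. by rewrite tens_rk comp1m. Qed.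
Lemma tens1_lk A X Y (g : hom X Y) (p : hom Iob X) :
  (g ⊠ idm A) ∘ lk p A = lk (g ∘ p) A.
Proof. by rewrite tens_lk compm1. Qed.
Lemma lk_nat A B X (f : hom A B) (p : hom Iob X) :
  (idm X ⊠ f) ∘ lk p A = lk p B ∘ f.
Proof. by rewrite tens_lk comp1m. Qed.

Lemma rkD_tens A B X Y (f : hom A B) (g : hom X Y) (p : hom Iob Y) :
  (rk p B)^† ∘ (f ⊠ g) = f ∘ (rk (g^† ∘ p) A)^†.
Proof. by apply: dag_inj; rewrite !dag_comp dag_tensm !dagK tens_rk. Qed.
Lemma lkD_tens A B X Y (f : hom A B) (g : hom X Y) (p : hom Iob Y) :
  (lk p B)^† ∘ (g ⊠ f) = f ∘ (lk (g^† ∘ p) A)^†.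
Proof. by apply: dag_inj; rewrite !dag_comp dag_tensm !dagK tens_lk. Qed.
Lemma rkD_tens1 A X Y (g : hom X Y) (p : hom Iob Y) :
  (rk p A)^† ∘ (idm A ⊠ g) = (rk (g^† ∘ p) A)^†.
Proof. by rewrite rkD_tens comp1m. Qed.
Lemma lkD_tens1 A X Y (g : hom X Y) (p : hom Iob Y) :
  (lk p A)^† ∘ (g ⊠ idm A) = (lk (g^† ∘ p) A)^†.
Proof. by rewrite lkD_tens comp1m. Qed.
Lemma rkD_nat A B X (f : hom A B) (p : hom Iob X) :
  (rk p B)^† ∘ (f ⊠ idm X) = f ∘ (rk p A)^†.
Proof. by rewrite rkD_tens dag1 comp1m. Qed.
Lemma lkD_nat A B X (f : hom A B) (p : hom Iob X) :
  (lk p B)^† ∘ (idm X ⊠ f) = f ∘ (lk p A)^†.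
Proof. by rewrite lkD_tens dag1 comp1m. Qed.

Lemma rkD_rk A X (p q : hom Iob X) :
  p^† ∘ q = idm Iob -> (rk p A)^† ∘ rk q A = idm A.
Proof.
move=> e; rewrite [rk q A]rkE compA rkD_tens1 !rkE dag_comp dag_tensm dagK dag1.
by rewrite dag_comp dagK e tensm1 compm1 runitVK.
Qed.

Lemma lkD_lk A X (p q : hom Iob X) :
  p^† ∘ q = idm Iob -> (lk p A)^† ∘ lk q A = idm A.
Proof.
move=> e; rewrite [lk q A]lkE compA lkD_tens1 !lkE dag_comp dag_tensm dagK dag1.
by rewrite dag_comp dagK e tensm1 compm1 lunitVK.
Qed.

Lemma rkI X (p : hom Iob X) : rk p Iob = (lunit X)^† ∘ p.
Proof. by rewrite !rkE -lunitI lunitV_nat. Qed.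

Lemma lk_ket X Y (p : hom Iob X) (q : hom Iob Y) : lk p Y ∘ q = rk q X ∘ p.
Proof.
by rewrite -lk_nat -rk_nat !lkE !rkE lunitI !compA !tens_inter !comp1m !compm1.
Qed.

Lemma rkD_lk A X (p : hom Iob X) (q : hom Iob A) :
  (rk p A)^† ∘ lk q X = q ∘ p^†.
Proof. by rewrite !lkE compA rkD_nat rkI dag_comp dagK -!compA lunitVK compm1. Qed.

Lemma swap_rk A X (p : hom Iob X) : swap A X ∘ rk p A = lk p A.
Proof.
rewrite rkE lkE compA swap_nat -compA; congr (_ ∘ _).
by rewrite -lunit_swap dag_comp dag_swap compA swapK comp1m.
Qed.

Lemma swap_lk A X (p : hom Iob X) : swap X A ∘ lk p A = rk p A.
Proof. by rewrite -swap_rk compA swapK comp1m. Qed.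

Lemma assoc_rk A B X (p : hom Iob X) :
  assoc A B X ∘ rk p (A ⊗ B) = idm A ⊠ rk p B.
Proof.
rewrite !rkE -tensm1 compA assoc_nat -runit_assoc dag_comp dag_tensm dag1 compA.
by rewrite (pre (assocVK _ _ _)) compm1 tens_inter comp1m.
Qed.

Lemma assoc_lk A B X (p : hom Iob X) :
  assoc X A B ∘ (lk p A ⊠ idm B) = lk p (A ⊗ B).
Proof.
rewrite !lkE -[idm B]comp1m tensm_comp compA assoc_nat tensm1 -compA; congr (_ ∘ _).
apply: dag_inj; rewrite dag_comp dag_tensm !dagK dag1 -lunit_assoc.
by rewrite -compA assocVK compm1.
Qed.

Lemma assoc_rk_lk A B X (p : hom Iob X) :
  assoc A X B ∘ (rk p A ⊠ idm B) = idm A ⊠ lk p B.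
Proof.
rewrite !rkE !lkE -[idm B in LHS]comp1m tensm_comp compA assoc_nat.
rewrite -[idm A in RHS]comp1m tensm_comp -compA; congr (_ ∘ _).
apply: dag_inj; rewrite dag_comp !dag_tensm !dagK !dag1 -triangle.
by rewrite -compA assocVK compm1.
Qed.

Lemma assocV_rk A B X (p : hom Iob X) :
  (assoc A B X)^† ∘ (idm A ⊠ rk p B) = rk p (A ⊗ B).
Proof. by rewrite -assoc_rk compA assocK comp1m. Qed.

Lemma assocV_lk A B X (p : hom Iob X) :
  (assoc X A B)^† ∘ lk p (A ⊗ B) = lk p A ⊠ idm B.
Proof. by rewrite -assoc_lk compA assocK comp1m. Qed.

End Kets.

(** * Phased biproducts *)

Record sup_category := SupCategory {
  sup_dcc :> dcompact_category;
  supP : superposition_properties sup_dcc }.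

(** * Currying in a dagger compact category *)

Section Duality.
Variable P : dcompact_category.
Implicit Types A B D X Y : P.

Lemma snake_kets A :
  (lk (cap A)^† A)^† ∘ (assoc A (dual A) A)^† ∘ rk (cup A) A = idm A.
Proof.
rewrite -[RHS](snake A) !lkE !rkE /cap /cap_of !dag_comp !dag_tensm !dagK dag1.
by rewrite !dag_comp !dagK !compA.
Qed.

(** The pentagon moves [Y] out of the brackets, after which the snake for [X] applies. *)
Lemma snake_tens X X' (b : hom Iob (X' ⊗ X)) (c : hom Iob (X ⊗ X')) :
  (lk c X)^† ∘ (assoc X X' X)^† ∘ rk b X = idm X ->
  forall Y, (lk c (X ⊗ Y))^† ∘ (assoc X X' (X ⊗ Y))^† ∘ (idm X ⊠ assoc X' X Y)
    ∘ (idm X ⊠ lk b Y) = idm (X ⊗ Y).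
Proof.
move=> sn Y; rewrite -assoc_lk -assoc_rk_lk dag_comp !compA.
have pent := shift_r (tens_coiso (assocVK X X' X) (id_coiso Y))
  (esym (pentagon X X' X Y)).
rewrite (pre pent) !compA (pre (assocK _ _ _)) compm1.
rewrite (pre (assocK _ _ _)) compm1 !dag_tensm !dag1 !tens_inter !compm1.
by rewrite sn tensm1.
Qed.

Definition cur X Y D (h : hom (X ⊗ Y) D) : hom Y (dual X ⊗ D) :=
  (idm (dual X) ⊠ h) ∘ (assoc (dual X) X Y ∘ lk (cup X) Y).
Definition unc X Y D (g : hom Y (dual X ⊗ D)) : hom (X ⊗ Y) D :=
  (lk (cap X)^† D)^† ∘ (assoc X (dual X) D)^† ∘ (idm X ⊠ g).

Lemma cur_nat X Y Y' D (h : hom (X ⊗ Y) D) (y : hom Y' Y) :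
  cur h ∘ y = cur (h ∘ (idm X ⊠ y)).
Proof.
rewrite /cur -!compA -lk_nat [assoc _ _ _ ∘ (_ ∘ _)]compA -tensm1 assoc_nat.
by rewrite !compA tens_inter comp1m.
Qed.

Lemma unc_nat X Y Y' D (g : hom Y (dual X ⊗ D)) (y : hom Y' Y) :
  unc (g ∘ y) = unc g ∘ (idm X ⊠ y).
Proof. by rewrite /unc -[RHS]compA tens_inter comp1m. Qed.

(** Makes [cur] injective, so that uniqueness for maps out of [X ⊗ Y] reduces to uniqueness for maps
    out of [Y]. *)
Lemma curK X Y D (h : hom (X ⊗ Y) D) : unc (cur h) = h.
Proof.
have -> : unc (cur h) =
  (lk (cap X)^† D)^† ∘ (assoc X (dual X) D)^† ∘ (idm X ⊠ (idm (dual X) ⊠ h)) ∘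
  (idm X ⊠ assoc (dual X) X Y) ∘ (idm X ⊠ lk (cup X) Y).
  by rewrite /unc /cur -!compA !tens_inter !comp1m.
rewrite (pre (assocV_nat _ _ _)) compA tensm1 lkD_nat.
by rewrite -!compA [X in h ∘ X]compA [X in h ∘ X]compA snake_tens ?compm1 ?snake_kets.
Qed.

End Duality.

(** * Zero morphisms *)

Section Zero.
Variable P : sup_category.
Implicit Types A B D X Y : P.

Lemma zob_ex : exists Z : P, zero_object Z.
Proof. by case: (supP P) => _ []. Qed.
Definition zob : P := sval (cid zob_ex).
Lemma zobP : zero_object zob. Proof. exact: svalP (cid zob_ex). Qed.

Lemma to_zob_ex A : exists f : hom A zob, True.
Proof. by case: (zobP A) => _ [f _]; exists f. Qed.
Definition to_zob A : hom A zob := sval (cid (to_zob_ex A)).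
Lemma to_zobE A (f g : hom A zob) : f = g.
Proof. by case: (zobP A) => _ [h [_ u]]; rewrite -(u f) // -(u g). Qed.
Lemma from_zobE A (f g : hom zob A) : f = g.
Proof. by case: (zobP A) => [[h [_ u]] _]; rewrite -(u f) // -(u g). Qed.

Definition zm A B : hom A B := locked ((to_zob B)^† ∘ to_zob A).
Lemma zmE A B : zm A B = (to_zob B)^† ∘ to_zob A.
Proof. by rewrite /zm -lock. Qed.

Lemma zm_comp A B D (f : hom A B) : zm B D ∘ f = zm A D.
Proof. by rewrite !zmE -compA; congr (_ ∘ _); apply: to_zobE. Qed.
Lemma comp_zm A B D (g : hom B D) : g ∘ zm A B = zm A D.
Proof. by rewrite !zmE compA; congr (_ ∘ _); apply: from_zobE. Qed.
Lemma dag_zm A B : (zm A B)^† = zm B A.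
Proof. by rewrite !zmE dag_comp dagK. Qed.
Lemma is_zeroP A B (f : hom A B) : is_zero f -> f = zm A B.
Proof.
case=> z zf ->; have [h _] := zf A A B; have [_ k] := zf A A B.
by rewrite -(k (zm A B)) zm_comp.
Qed.

(** Maps out of [X ⊗ zob P] are unique, because their curried forms start at the zero object. *)
Lemma tens_zm X A B : idm X ⊠ zm A B = zm (X ⊗ A) (X ⊗ B).
Proof.
have u (f g : hom (X ⊗ zob) (X ⊗ B)) : f = g.
  by rewrite -(curK f) -(curK g); congr unc; apply: from_zobE.
have -> : idm X ⊠ zm A B = (idm X ⊠ (to_zob B)^†) ∘ (idm X ⊠ to_zob A).
  by rewrite tens_inter comp1m zmE.
by rewrite (u (idm X ⊠ (to_zob B)^†) (zm _ _)) zm_comp.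
Qed.

Lemma rkD_rk0 A X (p q : hom Iob X) :
  p^† ∘ q = zm _ _ -> (rk p A)^† ∘ rk q A = zm A A.
Proof.
move=> e; rewrite [rk q A]rkE compA rkD_tens1 !rkE dag_comp dag_tensm dagK dag1.
by rewrite dag_comp dagK e tens_zm comp_zm zm_comp.
Qed.

End Zero.

(** * Phases of a biproduct, and equality of maps up to a phase *)

Section Biproducts.
Variable P : sup_category.

Lemma pb_exists (A B : P) : exists W : phased_dbiproduct A B, True.
Proof. by case: (supP P) => _ [_ /(_ A B)[W]]; exists W. Qed.
Definition pb (A B : P) : phased_dbiproduct A B := sval (cid (pb_exists A B)).

Section One.
Variables (A B : P) (W : phased_dbiproduct A B).
Local Notation il := (pb_inl W).
Local Notation ir := (pb_inr W).

Lemma ilD_il : il^† ∘ il = idm _. Proof. exact: pb_inl_iso. Qed.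
Lemma irD_ir : ir^† ∘ ir = idm _. Proof. exact: pb_inr_iso. Qed.
Lemma irD_il : ir^† ∘ il = zm _ _. Proof. exact: is_zeroP (pb_orth W). Qed.
Lemma ilD_ir : il^† ∘ ir = zm _ _.
Proof. by apply: dag_inj; rewrite dag_comp dagK irD_il dag_zm. Qed.

Lemma phase_dag (U : hom W W) : is_phase U -> is_phase U^†.
Proof. exact: pb_dag. Qed.

Lemma phase_comp (U V : hom W W) : is_phase U -> is_phase V -> is_phase (U ∘ V).
Proof. by case=> a b [c d]; split; rewrite -compA ?c ?d. Qed.

Lemma pos_phase (U p q : hom W W) : is_phase U -> positive p -> diagonal p ->
  positive q -> diagonal q -> p = q ∘ U -> p = q.
Proof. by case: (supP P) => _ _; apply. Qed.

Lemma phase_diag (U : hom W W) : is_phase U -> diagonal U.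
Proof. by case=> a b; split; [exists (idm A)|exists (idm B)]; rewrite ?a ?b compm1. Qed.

Lemma phase1 : is_phase (idm W).
Proof. by split; rewrite comp1m. Qed.

(** [U^† ∘ U] is itself a phase, positive and diagonal; the last superposition property, with the
    identity as second positive map, removes it. *)
Lemma phaseK (U : hom W W) : is_phase U -> U^† ∘ U = idm W.
Proof.
move=> hU; have hV := phase_comp (phase_dag hU) hU.
apply: (pos_phase hV); rewrite ?comp1m //; [by exists W, U|exact: phase_diag| |].
  by exists W, (idm W); rewrite compm1 dag1.
exact/phase_diag/phase1.
Qed.

Lemma phaseVK (U : hom W W) : is_phase U -> U ∘ U^† = idm W.
Proof. by move/phase_dag/phaseK; rewrite dagK. Qed.

Lemma pb_ext (D : P) (h h' : hom W D) : h ∘ il = h' ∘ il -> h ∘ ir = h' ∘ ir ->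
  exists2 U : hom W W, is_phase U & h' = h ∘ U.
Proof. exact: pb_uniq. Qed.

Lemma pb_coext (D : P) (h h' : hom D W) :
  il^† ∘ h = il^† ∘ h' -> ir^† ∘ h = ir^† ∘ h' ->
  exists2 U : hom W W, is_phase U & h' = U ∘ h.
Proof.
move=> el er; have [||U hU e] := @pb_ext _ (h^†) (h'^†).
- by apply: dag_inj; rewrite !dag_comp !dagK.
- by apply: dag_inj; rewrite !dag_comp !dagK.
exists U^†; first exact: phase_dag.
by apply: dag_inj; rewrite dag_comp dagK.
Qed.

(** [h] and its projection onto the right summand have the same components, so they differ by a
    phase, and a phase fixes whatever factors through [ir]. *)
Lemma supp_r (D : P) (h : hom D W) : il^† ∘ h = zm _ _ -> h = ir ∘ (ir^† ∘ h).
Proof.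
move=> e; have [||U hU {1}->] := @pb_coext _ (ir ∘ (ir^† ∘ h)) h.
- by rewrite compA ilD_ir zm_comp e.
- by rewrite !compA irD_ir comp1m.
by rewrite compA (proj2 hU).
Qed.

Lemma supp_l (D : P) (h : hom D W) : ir^† ∘ h = zm _ _ -> h = il ∘ (il^† ∘ h).
Proof.
move=> e; have [||U hU {1}->] := @pb_coext _ (il ∘ (il^† ∘ h)) h.
- by rewrite !compA ilD_il comp1m.
- by rewrite compA irD_il zm_comp e.
by rewrite compA (proj1 hU).
Qed.

Lemma pb_eq_l (D : P) (h : hom D W) (x : hom D A) :
  il^† ∘ h = x -> ir^† ∘ h = zm _ _ -> h = il ∘ x.
Proof. by move=> <-; apply: supp_l. Qed.

Lemma pb_eq_r (D : P) (h : hom D W) (x : hom D B) :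
  il^† ∘ h = zm _ _ -> ir^† ∘ h = x -> h = ir ∘ x.
Proof. by move=> + <-; apply: supp_r. Qed.

(** The hypotheses make [f^† ∘ f] a phase; being positive, it is the identity for the same reason as
    in [phaseK]. *)
Lemma pb_iso (Y : P) (f : hom W Y) : (f ∘ il)^† ∘ (f ∘ il) = idm A ->
  (f ∘ ir)^† ∘ (f ∘ ir) = idm B -> (f ∘ ir)^† ∘ (f ∘ il) = zm A B ->
  f^† ∘ f = idm W.
Proof.
move=> ll rr rl.
have lr : (f ∘ il)^† ∘ (f ∘ ir) = zm B A.
  by apply: dag_inj; rewrite dag_comp dagK rl dag_zm.
move: ll rr rl lr; rewrite !dag_comp !compA => ll rr rl lr.
have hU : is_phase (f^† ∘ f).
  split; first by rewrite -[RHS]compm1; apply: pb_eq_l; rewrite !compA.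
  by rewrite -[RHS]compm1; apply: pb_eq_r; rewrite !compA.
apply: (pos_phase hU); rewrite ?comp1m //; [by exists Y, f|exact: phase_diag| |].
  by exists W, (idm W); rewrite compm1 dag1.
exact/phase_diag/phase1.
Qed.

(** [e ∘ f = f ∘ U] for a phase [U]; solving for [f = e ∘ f ∘ U^†] puts [f] in the range of the
    idempotent. *)
Lemma pb_range (Y : P) (e : hom Y Y) (f : hom W Y) : e ∘ e = e ->
  e ∘ f ∘ il = f ∘ il -> e ∘ f ∘ ir = f ∘ ir -> e ∘ f = f.
Proof.
move=> ee el er; have [||U hU eU] := @pb_ext _ f (e ∘ f); rewrite ?el ?er //.
by rewrite {1}[f](shift_r (phaseVK hU) (esym eU)) !compA ee eU -compA phaseVK ?compm1.
Qed.

End One.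
End Biproducts.

(** * The action of the phases *)

Section Control.
Variable P : sup_category.
Implicit Types A B D X Y : P.
Local Notation il := (pb_inl _).
Local Notation ir := (pb_inr _).

(** [f = s ∘ m ∘ U] for a phase [U]; applying [r] gives [m = m ∘ U], so the phase disappears. *)
Lemma pb_eq_sec A B (W : phased_dbiproduct A B) X Y (s : hom X Y) (r : hom Y X)
    (m : hom W X) (f : hom W Y) : r ∘ s = idm X ->
  f ∘ il = s ∘ (m ∘ il) -> f ∘ ir = s ∘ (m ∘ ir) -> r ∘ f = m -> f = s ∘ m.
Proof.
move=> rs el er rf; have [||U hU eU] := @pb_ext _ _ _ W _ (s ∘ m) f.
- by rewrite -compA el.
- by rewrite -compA er.
have mU : m = m ∘ U by rewrite -{1}rf eU !compA rs comp1m.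
by rewrite eU -compA -mU.
Qed.

(** Currying turns maps out of [X ⊗ W] into maps out of the biproduct [W], so [X ⊗ W] behaves like a
    phased biproduct whose phases are the [idm X ⊠ U]. *)
Lemma tens_phase X A B (W : phased_dbiproduct A B) D (f f' : hom (X ⊗ W) D) :
  f ∘ (idm X ⊠ il) = f' ∘ (idm X ⊠ il) ->
  f ∘ (idm X ⊠ ir) = f' ∘ (idm X ⊠ ir) ->
  exists2 U : hom W W, is_phase U & f' = f ∘ (idm X ⊠ U).
Proof.
move=> el er; have [||U hU eU] := @pb_ext _ _ _ W _ (cur f) (cur f').
- by rewrite !cur_nat el.
- by rewrite !cur_nat er.
by exists U => //; rewrite -[LHS]curK eU unc_nat curK.
Qed.

Definition pl A : phased_dbiproduct A Iob := pb A Iob.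
Definition kk A : hom A (pl A) := pb_inl (pl A).
Definition pt A : hom Iob (pl A) := pb_inr (pl A).

Lemma kkD_kk A : (kk A)^† ∘ kk A = idm _. Proof. exact: ilD_il. Qed.
Lemma ptD_pt A : (pt A)^† ∘ pt A = idm _. Proof. exact: irD_ir. Qed.
Lemma ptD_kk A : (pt A)^† ∘ kk A = zm _ _. Proof. exact: irD_il. Qed.
Lemma kkD_pt A : (kk A)^† ∘ pt A = zm _ _. Proof. exact: ilD_ir. Qed.

Local Notation TT := (pl Iob).
Local Notation T := (pb_obj TT).
Local Notation k1 := (kk Iob).
Local Notation k0 := (pt Iob).

Lemma rk_phase X D (f f' : hom (X ⊗ T) D) :
  f ∘ rk k1 X = f' ∘ rk k1 X -> f ∘ rk k0 X = f' ∘ rk k0 X ->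
  exists2 v : hom T T, is_phase v & f' = f ∘ (idm X ⊠ v).
Proof.
rewrite !rkE !compA => el er.
have i : (runit X)^† ∘ (runit X)^†^† = idm _ by rewrite dagK runitK.
by apply: tens_phase; apply: (coiso_inj i).
Qed.

Lemma unif_ex : exists u : hom Iob T, u^† ∘ k1 = idm _ /\ u^† ∘ k0 = idm _.
Proof.
have [e [e1 e0]] := pb_ex TT (idm Iob) (idm Iob).
by exists e^†; rewrite dagK.
Qed.
Definition unif := sval (cid unif_ex).
Lemma unifD_k1 : unif^† ∘ k1 = idm _. Proof. by case: (svalP (cid unif_ex)). Qed.
Lemma unifD_k0 : unif^† ∘ k0 = idm _. Proof. by case: (svalP (cid unif_ex)). Qed.

Section Coaction.
Variables (A B : P) (W : phased_dbiproduct A B).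

(** [coact] tags the left summand with [k1] and the right one with [k0]; the effect [unif^†], which
    is 1 on both tags, is its counit. *)
Lemma coact_ex : exists c : hom W (W ⊗ T),
  [/\ c ∘ il = rk k1 W ∘ il, c ∘ ir = rk k0 W ∘ ir & (rk unif W)^† ∘ c = idm W].
Proof.
have [c [cl cr]] := pb_ex W (rk k1 W ∘ il) (rk k0 W ∘ ir).
have hU : is_phase ((rk unif W)^† ∘ c).
  by split; rewrite -compA ?cl ?cr compA rkD_rk ?comp1m ?unifD_k1 ?unifD_k0.
(* The counit law holds for [c] up to a phase; the inverse phase corrects it and leaves the tags
   alone. *)
exists (c ∘ ((rk unif W)^† ∘ c)^†); have [Vl Vr] := phase_dag hU.
by split; rewrite -?compA ?Vl ?Vr // compA phaseVK.
Qed.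
Definition coact : hom W (W ⊗ T) := sval (cid coact_ex).
Lemma coact_l : coact ∘ il = rk k1 W ∘ il. Proof. by case: (svalP (cid coact_ex)). Qed.
Lemma coact_r : coact ∘ ir = rk k0 W ∘ ir. Proof. by case: (svalP (cid coact_ex)). Qed.
Lemma coactU : (rk unif W)^† ∘ coact = idm W. Proof. by case: (svalP (cid coact_ex)). Qed.

Lemma coact_iso : coact^† ∘ coact = idm W.
Proof.
apply: pb_iso; rewrite ?coact_l ?coact_r !dag_comp !compA.
- by rewrite (pre (rkD_rk _ (kkD_kk Iob))) compm1 ilD_il.
- by rewrite (pre (rkD_rk _ (ptD_pt Iob))) compm1 irD_ir.
- by rewrite (pre (rkD_rk0 _ (ptD_kk Iob))) comp_zm zm_comp.
Qed.

Definition act (v : hom T T) : hom W W := locked (coact^† ∘ (idm W ⊠ v) ∘ coact).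
Lemma actE v : act v = coact^† ∘ (idm W ⊠ v) ∘ coact.
Proof. by rewrite /act -lock. Qed.

Lemma coact_act v : is_phase v -> (idm W ⊠ v) ∘ coact = coact ∘ act v.
Proof.
case=> vl vr; have [||U hU eU] := @pb_ext _ _ _ W _ coact ((idm W ⊠ v) ∘ coact).
- by rewrite -compA coact_l !compA tens1_rk vl.
- by rewrite -compA coact_r !compA tens1_rk vr.
by rewrite actE -compA eU [coact^† ∘ _]compA coact_iso comp1m.
Qed.

Lemma act_phase v : is_phase v -> is_phase (act v).
Proof.
move=> hv; case: (hv) => vl vr; split; apply: (iso_inj coact_iso);
  rewrite compA -coact_act // -compA ?coact_l ?coact_r compA tens1_rk.
- by rewrite vl.
- by rewrite vr.
Qed.

Lemma coactD_k1 : coact^† ∘ rk k1 W = il ∘ il^†.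
Proof.
apply: pb_eq_l; rewrite compA -[X in X ∘ _ = _]dag_comp ?coact_l ?coact_r dag_comp -compA.
  by rewrite (rkD_rk _ (kkD_kk Iob)) compm1.
by rewrite (rkD_rk0 _ (ptD_kk Iob)) comp_zm.
Qed.

Lemma coactD_k0 : coact^† ∘ rk k0 W = ir ∘ ir^†.
Proof.
apply: pb_eq_r; rewrite compA -[X in X ∘ _ = _]dag_comp ?coact_l ?coact_r dag_comp -compA.
  by rewrite (rkD_rk0 _ (kkD_pt Iob)) comp_zm.
by rewrite (rkD_rk _ (ptD_pt Iob)) compm1.
Qed.

(* The phases of [W ⊗ T] are the [1 ⊗ v], and [coact] embeds [W] into [W ⊗ T]
   compatibly with the injections. *)
Lemma phase_act (U : hom W W) : is_phase U ->
  exists2 v : hom T T, is_phase v & U = act v.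
Proof.
move=> hU; have [||v hv e] := @rk_phase _ _ (coact^†) (U ∘ coact^†).
- by rewrite -compA coactD_k1 compA (proj1 hU).
- by rewrite -compA coactD_k0 compA (proj2 hU).
by exists v => //; rewrite actE -e -compA coact_iso compm1.
Qed.

End Coaction.

Lemma coact_nat A B A' B' (W : phased_dbiproduct A B) (W' : phased_dbiproduct A' B')
  (f : hom W W') : diagonal f -> (f ⊠ idm T) ∘ coact W = coact W' ∘ f.
Proof.
case=> [[a ea] [b eb]]; apply: (pb_eq_sec (coactU W')).
- by rewrite -compA coact_l ea !compA rk_nat coact_l -!compA ea.
- by rewrite -compA coact_r eb !compA rk_nat coact_r -!compA eb.
- by rewrite compA rkD_nat -compA coactU compm1.
Qed.

(** The phases of [T] act on every biproduct at once, and diagonal maps are equivariant. This allows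
    a phase found on one object to be cancelled on another. *)
Lemma act_nat A B A' B' (W : phased_dbiproduct A B) (W' : phased_dbiproduct A' B')
  (f : hom W W') v : diagonal f -> is_phase v -> f ∘ act W v = act W' v ∘ f.
Proof.
move=> df hv; apply: (iso_inj (coact_iso W')).
rewrite [LHS]compA -coact_nat // -[LHS]compA -coact_act // [LHS]compA -tens_split.
by rewrite [RHS]compA -coact_act // -[RHS]compA -coact_nat // compA -tens_split'.
Qed.

(* [T] with [delta] is a cocommutative comonoid which copies [k1] and [k0]. *)
Definition delta : hom T (T ⊗ T) := coact TT.

Lemma delta_k1 : delta ∘ k1 = rk k1 T ∘ k1. Proof. exact: coact_l. Qed.
Lemma delta_k0 : delta ∘ k0 = rk k0 T ∘ k0. Proof. exact: coact_r. Qed.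
Lemma delta_iso : delta^† ∘ delta = idm T. Proof. exact: coact_iso. Qed.

(** The two sides differ by a phase [z], which is also [delta] with the counit applied to the left
    factor. Since [z^†] fixes [unif], [z] acts trivially, and this makes it idempotent; a unitary
    idempotent is the identity. *)
Lemma swap_delta : swap T T ∘ delta = delta.
Proof.
have [||z hz e] := @pb_ext _ _ _ TT _ delta (swap T T ∘ delta).
- by rewrite -[RHS]compA delta_k1 compA swap_rk lk_ket.
- by rewrite -[RHS]compA delta_k0 compA swap_rk lk_ket.
have lz : (lk unif T)^† ∘ delta = z.
  by rewrite -swap_rk dag_comp dag_swap -compA e compA coactU comp1m.
have uz : z^† ∘ unif = unif.
  apply: dag_inj; rewrite dag_comp dagK -lz compA -dag_comp lk_ket dag_comp.
  by rewrite -compA coactU compm1.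
have az : act TT z = idm T.
  have <- : (rk unif T)^† ∘ (coact TT ∘ act TT z) = act TT z.
    by rewrite compA coactU comp1m.
  rewrite -coact_act // compA rkD_tens1 uz.
  exact: (coactU TT).
have zz : z ∘ z = z.
  transitivity (z ∘ ((lk unif T)^† ∘ delta)); first by rewrite lz.
  by rewrite compA -lkD_nat -compA /delta coact_act // az compm1.
have z1 : z = idm T.
  by rewrite -[LHS]comp1m -(phaseK hz) -compA zz phaseK.
by rewrite e z1 compm1.
Qed.

Lemma delta_assoc :
  assoc T T T ∘ (delta ⊠ idm T) ∘ delta = (idm T ⊠ delta) ∘ delta.
Proof.
have rs : (idm T ⊠ (rk unif T)^†) ∘ (idm T ⊠ delta) = idm _.
  by rewrite tens_inter comp1m coactU tensm1.
apply: (pb_eq_sec rs).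
- rewrite -/k1 delta_k1 -[LHS]compA delta_k1 !compA (pre (rk_nat _ _)).
  by rewrite !compA (pre delta_k1) compA assoc_rk !tens1_rk delta_k1.
- rewrite -/k0 delta_k0 -[LHS]compA delta_k0 !compA (pre (rk_nat _ _)).
  by rewrite !compA (pre delta_k0) compA assoc_rk !tens1_rk delta_k0.
- have -> : idm T ⊠ (rk unif T)^† = (idm T ⊠ rk unif T)^† by rewrite dag_tensm dag1.
  rewrite -assoc_rk dag_comp !compA (pre (assocK _ _ _)) compm1 rkD_nat -compA.
  by rewrite coactU compm1.
Qed.

Lemma delta_nat_l (s : hom T T) : diagonal (W := TT) (W' := TT) s ->
  (s ⊠ idm T) ∘ delta = delta ∘ s.
Proof. exact: coact_nat. Qed.

Lemma delta_nat_r (s : hom T T) : diagonal (W := TT) (W' := TT) s ->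
  (idm T ⊠ s) ∘ delta = delta ∘ s.
Proof.
move=> ds; rewrite -[in LHS]swap_delta compA -swap_nat -compA delta_nat_l //.
by rewrite compA swap_delta.
Qed.

(** An Eckmann-Hilton argument: after [delta] both composites become [s ⊠ t]. This is the
    commutativity of the semiring. *)
Lemma diag_comm (s t : hom T T) : diagonal (W := TT) (W' := TT) s ->
  diagonal (W := TT) (W' := TT) t -> s ∘ t = t ∘ s.
Proof.
move=> ds dt; apply: (iso_inj delta_iso); rewrite !compA.
transitivity ((s ⊠ t) ∘ delta).
  by rewrite tens_split -[RHS]compA (delta_nat_r dt) compA (delta_nat_l ds).
by rewrite tens_split' -[LHS]compA (delta_nat_l ds) compA (delta_nat_r dt).
Qed.

Lemma delta_tens (s t : hom T T) : diagonal (W := TT) (W' := TT) s ->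
  diagonal (W := TT) (W' := TT) t -> delta^† ∘ (s ⊠ t) ∘ delta = s ∘ t.
Proof.
move=> ds dt; rewrite tens_split -!compA (delta_nat_r dt).
by rewrite [(s ⊠ _) ∘ _]compA (delta_nat_l ds) !compA delta_iso comp1m.
Qed.

End Control.

(** * Pointed maps and their sums *)

Section Pointed.
Variable P : sup_category.
Implicit Types A B D X Y : P.
Local Notation il := (pb_inl _).
Local Notation ir := (pb_inr _).
Local Notation TT := (pl (Iob : P)).
Local Notation T := (pb_obj TT).
Local Notation k1 := (kk (Iob : P)).
Local Notation k0 := (pt (Iob : P)).

(** The condition on [f^†] kills the component of [f ∘ kk A] along [pt B], so that [f] maps the
    summand [A] into [B]; it also closes pointed maps under the dagger. *)
Definition pointed A B (f : hom (pl A) (pl B)) : Prop :=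
  f ∘ pt A = pt B /\ f^† ∘ pt B = pt A.

Definition und A B (f : hom (pl A) (pl B)) : hom A B :=
  locked ((kk B)^† ∘ f ∘ kk A).
Lemma undE A B (f : hom (pl A) (pl B)) : und f = (kk B)^† ∘ f ∘ kk A.
Proof. by rewrite /und -lock. Qed.

Lemma und_eq A B (f : hom (pl A) (pl B)) :
  f^† ∘ pt B = pt A -> f ∘ kk A = kk B ∘ und f.
Proof.
move=> e; rewrite undE -compA; apply: pb_eq_l => //.
have -> : (pb_inr (pl B))^† ∘ (f ∘ kk A) = (f^† ∘ pt B)^† ∘ kk A.
  by rewrite dag_comp dagK compA.
by rewrite e ptD_kk.
Qed.

Lemma pointed_kk A B (f : hom (pl A) (pl B)) : pointed f -> f ∘ kk A = kk B ∘ und f.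
Proof. by case=> _ /und_eq. Qed.

Lemma pointed_diag A B (f : hom (pl A) (pl B)) : pointed f -> diagonal f.
Proof.
move=> pf; split; first by exists (und f); apply: pointed_kk.
by exists (idm _); rewrite compm1; case: pf.
Qed.

Lemma pointed1 A : pointed (idm (pl A)).
Proof. by split; rewrite ?dag1 comp1m. Qed.
Lemma pointed_comp A B D (g : hom (pl B) (pl D)) (f : hom (pl A) (pl B)) :
  pointed g -> pointed f -> pointed (g ∘ f).
Proof.
case=> g1 g2 [f1 f2]; split; first by rewrite -compA f1.
by rewrite dag_comp -compA g2.
Qed.
Lemma pointed_dag A B (f : hom (pl A) (pl B)) : pointed f -> pointed f^†.
Proof. by case=> f1 f2; split; rewrite ?dagK. Qed.
Lemma pointed0 A B : pointed (pt B ∘ (pt A)^†).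
Proof.
by split; rewrite ?dag_comp ?dagK -compA ptD_pt compm1.
Qed.
Lemma pl_ext A X (f g : hom (pl A) X) : f ∘ kk A = g ∘ kk A -> f ∘ pt A = g ∘ pt A ->
  exists2 U, is_phase U & g = f ∘ U.
Proof. exact: pb_ext. Qed.

(* [jj] embeds [B ∔ Y] into [Y ⊗ (B ∔ I)]; for [Y = A ∔ I] pointed by [pt A], its
   image is the summand [I ∔ A ∔ B] of [(A ∔ I) ⊗ (B ∔ I)]. *)
Section Wedge.
Variables (Y : P) (q : hom Iob Y).
Hypothesis qq : q^† ∘ q = idm _.

Lemma jj_ex B : exists j : hom (pb B Y) (Y ⊗ pl B),
  j ∘ il = lk q _ ∘ kk B /\ j ∘ ir = rk (pt B) Y.
Proof. exact: pb_ex. Qed.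
Definition jj B : hom (pb B Y) (Y ⊗ pl B) := sval (cid (jj_ex B)).
Lemma jj_l B : jj B ∘ il = lk q _ ∘ kk B. Proof. by case: (svalP (cid (jj_ex B))). Qed.
Lemma jj_r B : jj B ∘ ir = rk (pt B) Y. Proof. by case: (svalP (cid (jj_ex B))). Qed.

Lemma jj_iso B : (jj B)^† ∘ jj B = idm _.
Proof.
apply: pb_iso; rewrite ?jj_l ?jj_r ?rkD_rk ?ptD_pt // ?dag_comp !compA.
  by rewrite (pre (lkD_lk _ qq)) compm1 kkD_kk.
by rewrite rkD_lk -compA ptD_kk comp_zm.
Qed.

Definition supp B X (g : hom X (Y ⊗ pl B)) : Prop := jj B ∘ (jj B)^† ∘ g = g.

Lemma supp_jj B X (x : hom X (pb B Y)) : supp (jj B ∘ x).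
Proof. by rewrite /supp compA (pre (jj_iso B)) compm1. Qed.

Lemma supp_comp B X X' (g : hom X (Y ⊗ pl B)) (x : hom X' X) :
  supp g -> supp (g ∘ x).
Proof. by rewrite /supp compA => ->. Qed.

Lemma supp_pb B A A' (W : phased_dbiproduct A A') (g : hom W (Y ⊗ pl B)) :
  supp (g ∘ il) -> supp (g ∘ ir) -> supp g.
Proof.
rewrite /supp !compA => gl gr; apply: pb_range => //.
by rewrite !compA (pre (jj_iso B)) compm1.
Qed.

Lemma supp_rk B : supp (rk (pt B) Y).
Proof. by rewrite -jj_r; apply: supp_jj. Qed.

Lemma supp_lkk B : supp (lk q _ ∘ kk B).
Proof. by rewrite -jj_l; apply: supp_jj. Qed.

Lemma supp_lk B : supp (lk q (pl B)).
Proof.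
apply: supp_pb; first exact: supp_lkk.
by rewrite -/(pt B) lk_ket; apply/supp_comp/supp_rk.
Qed.

(** The tags match: [B] and [kk B] both carry [k1], [Y] and [pt B] both carry [k0]. So [jj]
    intertwines the coaction of [pb B Y] with that of the factor [pl B]. *)
Lemma jj_act B v : is_phase v -> jj B ∘ act (pb B Y) v = (idm Y ⊠ act (pl B) v) ∘ jj B.
Proof.
move=> hv.
have e : assoc Y (pl B) T ∘ (jj B ⊠ idm T) ∘ coact (pb B Y) =
    (idm Y ⊠ coact (pl B)) ∘ jj B.
  have rs : (idm Y ⊠ (rk (unif P) (pl B))^†) ∘ (idm Y ⊠ coact (pl B)) = idm _.
    by rewrite tens_inter comp1m coactU tensm1.
  apply: (pb_eq_sec rs).
  - rewrite -compA coact_l !compA (pre (rk_nat _ _)) compA assoc_rk.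
    rewrite !(pre (jj_l B)) !compA !lk_nat -!compA.
    by rewrite [X in _ = _ ∘ X](coact_l (pl B)).
  - rewrite -compA coact_r !compA (pre (rk_nat _ _)) compA assoc_rk.
    by rewrite !(pre (jj_r B)) !tens1_rk (coact_r (pl B)).
  - have -> : idm Y ⊠ (rk (unif P) (pl B))^† = (idm Y ⊠ rk (unif P) (pl B))^†.
      by rewrite dag_tensm dag1.
    rewrite -assoc_rk dag_comp !compA (pre (assocK _ _ _)) compm1 rkD_nat -compA.
    by rewrite coactU compm1.
have ii : (idm Y ⊠ coact (pl B))^† ∘ (idm Y ⊠ coact (pl B)) = idm _.
  by apply: tens_iso; rewrite ?dag1 ?comp1m ?coact_iso.
have h : (idm Y ⊠ coact (pl B)) ∘ (idm Y ⊠ act (pl B) v) =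
    (idm Y ⊠ (idm _ ⊠ v)) ∘ (idm Y ⊠ coact (pl B)).
  by rewrite !tens_inter !comp1m coact_act.
apply: (iso_inj ii); rewrite [RHS]compA h -[RHS]compA [LHS]compA -e !compA.
rewrite -assoc_nat tensm1 -[LHS]compA -coact_act // !compA.
by rewrite !(pre (tens_inter _ _ _ _)) !compm1 !comp1m.
Qed.

(** The two marginals determine both components along [jj]; what is left is a phase of [pb B Y],
    which [jj_act] carries to the factor [pl B]. *)
Lemma supp_eq_act B X (g g' : hom X (Y ⊗ pl B)) : supp g -> supp g' ->
  (rk (pt B) Y)^† ∘ g = (rk (pt B) Y)^† ∘ g' ->
  (lk q _)^† ∘ g = (lk q _)^† ∘ g' ->
  exists2 v, is_phase v & g' = (idm Y ⊠ act (pl B) v) ∘ g.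
Proof.
move=> sg sg' er el.
have [||U hU eU] := @pb_coext _ _ _ (pb B Y) _ ((jj B)^† ∘ g) ((jj B)^† ∘ g').
- by rewrite !compA -dag_comp jj_l dag_comp -!compA el.
- by rewrite !compA -dag_comp jj_r er.
have [v hv eU'] := phase_act hU; exists v => //.
by rewrite -[LHS]sg' -compA eU eU' !compA jj_act // -!compA [jj B ∘ _]compA sg.
Qed.

End Wedge.

Lemma supp_tens Y Y' (q : hom Iob Y) (q' : hom Iob Y') (qq : q^† ∘ q = idm _)
    (qq' : q'^† ∘ q' = idm _) A B X (f : hom Y Y') (g : hom (pl A) (pl B))
    (h : hom X (Y ⊗ pl A)) :
  f ∘ q = q' -> pointed g -> supp q h -> supp q' ((f ⊠ g) ∘ h).
Proof.
move=> fq pg <-; rewrite -[jj q A ∘ _ ∘ _]compA compA.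
apply: supp_comp; apply: supp_pb => //; rewrite -compA ?jj_l ?jj_r.
  rewrite compA tens_lk -compA pointed_kk // fq compA; apply: supp_comp.
  exact: supp_lkk.
by rewrite tens_rk (proj1 pg); apply/supp_comp/supp_rk.
Qed.

(** The witness is the dagger of a fold map [[kk, id]] on [D ∔ (D ∔ I)]. For a first choice [y], the
    composite with the inclusion [i] of [pl D] is only a phase [act (pl D) v]; as [i] is diagonal,
    the phase of [pb D (pl D)] with the same [v] corrects [y] without changing its components. *)
Lemma Delta_ex D : exists d : hom (pl D) (pl D ⊗ pl D),
  [/\ supp (pt D) d, (rk (pt D) _)^† ∘ d = idm _, (lk (pt D) _)^† ∘ d = idm _
    & d ∘ pt D = rk (pt D) _ ∘ pt D].
Proof.
have [y [yl yr]] := pb_ex (pb D (pl D)) (kk D) (idm (pl D)).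
pose i := (jj (pt D) D)^† ∘ lk (pt D) (pl D).
have il' : i ∘ kk D = pb_inl (pb D (pl D)).
  by rewrite /i -compA -jj_l compA jj_iso ?ptD_pt ?comp1m.
have ir' : i ∘ pt D = pb_inr (pb D (pl D)) ∘ pt D.
  by rewrite /i -compA lk_ket -(jj_r (pt D)) !compA jj_iso ?ptD_pt ?comp1m.
have di : diagonal (W := pl D) (W' := pb D (pl D)) i.
  by split; [exists (idm D); rewrite compm1|exists (pt D)].
have hU : is_phase (W := pl D) (y ∘ i).
  split; rewrite -compA -/(kk D) -/(pt D) ?il' ?ir' //.
  by rewrite compA yr comp1m.
have [v hv e] := phase_act hU.
have ha := act_phase (pb D (pl D)) hv.
have [al ar] := phase_dag ha.
pose z := y ∘ (act (pb D (pl D)) v)^†.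
have zr : z ∘ ir = idm _ by rewrite /z -compA ar.
have zl : z ∘ il = kk D by rewrite /z -compA al.
have zi : z ∘ i = idm _.
  apply: (coiso_inj (phaseVK (act_phase (pl D) hv))).
  rewrite -compA act_nat // /z !compA (pre (phaseK ha)) compm1 comp1m.
  by rewrite -e /i compA.
exists (jj (pt D) D ∘ z^†); split.
- by apply: supp_jj; rewrite ptD_pt.
- rewrite -(jj_r (pt D)) dag_comp -compA [(jj _ _)^† ∘ _]compA jj_iso ?ptD_pt //.
  by rewrite comp1m -dag_comp zr dag1.
- by rewrite compA -[(lk _ _)^† ∘ _]dagK dag_comp dagK -/i -dag_comp zi dag1.
- rewrite -compA (_ : z^† ∘ pt D = ir ∘ pt D) ?compA ?jj_r //.
  apply: pb_eq_r; rewrite compA -dag_comp ?zl ?zr ?kkD_pt //.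
  by rewrite dag1 comp1m.
Qed.
Definition Delta D := sval (cid (Delta_ex D)).
Lemma Delta_supp D : supp (pt D) (Delta D).
Proof. by case: (svalP (cid (Delta_ex D))). Qed.
Lemma DeltaR D : (rk (pt D) _)^† ∘ Delta D = idm _.
Proof. by case: (svalP (cid (Delta_ex D))). Qed.
Lemma DeltaL D : (lk (pt D) _)^† ∘ Delta D = idm _.
Proof. by case: (svalP (cid (Delta_ex D))). Qed.
Lemma Delta_pt D : Delta D ∘ pt D = rk (pt D) _ ∘ pt D.
Proof. by case: (svalP (cid (Delta_ex D))). Qed.

(* The hypotheses are symmetric up to a scalar [v] acting on the second factor, and
   [v] fixes the second marginal [b]; comparing with [(a ⊗ b) ∘ Delta], on which [v]
   acts through [b], shows that [v] fixes [g]. *)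
Lemma supp_eq Y (q : hom Iob Y) (qq : q^† ∘ q = idm _) B D
    (g g' : hom (pl D) (Y ⊗ pl B)) : supp q g -> supp q g' ->
  (rk (pt B) Y)^† ∘ g = (rk (pt B) Y)^† ∘ g' ->
  (lk q _)^† ∘ g = (lk q _)^† ∘ g' ->
  pointed ((lk q _)^† ∘ g) -> (rk (pt B) Y)^† ∘ g ∘ pt D = q -> g = g'.
Proof.
move=> sg sg' er el pb aq.
have [v hv e] := supp_eq_act sg sg' er el.
set b := (lk q _)^† ∘ g in el pb; set a := (rk (pt B) Y)^† ∘ g in er aq.
have vb : act (pl B) v ∘ b = b by rewrite [in RHS]el e compA lkD_nat -compA.
have ad : a^† ∘ q = pt D.
  apply: dag_inj; rewrite dag_comp dagK /a compA -dag_comp -lk_ket dag_comp -compA.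
  by rewrite -[LHS]dagK dag_comp dagK (proj2 pb).
have [w hw e0] : exists2 w, is_phase w & g = (idm Y ⊠ act (pl B) w) ∘ ((a ⊠ b) ∘ Delta D).
  apply: supp_eq_act => //.
  - exact: (supp_tens (ptD_pt D) qq aq pb (Delta_supp D)).
  - exact: sg.
  - by rewrite compA rkD_tens (proj2 pb) -compA DeltaR compm1.
  - by rewrite compA lkD_tens ad -compA DeltaL compm1.
have dw : diagonal (W := pl B) (W' := pl B) (act (pl B) w).
  by apply: phase_diag; apply: act_phase.
rewrite e {2}e0 !compA !tens_inter !comp1m -(act_nat dw hv) -compA vb.
by rewrite {1}e0 compA tens_inter comp1m.
Qed.

Lemma Delta_nat A B (f : hom (pl A) (pl B)) : pointed f ->
  (f ⊠ f) ∘ Delta A = Delta B ∘ f.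
Proof.
move=> pf; case: (pf) => f1 f2; apply: (supp_eq (ptD_pt B)).
- exact: (supp_tens (ptD_pt A) (ptD_pt B) f1 pf (Delta_supp A)).
- exact/supp_comp/Delta_supp.
- by rewrite !compA rkD_tens f2 DeltaR -compA DeltaR compm1 comp1m.
- by rewrite !compA lkD_tens f2 DeltaL -compA DeltaL compm1 comp1m.
- by rewrite !compA lkD_tens f2 -compA DeltaL compm1.
- by rewrite !compA rkD_tens f2 -[_ ∘ Delta A]compA DeltaR compm1.
Qed.

Lemma swap_Delta D : swap _ _ ∘ Delta D = Delta D.
Proof.
apply: (supp_eq (ptD_pt D)); last 2 first.
- by rewrite compA -[swap _ _]dag_swap -dag_comp swap_lk DeltaR; apply: pointed1.
- by rewrite compA -[swap _ _]dag_swap -dag_comp swap_rk DeltaL comp1m.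
- rewrite -(Delta_supp D) -compA compA; apply: supp_comp.
  apply: supp_pb; rewrite ?ptD_pt // -compA ?jj_l ?jj_r.
    by rewrite compA swap_lk; apply/supp_comp/supp_rk; rewrite ptD_pt.
  by rewrite swap_rk; apply: supp_lk; rewrite ptD_pt.
- exact: Delta_supp.
- by rewrite compA -[swap _ _]dag_swap -dag_comp swap_rk DeltaR DeltaL.
- by rewrite compA -[swap _ _]dag_swap -dag_comp swap_lk DeltaR DeltaL.
Qed.

(** Both sides are supported on the wedge of [pl D ⊗ pl D], with base point [pt D ⊗ pt D], and
    [pl D]; their marginals there are [Delta D] and the identity. *)
Lemma Delta_assoc D : (Delta D ⊠ idm _) ∘ Delta D =
  (assoc _ _ _)^† ∘ (idm _ ⊠ Delta D) ∘ Delta D.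
Proof.
pose q := rk (pt D) (pl D) ∘ pt D; have pp := ptD_pt D.
have qE : q = lk (pt D) (pl D) ∘ pt D by rewrite lk_ket.
have qq : q^† ∘ q = idm _.
  by rewrite /q dag_comp compA (pre (rkD_rk _ pp)) compm1.
have Dq : (Delta D)^† ∘ q = pt D.
  rewrite /q compA -[(Delta D)^† ∘ _]dagK [(_ ∘ _)^†]dag_comp dagK DeltaR.
  by rewrite dag1 comp1m.
have L1 : (lk q _)^† ∘ ((Delta D ⊠ idm _) ∘ Delta D) = idm _.
  by rewrite compA lkD_tens1 Dq DeltaL.
have R1 : (rk (pt D) _)^† ∘ ((Delta D ⊠ idm _) ∘ Delta D) = Delta D.
  by rewrite compA rkD_nat -compA DeltaR compm1.
apply: (supp_eq qq); rewrite ?L1 ?R1.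
- by apply: (supp_tens pp qq (Delta_pt D) _ (Delta_supp D)); apply: pointed1.
- rewrite -[X in _ ∘ X](Delta_supp D) -[jj _ _ ∘ _ ∘ _]compA compA.
  apply: supp_comp; apply: supp_pb => //.
    rewrite -compA jj_l -compA [(idm _ ⊠ _) ∘ _]compA lk_nat !compA assocV_lk.
    apply: supp_comp; apply: (supp_tens pp qq _ _ (Delta_supp D)).
      by rewrite lk_ket.
    exact: pointed1.
  rewrite -compA jj_r -compA tens1_rk Delta_pt -tens1_rk compA assocV_rk.
  exact/supp_comp/supp_rk.
- rewrite !compA -dag_comp assoc_rk dag_tensm dag1 tens_inter comp1m DeltaR.
  by rewrite tensm1 comp1m.
- rewrite qE -tens1_lk !compA -dag_comp compA assoc_lk dag_comp.
  by rewrite -[_ ∘ (idm _ ⊠ _)]compA lkD_nat compA DeltaL comp1m DeltaL.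
- exact: pointed1.
- exact: Delta_pt.
Qed.

End Pointed.

(** * Underlying maps, and the addition of pointed maps *)

Section PointedCategory.
Variable P : sup_category.
Implicit Types A B D X Y : P.
Local Notation il := (pb_inl _).
Local Notation ir := (pb_inr _).

Lemma und1 A : und (idm (pl A)) = idm A.
Proof. by rewrite undE compm1 kkD_kk. Qed.

Lemma und_comp A B D (g : hom (pl B) (pl D)) (f : hom (pl A) (pl B)) :
  pointed f -> und (g ∘ f) = und g ∘ und f.
Proof.
by move=> pf; rewrite [und g]undE -[RHS]compA -pointed_kk // undE !compA.
Qed.

Lemma und_dag A B (f : hom (pl A) (pl B)) : und f^† = (und f)^†.
Proof. by rewrite !undE !dag_comp dagK compA. Qed.

Lemma und_pt A B : und (pt B ∘ (pt A)^†) = zm A B.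
Proof. by rewrite undE -!compA ptD_kk !comp_zm. Qed.

Lemma und_phase A B (f g : hom (pl A) (pl B)) : pointed f -> pointed g ->
  und f = und g -> exists2 U, is_phase (W := pl A) U & g = f ∘ U.
Proof.
move=> pf pg e; apply: pl_ext; first by rewrite !pointed_kk ?e.
by rewrite (proj1 pf) (proj1 pg).
Qed.

Lemma und_zm A B (f : hom (pl A) (pl B)) : pointed f -> und f = zm A B ->
  f = pt B ∘ (pt A)^†.
Proof.
move=> pf e; have [|U hU ->] := und_phase (pointed0 A B) pf.
  by rewrite e und_pt.
by rewrite -compA -[(pt A)^† ∘ U]dagK dag_comp dagK (proj2 (phase_dag hU)).
Qed.

(** The two positive maps have the same underlying map, so they differ by a phase; both are
    diagonal, and the last superposition property applies. *)
Lemma und_pos A B B' (f : hom (pl A) (pl B)) (g : hom (pl A) (pl B')) :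
  pointed f -> pointed g -> (und f)^† ∘ und f = (und g)^† ∘ und g ->
  f^† ∘ f = g^† ∘ g.
Proof.
move=> pf pg e.
have qf := pointed_comp (pointed_dag pf) pf.
have qg := pointed_comp (pointed_dag pg) pg.
have [|U hU eU] := und_phase qg qf; first by rewrite !und_comp ?und_dag.
apply: (pos_phase (W := pl A) hU) => //; try exact: pointed_diag.
  by exists (pl B), f.
by exists (pl B'), g.
Qed.

Lemma und_iso A B (f : hom (pl A) (pl B)) :
  pointed f -> (und f)^† ∘ und f = idm A -> f^† ∘ f = idm (pl A).
Proof.
move=> pf e; rewrite (@und_pos _ _ _ f (idm (pl A))) //; last first.
- by rewrite e und1 dag1 comp1m.
- exact: pointed1.
by rewrite dag1 comp1m.
Qed.

Lemma pointed_lift A B (g : hom A B) : exists2 f : hom (pl A) (pl B),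
  pointed f & und f = g.
Proof.
have [f [fl fr]] := pb_ex (pl A) (kk B ∘ g) (pt B).
exists f; last by rewrite undE -compA fl compA kkD_kk comp1m.
split=> //; rewrite -[RHS]compm1; apply: pb_eq_r; rewrite compA -dag_comp.
  by rewrite fl dag_comp -compA kkD_pt comp_zm.
by rewrite fr ptD_pt.
Qed.

Definition padd A B (f g : hom (pl A) (pl B)) : hom (pl A) (pl B) :=
  locked ((Delta B)^† ∘ (f ⊠ g) ∘ Delta A).
Lemma paddE A B (f g : hom (pl A) (pl B)) :
  padd f g = (Delta B)^† ∘ (f ⊠ g) ∘ Delta A.
Proof. by rewrite /padd -lock. Qed.

Lemma padd_dag A B (f g : hom (pl A) (pl B)) : (padd f g)^† = padd f^† g^†.
Proof. by rewrite !paddE !dag_comp dagK dag_tensm compA. Qed.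

Lemma pointed_padd A B (f g : hom (pl A) (pl B)) :
  pointed f -> pointed g -> pointed (padd f g).
Proof.
have aux A' B' (f' g' : hom (pl A') (pl B')) :
    pointed f' -> pointed g' -> padd f' g' ∘ pt A' = pt B'.
  move=> [pf _] [pg _]; rewrite paddE -compA Delta_pt compA -[X in X ∘ _]compA.
  rewrite tens_rk pg compA -[X in X ∘ _ ∘ _]dagK dag_comp dagK DeltaR dag1.
  by rewrite comp1m.
move=> pf pg; split; first exact: aux.
by rewrite padd_dag; apply: aux; apply: pointed_dag.
Qed.

Lemma paddC A B (f g : hom (pl A) (pl B)) : padd f g = padd g f.
Proof.
by rewrite !paddE -{1}(swap_Delta B) dag_comp dag_swap -!compA
  [swap _ _ ∘ _]compA swap_nat -compA swap_Delta.
Qed.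

Lemma paddA A B (f g h : hom (pl A) (pl B)) :
  padd f (padd g h) = padd (padd f g) h.
Proof.
have s1 (x y z : hom (pl A) (pl B)) : padd x (padd y z) =
    ((idm _ ⊠ Delta B) ∘ Delta B)^† ∘ (x ⊠ (y ⊠ z)) ∘ ((idm _ ⊠ Delta A) ∘ Delta A).
  rewrite !paddE dag_comp dag_tensm dag1 !compA; congr (_ ∘ _).
  by rewrite -!compA !tens_inter !comp1m compm1 !compA.
have s2 (x y z : hom (pl A) (pl B)) : padd (padd x y) z =
    ((Delta B ⊠ idm _) ∘ Delta B)^† ∘ (x ⊠ y ⊠ z) ∘ ((Delta A ⊠ idm _) ∘ Delta A).
  rewrite !paddE dag_comp dag_tensm dag1 !compA; congr (_ ∘ _).
  by rewrite -!compA !tens_inter !comp1m compm1 !compA.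
rewrite s1 s2 !Delta_assoc !dag_comp !dagK !compA.
rewrite -[_ ∘ assoc _ _ _ ∘ _]compA assoc_nat !compA.
by rewrite (pre (assocVK _ _ _)) compm1.
Qed.

Lemma padd0 A B (f : hom (pl A) (pl B)) : padd f (pt B ∘ (pt A)^†) = f.
Proof.
have -> : padd f (pt B ∘ (pt A)^†) =
    (Delta B)^† ∘ (idm _ ⊠ pt B) ∘ (f ⊠ idm Iob) ∘ ((idm _ ⊠ (pt A)^†) ∘ Delta A).
  rewrite paddE !compA; congr (_ ∘ _).
  by rewrite -!compA !tens_inter !comp1m !compm1.
rewrite (_ : idm _ ⊠ (pt A)^† = (runit _)^† ∘ (rk (pt A) _)^†); last first.
  by rewrite rkE dag_comp dag_tensm dagK dag1 compA runitK comp1m.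
rewrite -[_ ∘ _ ∘ Delta A]compA DeltaR compm1 -compA runitV_nat compA.
rewrite -[X in X ∘ _]compA -rkE -[X in X ∘ _]dagK dag_comp dagK DeltaR dag1.
exact: comp1m.
Qed.

Lemma comp_padd A B D (h : hom (pl B) (pl D)) (f g : hom (pl A) (pl B)) :
  pointed h -> h ∘ padd f g = padd (h ∘ f) (h ∘ g).
Proof.
move=> ph; rewrite !paddE -tens_inter !compA; congr (_ ∘ _ ∘ _).
apply: dag_inj; rewrite !dag_comp !dagK dag_tensm.
by rewrite Delta_nat //; apply: pointed_dag.
Qed.

Lemma padd_comp A B D (h : hom (pl D) (pl A)) (f g : hom (pl A) (pl B)) :
  pointed h -> padd f g ∘ h = padd (f ∘ h) (g ∘ h).
Proof. by move=> ph; rewrite !paddE -tens_inter -!compA Delta_nat. Qed.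

(** [th] reassociates [B ∔ (A ∔ I)] into [(A ∔ B) ∔ I], and the sum is [th ∘ th^†] because
    [(a^† ⊗ b^†) ∘ Delta] is supported and hence equal to [jj ∘ th^†]. The idempotent [th ∘ th^†]
    fixes the injections of [A], [B] and [I], so it is the identity. *)
Lemma pb_complete A B (a : hom (pl A) (pl (pb A B))) (b : hom (pl B) (pl (pb A B))) :
  pointed a -> pointed b -> und a = il -> und b = ir ->
  padd (a ∘ a^†) (b ∘ b^†) = idm _.
Proof.
move=> pa pb' ea eb; set W := pb A B in a b pa pb' ea eb *.
have pp := ptD_pt A.
pose th := (Delta W)^† ∘ (a ⊠ b) ∘ jj (pt A) B.
have DR : (Delta W)^† ∘ rk (pt W) _ = idm _.
  by rewrite -[LHS]dagK dag_comp dagK DeltaR dag1.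
have DL : (Delta W)^† ∘ lk (pt W) _ = idm _.
  by rewrite -[LHS]dagK dag_comp dagK DeltaL dag1.
have thl : th ∘ il = b ∘ kk B.
  rewrite /th -compA jj_l !compA -[_ ∘ lk _ _]compA tens_lk (proj1 pa).
  by rewrite compA DL comp1m.
have thr : th ∘ ir = a.
  by rewrite /th -compA jj_r -compA tens_rk (proj1 pb') compA DR comp1m.
have ia : a^† ∘ a = idm _ by apply: und_iso; rewrite // ea ilD_il.
have ib : b^† ∘ b = idm _ by apply: und_iso; rewrite // eb irD_ir.
have ab : a^† ∘ b = pt A ∘ (pt B)^†.
  apply: und_zm; first by apply: pointed_comp => //; apply: pointed_dag.
  by rewrite und_comp // und_dag ea eb ilD_ir.
have ith : th^† ∘ th = idm _.
  apply: pb_iso; rewrite ?thl ?thr //.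
    by rewrite dag_comp compA (pre ib) compm1 kkD_kk.
  by rewrite compA ab -compA ptD_kk comp_zm.
have pth : th ∘ th^† ∘ (th ∘ th^†) = th ∘ th^†.
  by rewrite compA (pre ith) compm1.
have rg X (x : hom X _) : th ∘ th^† ∘ (th ∘ x) = th ∘ x.
  by rewrite compA (pre ith) compm1.
have cth : th ∘ th^† = idm _.
  rewrite -[LHS]compm1; apply: (pb_range (W := pl W)) => //; last first.
    by rewrite compm1 comp1m -[pb_inr _](proj1 pa) -thr -[th ∘ ir ∘ _]compA rg.
  rewrite compm1 comp1m -/(kk W); apply: pb_range => //.
    by rewrite -compA -ea -pointed_kk // -thr -[th ∘ ir ∘ _]compA rg.
  by rewrite -compA -eb -pointed_kk // -thl rg.
have s : supp (pt A) ((a^† ⊠ b^†) ∘ Delta W).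
  apply: (supp_tens (ptD_pt W) pp (proj2 pa) _ (Delta_supp W)).
  exact: pointed_dag.
set x := (a^† ⊠ b^†) ∘ Delta W in s.
have xE : x = jj (pt A) B ∘ th^†.
  by rewrite /th !dag_comp dag_tensm dagK -/x compA s.
have -> : padd (a ∘ a^†) (b ∘ b^†) = x^† ∘ x.
  by rewrite paddE -tens_inter /x dag_comp dag_tensm !dagK !compA.
by rewrite xE dag_comp dagK compA (pre (jj_iso pp B)) compm1.
Qed.

Record pm A B := Pm { pmv :> hom (pl A) (pl B); pmP : pointed pmv }.

Lemma pm_inj A B (f g : pm A B) : pmv f = pmv g -> f = g.
Proof.
case: f g => f pf [g pg] /= e; subst g; congr Pm; exact: Prop_irrelevance.
Qed.

Definition pm1 A : pm A A := Pm (pointed1 A).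
Definition pmc A B D (g : pm B D) (f : pm A B) : pm A D :=
  Pm (pointed_comp (pmP g) (pmP f)).
Definition pmd A B (f : pm A B) : pm B A := Pm (pointed_dag (pmP f)).
Definition pm0 A B : pm A B := Pm (pointed0 A B).
Definition pma A B (f g : pm A B) : pm A B := Pm (pointed_padd (pmP f) (pmP g)).

Lemma pmaA A B : associative (@pma A B).
Proof. by move=> f g h; apply/pm_inj/paddA. Qed.
Lemma pmaC A B : commutative (@pma A B).
Proof. by move=> f g; apply/pm_inj/paddC. Qed.
Lemma pma0 A B : left_id (pm0 A B) (@pma A B).
Proof. by move=> f; rewrite pmaC; apply/pm_inj/padd0. Qed.

HB.instance Definition _ A B := gen_eqMixin (pm A B).
HB.instance Definition _ A B := gen_choiceMixin (pm A B).
HB.instance Definition _ A B :=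
  GRing.isNmodule.Build (pm A B) (@pmaA A B) (@pmaC A B) (@pma0 A B).

End PointedCategory.

(** * Matrices over the scalars *)

Section PointedAlgebra.
Variable P : sup_category.
Implicit Types A B D X Y : P.
Local Open Scope ring_scope.

Lemma pmcA A B D X (h : pm D X) (g : pm B D) (f : pm A B) :
  pmc h (pmc g f) = pmc (pmc h g) f.
Proof. exact/pm_inj/compA. Qed.
Lemma pm1c A B (f : pm A B) : pmc (pm1 B) f = f.
Proof. exact/pm_inj/comp1m. Qed.
Lemma pmc1 A B (f : pm A B) : pmc f (pm1 A) = f.
Proof. exact/pm_inj/compm1. Qed.
Lemma pmdK A B (f : pm A B) : pmd (pmd f) = f.
Proof. exact/pm_inj/dagK. Qed.
Lemma pmd1 A : pmd (pm1 A) = pm1 A.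
Proof. exact/pm_inj/dag1. Qed.
Lemma pmdc A B D (g : pm B D) (f : pm A B) : pmd (pmc g f) = pmc (pmd f) (pmd g).
Proof. exact/pm_inj/dag_comp. Qed.

Lemma pmcDr A B D (g : pm B D) (f f' : pm A B) :
  pmc g (f + f') = pmc g f + pmc g f'.
Proof. exact/pm_inj/comp_padd/pmP. Qed.
Lemma pmcDl A B D (g g' : pm B D) (f : pm A B) :
  pmc (g + g') f = pmc g f + pmc g' f.
Proof. exact/pm_inj/padd_comp/pmP. Qed.
Lemma pmc0r A B D (g : pm B D) : pmc g (0 : pm A B) = 0.
Proof. by apply: pm_inj; rewrite /= compA (proj1 (pmP g)). Qed.
Lemma pmdD A B (f g : pm A B) : pmd (f + g) = pmd f + pmd g.
Proof. exact/pm_inj/padd_dag. Qed.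
Lemma pmd0 A B : pmd (0 : pm A B) = 0.
Proof. by apply: pm_inj; rewrite /= dag_comp dagK. Qed.
Lemma pmc0l A B D (f : pm A B) : pmc (0 : pm B D) f = 0.
Proof. by rewrite -[LHS]pmdK pmdc pmd0 pmc0r pmd0. Qed.

Lemma pmc_sumr A B D (I : finType) (g : pm B D) (F : I -> pm A B) :
  pmc g (\sum_i F i) = \sum_i pmc g (F i).
Proof. exact: (big_morph _ (pmcDr g) (pmc0r _ g)). Qed.
Lemma pmc_suml A B D (I : finType) (F : I -> pm B D) (f : pm A B) :
  pmc (\sum_i F i) f = \sum_i pmc (F i) f.
Proof. exact: (big_morph (fun g => pmc g f) (fun g h => pmcDl g h f) (pmc0l _ f)). Qed.
Definition sring : Type := pm (Iob : P) Iob.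
HB.instance Definition _ := GRing.Nmodule.on sring.

(** The order is that of matrices, where [g ∘ f] is [f *m g]. *)
Definition smul (s t : sring) : sring := pmc t s.
Definition sone : sring := pm1 _.

Lemma smulA : associative smul.
Proof. by move=> s t u; rewrite /smul pmcA. Qed.
Lemma smulC : commutative smul.
Proof. by move=> s t; apply/pm_inj/diag_comm; apply/pointed_diag/pmP. Qed.
Lemma smul1 : left_id sone smul.
Proof. by move=> s; apply: pmc1. Qed.
Lemma smulDl : left_distributive smul +%R.
Proof. by move=> s t u; apply: pmcDr. Qed.
Lemma smul0 : left_zero 0 smul.
Proof. by move=> s; apply: pmc0r. Qed.

HB.instance Definition _ :=
  GRing.Nmodule_isComPzSemiRing.Build sring smulA smulC smul1 smulDl smul0.

Definition sinv (s : sring) : sring := pmd s.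
Lemma sinv_nmod : GRing.nmod_morphism sinv.
Proof. by split; [apply: pmd0|move=> s t; apply: pmdD]. Qed.
Lemma sinv_monoid : GRing.monoid_morphism sinv.
Proof.
split; first exact: pmd1.
by move=> s t; rewrite [s * t]mulrC; apply: pmdc.
Qed.
HB.instance Definition _ := GRing.isNmodMorphism.Build sring sring sinv sinv_nmod.
HB.instance Definition _ := GRing.isMonoidMorphism.Build sring sring sinv sinv_monoid.

Definition scalars : involutive_semiring :=
  @InvolutiveSemiring sring sinv (fun s => pmdK s).

End PointedAlgebra.

(** * Orthonormal bases, and matrices of pointed maps *)

Section Bases.
Variable P : sup_category.
Implicit Types A B D X Y : P.
Local Open Scope ring_scope.

Lemma lft_ex A B (g : hom A B) : exists f : pm A B, und f = g.
Proof. by have [f pf e] := pointed_lift g; exists (Pm pf). Qed.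
Definition lft A B (g : hom A B) : pm A B := sval (cid (lft_ex g)).
Lemma und_lft A B (g : hom A B) : und (lft g) = g.
Proof. exact: svalP (cid (lft_ex g)). Qed.

Lemma lft_iso A B (g : hom A B) : (g^† ∘ g)%cat = idm A ->
  pmc (pmd (lft g)) (lft g) = pm1 A.
Proof. by move=> i; apply/pm_inj/und_iso; rewrite ?und_lft //; apply: pmP. Qed.

Lemma und_pmc A B D (g : pm B D) (f : pm A B) : und (pmc g f) = (und g ∘ und f)%cat.
Proof. exact/und_comp/pmP. Qed.
Lemma und_pmd A B (f : pm A B) : und (pmd f) = (und f)^†%cat.
Proof. exact: und_dag. Qed.

Lemma und_eq0 A B (f : pm A B) : und f = zm A B -> f = 0.
Proof. by move=> e; apply: pm_inj; apply: und_zm e; apply: pmP. Qed.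

Lemma pm_pos A B B' (f : pm A B) (g : pm A B') :
  ((und f)^† ∘ und f = (und g)^† ∘ und g)%cat ->
  pmc (pmd f) f = pmc (pmd g) g.
Proof. by move=> e; apply/pm_inj/und_pos => //; apply: pmP. Qed.

Fixpoint Eo (n : nat) : P := if n is m.+1 then pb_obj (pb (Eo m) Iob) else zob P.

(** The lifts of the injections are chosen arbitrarily among those differing by phases; any choice
    gives an orthonormal basis. Index 0 is the outermost summand. *)
Fixpoint eps (n : nat) : 'I_n -> pm Iob (Eo n) :=
  match n with
  | 0 => fun _ => 0
  | m.+1 => fun i => if unlift ord0 i is Some j
      then pmc (lft (pb_inl (pb (Eo m) Iob))) (@eps m j)
      else lft (pb_inr (pb (Eo m) Iob))
  end.

Lemma eps_ortho n (i j : 'I_n) :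
  pmc (pmd (eps i)) (eps j) = ((i == j)%:R : sring P).
Proof.
elim: n i j => [[]//|n IH] i j /=.
have ll := lft_iso (ilD_il (pb (Eo n) Iob)).
have rr := lft_iso (irD_ir (pb (Eo n) Iob)).
have lr : pmc (pmd (lft (pb_inl (pb (Eo n) Iob)))) (lft (pb_inr (pb (Eo n) Iob))) = 0.
  by apply: und_eq0; rewrite und_pmc und_pmd !und_lft ilD_ir.
have rl : pmc (pmd (lft (pb_inr (pb (Eo n) Iob)))) (lft (pb_inl (pb (Eo n) Iob))) = 0.
  by apply: und_eq0; rewrite und_pmc und_pmd !und_lft irD_il.
case: (unliftP ord0 i) => [i'|] ->; case: (unliftP ord0 j) => [j'|] ->.
- rewrite pmdc -pmcA [pmc (pmd (lft _)) _]pmcA ll pm1c IH.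
  by rewrite (inj_eq (@lift_inj _ _)).
- rewrite pmdc -pmcA lr pmc0r eq_sym (negPf (neq_lift _ _)) //.
- by rewrite pmcA rl pmc0l (negPf (neq_lift _ _)).
- by rewrite rr eqxx.
Qed.

Lemma eps_complete n : \sum_i pmc (eps i) (pmd (eps i)) = pm1 (Eo n).
Proof.
elim: n => [|n IH].
  (* On the zero object the identity has a zero underlying map, so it is the empty sum. *)
  rewrite big_ord0; apply/esym/und_eq0; exact: to_zobE.
rewrite big_ord_recl /= unlift_none.
under eq_bigr => i _ do rewrite liftK pmdc -pmcA [pmc (eps i) _]pmcA.
rewrite -pmc_sumr -pmc_suml IH pm1c addrC; apply: pm_inj.
by apply: pb_complete; rewrite ?und_lft //; apply: pmP.
Qed.

Lemma pm_ext_l n A (f g : pm (Eo n) A) :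
  (forall i, pmc f (eps i) = pmc g (eps i)) -> f = g.
Proof.
move=> e; rewrite -[f]pmc1 -[g]pmc1 -eps_complete !pmc_sumr.
by apply: eq_bigr => i _; rewrite !pmcA e.
Qed.

Lemma pm_ext_r n A (f g : pm A (Eo n)) :
  (forall i, pmc (pmd (eps i)) f = pmc (pmd (eps i)) g) -> f = g.
Proof.
move=> e; rewrite -[f]pm1c -[g]pm1c -eps_complete !pmc_suml.
by apply: eq_bigr => i _; rewrite -!pmcA e.
Qed.

Local Notation S := (scalars P).
Local Notation Mx m n := 'M[isr S]_(m, n).

Definition mf n m (f : pm (Eo n) (Eo m)) : Mx n m :=
  \matrix_(i, j) (pmc (pmd (eps j)) (pmc f (eps i)) : sring P).

Lemma mfE n m (f : pm (Eo n) (Eo m)) i j :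
  mf f i j = pmc (pmd (eps j)) (pmc f (eps i)).
Proof. by rewrite mxE. Qed.

Lemma mf_inj n m (f g : pm (Eo n) (Eo m)) : mf f = mf g -> f = g.
Proof.
move=> e; apply: pm_ext_l => i; apply: pm_ext_r => j.
by rewrite -!mfE e.
Qed.

Definition fm n m (M : Mx n m) : pm (Eo n) (Eo m) :=
  \sum_i \sum_j pmc (eps j) (pmc (M i j : sring P) (pmd (eps i))).

Lemma fm_eps n m (M : Mx n m) i j : pmc (pmd (eps j)) (pmc (fm M) (eps i)) = M i j.
Proof.
rewrite /fm pmc_suml pmc_sumr (bigD1 i) //= [X in _ + X]big1 ?addr0 => [|k ki].
  rewrite pmc_suml pmc_sumr (bigD1 j) //= [X in _ + X]big1 ?addr0 => [|k kj].
    by rewrite -!pmcA eps_ortho eqxx pmc1 pmcA eps_ortho eqxx pm1c.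
  by rewrite -!pmcA pmcA eps_ortho eq_sym (negPf kj) pmc0l.
rewrite pmc_suml pmc_sumr big1 // => l _.
by rewrite -!pmcA eps_ortho (negPf ki) !pmc0r.
Qed.

Lemma fmK n m (M : Mx n m) : mf (fm M) = M.
Proof. by apply/matrixP => i j; rewrite mfE fm_eps. Qed.

Lemma mfK n m (f : pm (Eo n) (Eo m)) : fm (mf f) = f.
Proof. by apply: mf_inj; rewrite fmK. Qed.

Lemma mf_comp n m p (g : pm (Eo m) (Eo p)) (f : pm (Eo n) (Eo m)) :
  mf (pmc g f) = mf f *m mf g.
Proof.
apply/matrixP => i j; rewrite mfE mxE.
have -> : pmc g f = \sum_k pmc (pmc g (eps k)) (pmc (pmd (eps k)) f).
  rewrite -{1}[f]pm1c -eps_complete pmc_suml pmc_sumr.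
  by apply: eq_bigr => k _; rewrite !pmcA.
rewrite pmc_suml pmc_sumr; apply: eq_bigr => k _; rewrite !mfE.
transitivity (pmc (pmc (pmd (eps j)) (pmc g (eps k)))
                  (pmc (pmd (eps k)) (pmc f (eps i)))).
  by rewrite -!pmcA.
by [].
Qed.

Lemma mf1 n : mf (pm1 (Eo n)) = 1%:M.
Proof. by apply/matrixP => i j; rewrite mfE pm1c eps_ortho mxE eq_sym. Qed.

Lemma mf_dag n m (f : pm (Eo n) (Eo m)) : mf (pmd f) = dagmx (mf f).
Proof. by apply/matrixP => i j; rewrite !mxE /= /sinv !pmdc pmdK pmcA. Qed.

Lemma fm_mul n m p (M : Mx n m) (N : Mx m p) : fm (M *m N) = pmc (fm N) (fm M).
Proof. by apply: mf_inj; rewrite mf_comp !fmK. Qed.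
Lemma fm1 n : fm 1%:M = pm1 (Eo n).
Proof. by rewrite -mf1 mfK. Qed.
Lemma fm_dag n m (M : Mx n m) : fm (dagmx M) = pmd (fm M).
Proof. by apply: mf_inj; rewrite mf_dag !fmK. Qed.

End Bases.

(** * The monoidal structure of the matrix functor *)

Section Monoidal.
Variable P : sup_category.
Implicit Types A B D X Y : P.
Local Notation il := (pb_inl _).
Local Notation ir := (pb_inr _).
Local Notation T := (pb_obj (pl (Iob : P))).
Local Notation S := (scalars P).
Local Notation Mx m n := 'M[isr S]_(m, n).
Local Notation idx := (@mxtens_index _ _).
Local Notation uidx := (@mxtens_unindex _ _).

Lemma bi_ex A B : exists c : hom (pl (A ⊗ B)) (pl A ⊗ pl B),
  c ∘ kk _ = kk A ⊠ kk B /\ c ∘ pt _ = rk (pt B) _ ∘ pt A.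
Proof. exact: pb_ex. Qed.
Definition bi A B := sval (cid (bi_ex A B)).
Lemma bi_kk A B : bi A B ∘ kk _ = kk A ⊠ kk B.
Proof. by case: (svalP (cid (bi_ex A B))). Qed.
Lemma bi_pt A B : bi A B ∘ pt _ = rk (pt B) _ ∘ pt A.
Proof. by case: (svalP (cid (bi_ex A B))). Qed.

Lemma ptpt_iso A B : (rk (pt B) (pl A) ∘ pt A)^† ∘ (rk (pt B) (pl A) ∘ pt A) = idm _.
Proof. by rewrite dag_comp compA (pre (rkD_rk _ (ptD_pt B))) compm1 ptD_pt. Qed.

Lemma ptptD_kk A B : (rk (pt B) (pl A) ∘ pt A)^† ∘ (kk A ⊠ kk B) = zm _ _.
Proof. by rewrite dag_comp -compA rkD_tens compA ptD_kk zm_comp. Qed.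

Lemma bi_iso A B : (bi A B)^† ∘ bi A B = idm _.
Proof.
apply: pb_iso; rewrite -/(kk _) -/(pt _) ?bi_kk ?bi_pt ?ptpt_iso ?ptptD_kk //.
by apply: tens_iso; apply: kkD_kk.
Qed.

(** The idempotent [bi ∘ bi^†] fixes [h] on both summands of [pl D], hence fixes [h]. *)
Lemma bi_factor A B D (h : hom (pl D) (pl A ⊗ pl B)) (y : hom D (A ⊗ B)) :
  h ∘ kk D = (kk A ⊠ kk B) ∘ y -> h ∘ pt D = rk (pt B) _ ∘ pt A ->
  exists f : pm D (A ⊗ B), bi A B ∘ f = h /\ und f = y.
Proof.
move=> hk hp.
have rg X (x : hom X _) : bi A B ∘ (bi A B)^† ∘ (bi A B ∘ x) = bi A B ∘ x.
  by rewrite compA (pre (bi_iso A B)) compm1.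
have pf : pointed ((bi A B)^† ∘ h).
  split; first by rewrite -compA hp -bi_pt compA bi_iso comp1m.
  rewrite dag_comp dagK -compA bi_pt -[RHS]compm1.
  apply: pb_eq_r; rewrite compA -dag_comp -/(kk D) -/(pt D) ?hk ?hp.
    by apply: dag_inj; rewrite !dag_comp !dagK compA -dag_comp ptptD_kk zm_comp dag_zm.
  exact: ptpt_iso.
exists (Pm pf); split=> /=.
  rewrite compA; apply: (pb_range (W := pl D)).
  - by rewrite compA (pre (bi_iso A B)) compm1.
  - by rewrite -compA -/(kk D) hk -bi_kk -[bi A B ∘ _ ∘ y]compA rg.
  - by rewrite -compA -/(pt D) hp -bi_pt rg.
rewrite undE -compA -[_ ∘ h ∘ _]compA hk -bi_kk !compA (pre (bi_iso A B)).
by rewrite compm1 kkD_kk comp1m.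
Qed.

Lemma smash_ex A B A' B' (f : pm A A') (g : pm B B') :
  exists h : pm (A ⊗ B) (A' ⊗ B'),
    bi A' B' ∘ h = (f ⊠ g) ∘ bi A B /\ und h = und f ⊠ und g.
Proof.
apply: bi_factor; rewrite -compA ?bi_kk ?bi_pt.
  by rewrite !tens_inter !pointed_kk //; apply: pmP.
by rewrite compA tens_rk -compA (proj1 (pmP f)) (proj1 (pmP g)).
Qed.

(** Both states depend on the same [T], which [delta] duplicates: [k1] becomes [k1 ⊗ k1] and the
    base point [k0] becomes [k0 ⊗ k0]. *)
Lemma wd_ex A B (s : pm Iob A) (t : pm Iob B) : exists h : pm Iob (A ⊗ B),
  bi A B ∘ h = (s ⊠ t) ∘ delta P /\ und h = rk (und t) A ∘ und s.
Proof.
apply: bi_factor; rewrite -compA ?delta_k1 ?delta_k0 compA tens_rk -compA.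
  rewrite !pointed_kk; try exact: pmP.
  by rewrite !compA tens_rk.
by rewrite (proj1 (pmP s)) (proj1 (pmP t)).
Qed.
Definition wd A B (s : pm Iob A) (t : pm Iob B) := sval (cid (wd_ex s t)).
Lemma bi_wd A B (s : pm Iob A) (t : pm Iob B) :
  bi A B ∘ wd s t = (s ⊠ t) ∘ delta P.
Proof. by case: (svalP (cid (wd_ex s t))). Qed.
Lemma und_wd A B (s : pm Iob A) (t : pm Iob B) :
  und (wd s t) = rk (und t) A ∘ und s.
Proof. by case: (svalP (cid (wd_ex s t))). Qed.

Lemma wdD_wd A B (s s' : pm Iob A) (t t' : pm Iob B) :
  pmc (pmd (wd s t)) (wd s' t') = pmc (pmc (pmd s) s') (pmc (pmd t) t').
Proof.
apply: pm_inj => /=.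
rewrite -[pmv (wd s' t')]comp1m -(bi_iso A B) -compA bi_wd compA -dag_comp bi_wd.
rewrite dag_comp dag_tensm -compA [(_ ⊠ _) ∘ (_ ∘ _)]compA tens_inter compA.
by rewrite delta_tens //; apply: pointed_diag; apply: pointed_comp;
  rewrite ?(pmP s) //; try apply: pointed_dag; apply: pmP.
Qed.

Lemma smash_wd A B A' B' (f : pm A A') (g : pm B B') (h : pm (A ⊗ B) (A' ⊗ B')) s t :
  bi A' B' ∘ h = (f ⊠ g) ∘ bi A B -> pmc h (wd s t) = wd (pmc f s) (pmc g t).
Proof.
move=> e; apply: pm_inj; apply: (iso_inj (bi_iso A' B')).
by rewrite bi_wd /= compA e -compA bi_wd compA tens_inter.
Qed.

Definition kap n (i : 'I_n) : hom Iob (Eo P n) := und (eps P i).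

Lemma kap_lift n (i : 'I_n) : kap (lift ord0 i) = pb_inl (pb (Eo P n) Iob) ∘ kap i.
Proof. by rewrite /kap /= liftK und_pmc und_lft. Qed.
Lemma kap_0 n : kap (ord0 : 'I_n.+1) = pb_inr (pb (Eo P n) Iob).
Proof. by rewrite /kap /= unlift_none und_lft. Qed.

Lemma eps_kk n (i : 'I_n) : eps P i ∘ kk _ = kk _ ∘ kap i.
Proof. exact/pointed_kk/pmP. Qed.
Lemma kapD_kap n (i : 'I_n) : (kap i)^† ∘ kap i = idm _.
Proof.
by rewrite /kap -und_pmd -und_pmc eps_ortho eqxx und1.
Qed.

(** Induction on the number of summands, each step being the argument of [pb_range] with the phases
    [idm X ⊠ U]. *)
Lemma range_tens X Y n (e : hom Y Y) (f : hom (X ⊗ Eo P n) Y) : e ∘ e = e ->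
  (forall i, e ∘ f ∘ rk (kap i) X = f ∘ rk (kap i) X) -> e ∘ f = f.
Proof.
move=> ee; elim: n f => [|n IH] f ef.
  by rewrite -[LHS]curK -[RHS]curK; congr unc; apply: from_zobE.
have [||U hU eU] := @tens_phase _ X _ _ (pb (Eo P n) Iob) _ f (e ∘ f).
- rewrite -compA IH // => i; rewrite -!compA !tens1_rk -kap_lift compA.
  exact: ef.
- have i : (runit X)^† ∘ (runit X)^†^† = idm _ by rewrite dagK runitK.
  apply: (coiso_inj i); move: (ef ord0); rewrite kap_0 rkE !compA => ->.
  by [].
have uU : (idm X ⊠ U) ∘ (idm X ⊠ U)^† = idm _.
  by apply: tens_coiso; rewrite ?phaseVK // dag1 comp1m.
by rewrite {1}[f](shift_r uU (esym eU)) !compA ee eU -compA uU compm1.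
Qed.

Lemma range_basis Y n (e : hom Y Y) (f : hom (Eo P n) Y) : e ∘ e = e ->
  (forall i, e ∘ f ∘ kap i = f ∘ kap i) -> e ∘ f = f.
Proof.
move=> ee ef; apply: (coiso_inj (lunitVK _)); rewrite -compA.
apply: range_tens => // i.
by rewrite rkI !compA !(pre (lunitVK _)) !compm1.
Qed.

(** The matrix of [x^† ∘ x'] is the identity, and [x ∘ x^†] fixes [x'] since it does so on the basis
    and at the base point. Testing on the pointed [eps P i], instead of their underlying states, is
    what leaves no phase free. *)
Lemma basis_iso_eq n Y (x x' : hom (pl (Eo P n)) Y) :
  x^† ∘ x = idm _ -> x'^† ∘ x' = idm _ -> x ∘ pt _ = x' ∘ pt _ ->
  (forall i, x ∘ eps P i = x' ∘ eps P i) -> x = x'.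
Proof.
move=> ix ix' ep ee.
have pf : pointed (x^† ∘ x').
  split; first by rewrite -compA -ep compA ix comp1m.
  by rewrite dag_comp dagK -compA ep compA ix' comp1m.
have f1 : x^† ∘ x' = idm _.
  have -> : idm (pl (Eo P n)) = pm1 _ by [].
  have -> : x^† ∘ x' = Pm pf by [].
  congr pmv; apply: mf_inj; rewrite mf1; apply/matrixP => i j.
  rewrite mfE mxE eq_sym -eps_ortho; apply: pm_inj => /=.
  by rewrite -compA -ee !compA (pre ix) compm1.
have xx : x ∘ x^† ∘ (x ∘ x^†) = x ∘ x^† by rewrite compA (pre ix) compm1.
have rg X (z : hom X _) : x ∘ x^† ∘ (x ∘ z) = x ∘ z.
  by rewrite compA (pre ix) compm1.
have : x ∘ x^† ∘ x' = x'.
  apply: (pb_range (W := pl _)) => //; last by rewrite -compA -/(pt _) -ep rg.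
  rewrite -compA -/(kk _); apply: range_basis => // i.
  by rewrite -!compA -eps_kk [x' ∘ _]compA -ee -[x ∘ _ ∘ _]compA [LHS]compA rg.
by rewrite -compA f1 compm1.
Qed.

Definition theta n m : pm (Eo P (n * m)) (Eo P n ⊗ Eo P m) :=
  (\sum_k pmc (wd (eps P (uidx k).1) (eps P (uidx k).2)) (pmd (eps P k)))%R.

Lemma theta_eps n m (k : 'I_(n * m)) :
  pmc (theta n m) (eps P k) = wd (eps P (uidx k).1) (eps P (uidx k).2).
Proof.
rewrite /theta pmc_suml (bigD1 k) //= big1 ?addr0 => [|l lk].
  by rewrite -pmcA eps_ortho eqxx pmc1.
by rewrite -pmcA eps_ortho (negPf lk) pmc0r.
Qed.

Lemma theta_iso n m : pmc (pmd (theta n m)) (theta n m) = pm1 _.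
Proof.
apply: mf_inj; rewrite mf1; apply/matrixP => k l.
rewrite mfE -pmcA theta_eps pmcA -pmdc theta_eps wdD_wd !eps_ortho mxE.
have -> : (k == l) = ((uidx k).1 == (uidx l).1) && ((uidx k).2 == (uidx l).2).
  case: {k}(mxtens_indexP k) => i j; case: {l}(mxtens_indexP l) => i' j'.
  by rewrite idx_eq !mxtens_indexK.
rewrite -mulnb natrM mulrC ![(uidx k).1 == _]eq_sym ![(uidx k).2 == _]eq_sym.
by [].
Qed.

Definition phi n m : hom (Eo P n ⊗ Eo P m) (Eo P (n * m)) :=
  und (pmd (theta n m)).

Lemma phiD n m : (phi n m)^† = und (theta n m).
Proof. by rewrite /phi und_dag dagK. Qed.

Lemma phi_coiso n m : phi n m ∘ (phi n m)^† = idm _.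
Proof. by rewrite phiD -und_pmc theta_iso und1. Qed.

(** The idempotent [phi^† ∘ phi] fixes every product of basis states, each being the image under
    [phi^†] of a basis state of [Eo P (n * m)]. *)
Lemma phi_iso n m : (phi n m)^† ∘ phi n m = idm _.
Proof.
set e := _ ∘ _.
have ee : e ∘ e = e by rewrite /e compA (pre (phi_coiso _ _)) compm1.
suff: e ∘ idm _ = idm _ by rewrite compm1.
apply: range_tens => // j; rewrite compm1 comp1m; apply: range_basis => // i.
have := theta_eps (idx (i, j)); rewrite mxtens_indexK /= => th.
rewrite -[LHS]compA; have <- : (phi n m)^† ∘ kap (idx (i, j)) = rk (kap j) _ ∘ kap i.
  by rewrite phiD /kap -und_pmc th und_wd.
by rewrite /e compA (pre (phi_coiso _ _)) compm1.
Qed.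

(* [bh] is the embedding of [I ∔ (A ⊗ B)] into [(I ∔ A) ⊗ (I ∔ B)] for [A = Eo n] and
   [B = Eo m]; its normalisation on the basis makes the coherence laws of [phi] hold
   exactly and not only up to phases. *)
Definition bh n m : hom (pl (Eo P (n * m))) (pl (Eo P n) ⊗ pl (Eo P m)) :=
  locked (bi _ _ ∘ theta n m).

Lemma bh_kk n m : bh n m ∘ kk _ = (kk _ ⊠ kk _) ∘ (phi n m)^†.
Proof.
by rewrite /bh -lock -compA pointed_kk ?compA ?bi_kk ?phiD //; apply: pmP.
Qed.
Lemma bh_pt n m : bh n m ∘ pt _ = rk (pt _) _ ∘ pt _.
Proof. by rewrite /bh -lock -compA (proj1 (pmP _)) bi_pt. Qed.
Lemma bh_iso n m : (bh n m)^† ∘ bh n m = idm _.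
Proof.
rewrite /bh -lock; apply: iso_comp; first exact: bi_iso.
exact: (congr1 (@pmv _ _ _) (theta_iso n m)).
Qed.
Lemma bh_eps n m (k : 'I_(n * m)) :
  bh n m ∘ eps P k = (eps P (uidx k).1 ⊠ eps P (uidx k).2) ∘ delta P.
Proof.
rewrite /bh -lock -compA -bi_wd; congr (_ ∘ _).
exact: (congr1 (@pmv _ _ _) (theta_eps k)).
Qed.

Definition Qm n m (M : Mx n m) : hom (Eo P n) (Eo P m) := und (fm M).

Lemma Qm_mul n m p (M : Mx n m) (N : Mx m p) : Qm (M *m N)%R = Qm N ∘ Qm M.
Proof. by rewrite /Qm fm_mul und_pmc. Qed.
Lemma Qm1 n : Qm (1%:M%R : Mx n n) = idm _.
Proof. by rewrite /Qm fm1 und1. Qed.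
Lemma Qm_dag n m (M : Mx n m) : Qm (dagmx M) = (Qm M)^†.
Proof. by rewrite /Qm fm_dag und_pmd. Qed.

(** [Qm] forgets phases and may identify different matrices; on products of this positive form
    [pm_pos] rules it out. *)
Lemma Qm_pos n m p (M : Mx n m) (N : Mx n p) :
  (Qm M)^† ∘ Qm M = (Qm N)^† ∘ Qm N -> (M *m dagmx M = N *m dagmx N)%R.
Proof.
move=> e; have := pm_pos e.
by rewrite -!fm_dag -!fm_mul => /(congr1 (@mf _ _ _)); rewrite !fmK.
Qed.

(** Once [phi] is cancelled, both sides underlie pointed maps, and their matrix entries are inner
    products of product states, which [wdD_wd] evaluates. *)
Lemma phi_nat n m n' m' (M : Mx n m) (N : Mx n' m') :
  phi m m' ∘ (Qm M ⊠ Qm N) = Qm (kron M N) ∘ phi n n'.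
Proof.
have [h [hb hu]] := smash_ex (fm M) (fm N).
have i : (phi n n')^† ∘ (phi n n')^†^† = idm _ by rewrite dagK phi_iso.
apply: (coiso_inj i); rewrite -[RHS]compA phi_coiso compm1 /Qm -hu phiD.
rewrite -und_pmc -und_pmc; congr und.
congr pmv; apply: mf_inj; rewrite fmK; apply/matrixP => k l.
rewrite mfE pmcA -!pmcA theta_eps (smash_wd _ _ hb) pmcA -pmdc theta_eps.
by rewrite wdD_wd !fm_eps mxE mulrC.
Qed.

Lemma fm_fmx n m (f : 'I_n -> 'I_m) i : pmc (fm (fmx S f)) (eps P i) = eps P (f i).
Proof.
apply: pm_ext_r => j; rewrite fm_eps mxE eps_ortho eq_sym.
by [].
Qed.

Lemma fm_fmx_iso n m (f : 'I_n -> 'I_m) g : cancel f g -> cancel g f ->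
  (fm (fmx S f))^† ∘ fm (fmx S f) = idm _.
Proof.
move=> fK gK; apply: (congr1 (@pmv _ _ _) (_ : pmc (pmd _) _ = pm1 _)).
rewrite -fm_dag -fm_mul (dag_fmx _ fK gK) fmx_comp -fm1 fmx_id; congr fm.
exact: eq_fmx.
Qed.

End Monoidal.

(** * Coherence laws of [phi] *)

Section Coherence.
Variable P : sup_category.
Local Notation T := (pb_obj (pl (Iob : P))).
Local Notation S := (scalars P).
Local Notation Mx m n := 'M[isr S]_(m, n).
Local Notation idx := (@mxtens_index _ _).
Local Notation uidx := (@mxtens_unindex _ _).
Local Notation phi := (@phi P).
Local Notation bh := (@bh P).

Lemma pm_pt A B (f : pm (A : P) B) : f ∘ pt A = pt B.
Proof. by case: (pmP f). Qed.

Lemma kk2_iso A B : (kk (A : P) ⊠ kk (B : P))^† ∘ (kk A ⊠ kk B) = idm _.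
Proof. by apply: tens_iso; apply: kkD_kk. Qed.

Lemma fm_eps_fmx n m (f : 'I_n -> 'I_m) i :
  fm (fmx S f) ∘ eps P i = eps P (f i).
Proof. exact: (congr1 (@pmv _ _ _) (fm_fmx P f i)). Qed.

(** Proved first for the isometries [bh], where on basis vectors it is the coassociativity of
    [delta], then restricted along [kk]. *)
Lemma phi_assoc n m p : assoc _ _ _ ∘ ((phi n m)^† ⊠ idm _) ∘ (phi (n * m) p)^† =
  (idm _ ⊠ (phi m p)^†) ∘ (phi n (m * p))^† ∘ Qm (fmx S (@aidx n m p)).
Proof.
have e : assoc _ _ _ ∘ (bh n m ⊠ idm _) ∘ bh (n * m) p =
    (idm _ ⊠ bh m p) ∘ bh n (m * p) ∘ fm (fmx S (@aidx n m p)).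
  apply: basis_iso_eq => [||| x].
  - apply: iso_comp; last exact: bh_iso.
    apply: iso_comp; first exact: assocK.
    by apply: tens_iso; rewrite ?bh_iso // dag1 comp1m.
  - apply: iso_comp; last exact: fm_fmx_iso (@aidxK n m p) (@aidxVK n m p).
    apply: iso_comp; last exact: bh_iso.
    by apply: tens_iso; rewrite ?bh_iso // dag1 comp1m.
  - rewrite -!compA pm_pt !bh_pt [(bh _ _ ⊠ _) ∘ _]compA rk_nat -compA bh_pt.
    by rewrite !compA assoc_rk !tens1_rk bh_pt.
  case: {x}(mxtens_indexP x) => x k; case: {x}(mxtens_indexP x) => i j.
  rewrite -[LHS]compA bh_eps -[RHS]compA fm_eps_fmx aidxE -[RHS]compA bh_eps.
  rewrite !mxtens_indexK /= [LHS]compA -[X in X ∘ _ = _]compA tens_inter comp1m.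
  rewrite bh_eps !mxtens_indexK /=.
  rewrite [RHS]compA tens_inter comp1m bh_eps !mxtens_indexK /=.
  have -> : (eps P i ⊠ eps P j ∘ delta P) ⊠ eps P k =
      (eps P i ⊠ eps P j ⊠ eps P k) ∘ (delta P ⊠ idm _).
    by rewrite tens_inter compm1.
  have -> : eps P i ⊠ (eps P j ⊠ eps P k ∘ delta P) =
      (eps P i ⊠ (eps P j ⊠ eps P k)) ∘ (idm _ ⊠ delta P).
    by rewrite tens_inter compm1.
  by rewrite compA assoc_nat -[RHS]compA -delta_assoc !compA.
apply: (iso_inj (_ : (kk _ ⊠ (kk _ ⊠ kk _))^† ∘ (kk _ ⊠ (kk _ ⊠ kk _)) = idm _)).
  by apply: tens_iso; rewrite ?kk2_iso ?kkD_kk.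
move: (congr1 (fun x => x ∘ kk _) e).
rewrite -[LHS]compA bh_kk -[RHS]compA [fm _ ∘ _]pointed_kk; last exact: pmP.
rewrite -/(Qm _) [RHS]compA -[_ ∘ bh _ _ ∘ kk _]compA bh_kk !compA.
rewrite -[X in X ∘ _ = _]compA tens_inter bh_kk comp1m tens_inter comp1m bh_kk.
have -> : (kk _ ⊠ kk _ ∘ (phi n m)^†) ⊠ kk (Eo P p) =
   (kk _ ⊠ kk _ ⊠ kk _) ∘ ((phi n m)^† ⊠ idm _) by rewrite tens_inter compm1.
have -> : kk _ ⊠ (kk _ ⊠ kk _ ∘ (phi m p)^†) =
   (kk (Eo P n) ⊠ (kk _ ⊠ kk _)) ∘ (idm _ ⊠ (phi m p)^†) by rewrite tens_inter compm1.
by move=> h; rewrite -assoc_nat -[assoc _ _ _ ∘ _ ∘ _]compA.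
Qed.

Lemma phi_swap n m : swap _ _ ∘ (phi n m)^† = (phi m n)^† ∘ Qm (fmx S (@sidx n m)).
Proof.
have e : swap _ _ ∘ bh n m = bh m n ∘ fm (fmx S (@sidx n m)).
  apply: basis_iso_eq => [||| x].
  - apply: iso_comp; last exact: bh_iso.
    by case: (swap_unitary (pl (Eo P n)) (pl (Eo P m))).
  - apply: iso_comp; last exact: fm_fmx_iso (@sidxK n m) (@sidxK m n).
    exact: bh_iso.
  - by rewrite -!compA pm_pt !bh_pt compA swap_rk lk_ket.
  case: {x}(mxtens_indexP x) => i j.
  rewrite -[LHS]compA bh_eps -[RHS]compA fm_eps_fmx sidxE bh_eps.
  by rewrite !mxtens_indexK /= compA swap_nat -compA swap_delta.
apply: (iso_inj (kk2_iso _ _)).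
move: (congr1 (fun x => x ∘ kk _) e).
rewrite -[LHS]compA bh_kk -[RHS]compA [fm _ ∘ _]pointed_kk; last exact: pmP.
by rewrite -/(Qm _) [RHS]compA bh_kk [LHS]compA swap_nat -!compA.
Qed.

(** [eps P ord0] identifies [T] with [pl (Eo P 1)], so that the coaction of [pl (Eo P n)] is the
    pointed form of the unitor. *)
Lemma phi_runit n :
  (phi n 1)^† = rk (kap P (ord0 : 'I_1)) _ ∘ Qm (fmx S (@ridx n)).
Proof.
have e : bh n 1 =
    (idm _ ⊠ eps P (ord0 : 'I_1)) ∘ coact (pl (Eo P n)) ∘ fm (fmx S (@ridx n)).
  apply: basis_iso_eq => [||| x].
  - exact: bh_iso.
  - apply: iso_comp; last exact: fm_fmx_iso (@ridxK n) (@ridxVK n).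
    apply: iso_comp; last exact: coact_iso.
    apply: tens_iso; first by rewrite dag1 comp1m.
    by have /(congr1 (@pmv _ _ _)) := eps_ortho P (ord0 : 'I_1) ord0.
  - rewrite bh_pt -compA pm_pt -compA coact_r compA tens1_rk.
    by rewrite (pm_pt (eps P (ord0 : 'I_1))).
  case: {x}(mxtens_indexP x) => i j; rewrite [j]ord1.
  rewrite bh_eps -[RHS]compA fm_eps_fmx ridxE !mxtens_indexK /= -[RHS]compA.
  rewrite -coact_nat; last exact/pointed_diag/pmP.
  by rewrite compA tens_inter comp1m compm1.
apply: (iso_inj (kk2_iso _ _)); rewrite -bh_kk e -compA pointed_kk; last exact: pmP.
rewrite -/(Qm _) !compA -[_ ∘ coact _ ∘ _]compA coact_l !compA tens1_rk.
rewrite tens_rk; congr (rk _ _ ∘ _ ∘ _).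
exact: eps_kk.
Qed.

Lemma phi_lunit n :
  (phi 1 n)^† = lk (kap P (ord0 : 'I_1)) _ ∘ Qm (fmx S (@lidx n)).
Proof.
have := phi_swap 1 n; rewrite phi_runit -compA -Qm_mul.
have -> : (fmx S (@sidx 1 n) *m fmx S (@ridx n))%R = fmx S (@lidx n).
  by rewrite fmx_comp; apply: eq_fmx => x; case: {x}(mxtens_indexP x) => i j;
    rewrite /= sidxE ridxE lidxE.
move/(congr1 (fun x => swap _ _ ∘ x)); rewrite compA swapK comp1m => ->.
by rewrite compA swap_rk.
Qed.

End Coherence.

(** * Bending wires *)

Section MatrixBending.
Variable S : involutive_semiring.
Local Notation Mx m n := 'M[isr S]_(m, n).
Local Notation idx := (@mxtens_index _ _).
Local Notation uidx := (@mxtens_unindex _ _).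
Local Open Scope ring_scope.

Lemma sum_pairs (V : nmodType) m n (F : 'I_(m * n) -> V) :
  \sum_k F k = \sum_i \sum_j F (idx (i, j)).
Proof.
rewrite pair_big /=; apply: (reindex (fun p => idx (p.1, p.2))).
exists uidx; first by move=> [i j] _; rewrite mxtens_indexK.
by move=> k _; rewrite -[RHS]mxtens_unindexK; case: (uidx k).
Qed.

Definition slice n m k (M : Mx n (m * k)) (c : 'I_k) : Mx n m :=
  \matrix_(x, y) M x (idx (y, c)).

Definition dsum n m k (M : Mx n (m * k)) : Mx (n * n) (m * m) :=
  \sum_c dmx (slice M c).

(** The output [m] is turned into an input, leaving the environment [k] as the only output:
    [hat M *m dagmx (hat M)] is a Choi matrix. *)
Definition hat n m k (M : Mx n (m * k)) : Mx (m * n) k :=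
  \matrix_(x, c) M (uidx x).2 (idx ((uidx x).1, c)).

(** Its slices are the daggers of the slices of [M], so it presents the dagger with the same
    environment [k]. *)
Definition adj n m k (M : Mx n (m * k)) : Mx m (n * k) :=
  \matrix_(y, x) inv S (M (uidx x).1 (idx (y, (uidx x).2))).

Lemma dsumE n m k (M : Mx n (m * k)) x x' y y' :
  dsum M (idx (x', x)) (idx (y', y)) =
  \sum_c inv S (M x' (idx (y', c))) * M x (idx (y, c)).
Proof. by rewrite summxE; apply: eq_bigr => c _; rewrite /dmx kronE !mxE. Qed.

Lemma hatE n m k (M : Mx n (m * k)) x y c : hat M (idx (y, x)) c = M x (idx (y, c)).
Proof. by rewrite mxE mxtens_indexK. Qed.

Lemma adjE n m k (M : Mx n (m * k)) x y c :
  adj M y (idx (x, c)) = inv S (M x (idx (y, c))).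
Proof. by rewrite mxE mxtens_indexK. Qed.

Lemma dsum_hat n m k l (M : Mx n (m * k)) (N : Mx n (m * l)) :
  dsum M = dsum N <-> hat M *m dagmx (hat M) = hat N *m dagmx (hat N).
Proof.
have hh k' (K : Mx n (m * k')) x x' y y' :
    (hat K *m dagmx (hat K)) (idx (y, x)) (idx (y', x')) =
    dsum K (idx (x', x)) (idx (y', y)).
  rewrite dsumE mxE; apply: eq_bigr => c _.
  by rewrite hatE [dagmx _ _ _]mxE hatE mulrC.
split=> e; apply/matrixP => u v; case: {u}(mxtens_indexP u) => a b;
  case: {v}(mxtens_indexP v) => a' b'; first by rewrite !hh e.
by rewrite -!hh e.
Qed.

(** Expresses [hat] by structural matrices and a cap, in a form through which [Qm] can be pushed. *)
Lemma hat_bend n m k (M : Mx n (m * k)) :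
  hat M = kron 1%:M M *m fmx S (@aidxV m m k) *m kron (capmx S m) 1%:M
            *m fmx S (@lidx k).
Proof.
apply/matrixP => u c; case: {u}(mxtens_indexP u) => y x.
rewrite hatE -!mulmxA mxE sum_idx -[LHS](sum_dl y (fun y' => M x (idx (y', c)))).
apply: eq_bigr => y' _; rewrite sum_idx.
rewrite -[M x (idx (y', c))](sum_dl y' (fun z => M x (idx (z, c)))) mulr_sumr.
apply: eq_bigr => z _.
rewrite -[M x (idx (z, c))](sum_dr c (fun c' => M x (idx (z, c')))) mulr_sumr mulr_sumr.
apply: eq_bigr => c' _.
rewrite fmx_mull (fmx_mulr _ (@lidxK _) (@lidxVK _)) idxE !kronE capmxE !mxE.
by rewrite -!mulrA; congr (_ * _); rewrite mulrCA.
Qed.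

Lemma bend_hat n m k (M : Mx n (m * k)) :
  M = fmx S (@lidxV n) *m kron (cupmx S m) 1%:M *m fmx S (@aidx m m n)
        *m kron 1%:M (hat M).
Proof.
apply/matrixP => x v; case: {v}(mxtens_indexP v) => y c.
rewrite -!mulmxA fmx_mull /lidxV mxE sum_idx.
rewrite -[LHS](sum_dr y (fun y' => M x (idx (y', c)))) sum_idx.
apply: eq_bigr => y' _.
rewrite -[M x (idx (y', c)) * _](sum_dl y' (fun z => M x (idx (z, c)) * (y' == y)%:R)).
apply: eq_bigr => z _.
rewrite -(sum_dl x (fun x' => M x' (idx (z, c)) * (y' == y)%:R)) mulr_sumr.
apply: eq_bigr => x' _.
rewrite fmx_mull idxE !kronE cupmxE hatE !mxE.
by rewrite -!mulrA; do 2!congr (_ * _); rewrite mulrC.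
Qed.

Lemma adj_bend n m k (M : Mx n (m * k)) :
  adj M = fmx S (@ridxV m) *m kron 1%:M (cupmx S k) *m fmx S (@aidxV m k k)
            *m kron (dagmx M) 1%:M.
Proof.
apply/matrixP => y v; case: {v}(mxtens_indexP v) => x c.
rewrite adjE -!mulmxA fmx_mull /ridxV mxE sum_idx.
rewrite -[LHS](sum_dl y (fun y' => inv S (M x (idx (y', c))))).
apply: eq_bigr => y' _; rewrite sum_idx.
rewrite -(sum_dr c (fun d => inv S (M x (idx (y', d))))) mulr_sumr.
apply: eq_bigr => d _.
rewrite -(sum_dl d (fun d' => inv S (M x (idx (y', d))) * (d' == c)%:R)) mulr_sumr.
apply: eq_bigr => d' _.
rewrite fmx_mull idxE !kronE cupmxE !mxE.
by rewrite -!mulrA.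
Qed.

Lemma hat_ridxV m : hat (fmx S (@ridxV m)) = capmx S m.
Proof.
apply/matrixP => u c; case: {u}(mxtens_indexP u) => y x.
by rewrite hatE mxE capmxE /ridxV idx_eq [c]ord1 eqxx andbT eq_sym.
Qed.

Lemma dsum_pure n m (M : Mx n m) : dsum (M *m fmx S (@ridxV m)) = dmx M.
Proof.
rewrite /dsum big_ord1; congr dmx; apply/matrixP => x y.
by rewrite mxE (fmx_mulr _ (@ridxVK _) (@ridxK _)) idxE.
Qed.

Lemma dsum_comp n m p k l (M : Mx n (m * k)) (N : Mx m (p * l)) :
  dsum (M *m kron N 1%:M *m fmx S (@aidx p l k)) = dsum M *m dsum N.
Proof.
rewrite /dsum sum_pairs mulmx_sumr; apply: eq_bigr => d _.
rewrite mulmx_suml; apply: eq_bigr => c _; rewrite -dmx_mul; congr dmx.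
apply/matrixP => x y; rewrite mxE (fmx_mulr _ (@aidxK _ _ _) (@aidxVK _ _ _)).
rewrite idxE !mxE sum_idx; apply: eq_bigr => z _; rewrite !mxE.
rewrite -(sum_dr c (fun c' => M x (idx (z, c')))) mulr_suml.
by apply: eq_bigr => c' _; rewrite kronE [1%:M _ _]mxE mulrA mulrAC.
Qed.

Lemma dsum_adj n m k (M : Mx n (m * k)) : dsum (adj M) = dagmx (dsum M).
Proof.
apply/matrixP => u v; case: {u}(mxtens_indexP u) => y' y.
case: {v}(mxtens_indexP v) => x' x; rewrite [RHS]mxE !dsumE rmorph_sum.
by apply: eq_bigr => c _; rewrite !adjE rmorphM.
Qed.

Lemma dsum_tens a n m k (N : Mx n (m * k)) :
  dsum (kron (1%:M : Mx a a) N *m fmx S (@aidxV a m k)) = qtens 1%:M (dsum N).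
Proof.
apply/matrixP => u v; case: {u}(mxtens_indexP u) => u' u.
case: {v}(mxtens_indexP v) => v' v.
case: {u'}(mxtens_indexP u') => i' x'; case: {u}(mxtens_indexP u) => i x.
case: {v'}(mxtens_indexP v') => j' y'; case: {v}(mxtens_indexP v) => j y.
rewrite qtensE !dsumE mulr_sumr; apply: eq_bigr => c _.
rewrite !(fmx_mulr _ (@aidxVK _ _ _) (@aidxK _ _ _)) !idxE !kronE !mxE.
rewrite idx_eq rmorphM rmorph_nat -mulnb natrM.
by rewrite -!mulrA; congr (_ * _); rewrite mulrCA.
Qed.

Lemma dsum_disc n : dsum (fmx S (@lidxV n) : Mx n (1 * n)) = @cpm_disc (Mat_dcompact S) n.
Proof.
apply/matrixP => u v; case: {u}(mxtens_indexP u) => x' x.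
case: {v}(mxtens_indexP v) => y' y; rewrite cpm_discE dsumE.
rewrite -(sum_dl x' (fun c => (c == x)%:R)); apply: eq_bigr => c _.
rewrite !mxE /lidxV !idx_eq rmorph_nat [y]ord1 [y']ord1 !eqxx /=.
by rewrite [c == x]eq_sym.
Qed.

Lemma cpm_dsum n m (q : Mx (n * n) (m * m)) : @is_cpm (Mat_dcompact S) n m q ->
  exists (k : nat) (M : Mx n (m * k)), q = dsum M.
Proof.
case/Mat_cpmP => k [M ->]; exists k.
exists (\matrix_(x, y) M (uidx y).2 x (uidx y).1).
rewrite /dsum; apply: eq_bigr => c _; congr dmx; apply/matrixP => x y.
by rewrite !mxE mxtens_indexK.
Qed.

End MatrixBending.

(** * Bent wires in the image of the matrix functor *)

Section Bending.
Variable P : sup_category.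
Local Notation S := (scalars P).
Local Notation Mx m n := 'M[isr S]_(m, n).
Local Notation phi := (@phi P).
Local Notation kap0 := (kap P (ord0 : 'I_1)).

Lemma kap0_coiso : kap0 ∘ kap0^† = idm _.
Proof.
rewrite /kap -und_pmd -und_pmc; have := eps_complete P 1.
by rewrite big_ord1 => ->; rewrite und1.
Qed.

Lemma Qm_fmxK n m (f : 'I_n -> 'I_m) g : cancel f g -> cancel g f ->
  Qm (fmx S f) ∘ Qm (fmx S g) = idm (Eo P m).
Proof.
move=> fK gK; rewrite -Qm_mul fmx_comp -Qm1 fmx_id; congr Qm.
exact: eq_fmx.
Qed.

Lemma phiD_nat n m n' m' (M : Mx n m) (N : Mx n' m') :
  (phi m m')^† ∘ Qm (kron M N) = (Qm M ⊠ Qm N) ∘ (phi n n')^†.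
Proof.
apply: dag_inj; rewrite !dag_comp !dagK dag_tensm -!Qm_dag dag_kron.
by rewrite phi_nat.
Qed.

Lemma phi_assocV n m p : (phi (n * m) p)^† ∘ Qm (fmx S (@aidxV n m p)) =
  (phi n m ⊠ idm _) ∘ (assoc _ _ _)^† ∘ (idm _ ⊠ (phi m p)^†) ∘ (phi n (m * p))^†.
Proof.
have := congr1 (fun x => x ∘ Qm (fmx S (@aidxV n m p))) (phi_assoc P n m p).
rewrite -[RHS]compA (Qm_fmxK (@aidxK _ _ _) (@aidxVK _ _ _)) compm1.
move=> h; rewrite -[RHS]compA -h !compA (pre (assocK _ _ _)) compm1 tens_inter.
by rewrite phi_coiso comp1m tensm1 comp1m.
Qed.

Lemma phi_assocD n m p : (phi n (m * p))^† ∘ Qm (fmx S (@aidx n m p)) =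
  (idm _ ⊠ phi m p) ∘ assoc _ _ _ ∘ ((phi n m)^† ⊠ idm _) ∘ (phi (n * m) p)^†.
Proof.
rewrite -[RHS]compA -[RHS]compA [assoc _ _ _ ∘ _]compA phi_assoc !compA.
by rewrite tens_inter comp1m phi_coiso tensm1 comp1m.
Qed.

(** A self-duality carried over from matrices; the chosen [cup (Eo P m)] may involve a different
    dual object. *)
Definition selfcup m : hom Iob (Eo P m ⊗ Eo P m) :=
  locked ((phi m m)^† ∘ Qm (cupmx S m) ∘ kap0).
Lemma selfcupE m : selfcup m = (phi m m)^† ∘ Qm (cupmx S m) ∘ kap0.
Proof. by rewrite /selfcup -lock. Qed.

Lemma Qm_cap m : Qm (capmx S m) = (Qm (cupmx S m))^†.
Proof. by rewrite -dag_cupmx Qm_dag. Qed.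

Definition bend_phi n m k (M : Mx n (m * k)) : hom (Eo P n) (Eo P m ⊗ Eo P k) :=
  locked ((phi m k)^† ∘ Qm M).
Lemma bend_phiE n m k (M : Mx n (m * k)) : bend_phi M = (phi m k)^† ∘ Qm M.
Proof. by rewrite /bend_phi -lock. Qed.

Lemma Qm_hat n m k (M : Mx n (m * k)) : Qm (hat M) ∘ phi m n =
  (lk (selfcup m) _)^† ∘ (assoc _ _ _)^† ∘ (idm _ ⊠ bend_phi M).
Proof.
rewrite hat_bend !Qm_mul -!compA -phi_nat Qm1.
have e : Qm (fmx S (@aidxV m m k)) ∘ phi m (m * k) =
    phi (m * m) k ∘ (phi m m ⊠ idm _) ∘ (assoc _ _ _)^† ∘ (idm _ ⊠ (phi m k)^†).
  have i : (phi m (m * k))^† ∘ (phi m (m * k))^†^† = idm _ by rewrite dagK phi_iso.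
  apply: (coiso_inj i); rewrite -!compA phi_coiso compm1.
  by rewrite -[LHS]comp1m -(phi_coiso P (m * m) k) -compA phi_assocV -!compA.
rewrite [Qm (fmx S (@aidxV _ _ _)) ∘ _]compA e -!compA.
rewrite [Qm (kron _ _) ∘ _]compA -phi_nat Qm1 -!compA tens_inter comp1m -bend_phiE.
rewrite [Qm (fmx S (@lidx _)) ∘ _]compA.
have -> : Qm (fmx S (@lidx k)) ∘ phi 1 k = (lk kap0 _)^†.
  rewrite -[phi 1 k]dagK phi_lunit dag_comp compA -Qm_dag.
  by rewrite (dag_fmx _ (@lidxK _) (@lidxVK _)) (Qm_fmxK (@lidxK _) (@lidxVK _)) comp1m.
rewrite [(Qm _ ⊠ _) ∘ _]compA tens_inter comp1m !compA lkD_tens1.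
by rewrite selfcupE dag_comp Qm_cap dagK.
Qed.

Lemma bend_phi_hat n m k (M : Mx n (m * k)) : bend_phi M =
  (idm _ ⊠ (Qm (hat M) ∘ phi m n)) ∘ assoc _ _ _ ∘ lk (selfcup m) _.
Proof.
rewrite bend_phiE {1}[M]bend_hat !Qm_mul !compA phiD_nat Qm1.
rewrite -[X in X ∘ _ ∘ _]compA phi_assocD !compA tens_inter comp1m.
rewrite -[X in X ∘ _]compA phiD_nat Qm1 phi_lunit.
rewrite !compA (pre (Qm_fmxK (@lidxK _) (@lidxVK _))) compm1.
by rewrite !(pre (tens1_lk _ _ _)) selfcupE compA.
Qed.

(** The matrix of the inverse right unitor has the matrix cap as its [hat], so for it the bending
    formula becomes the snake. *)
Lemma selfcup_snake m :
  (rk (selfcup m) _)^† ∘ assoc _ _ _ ∘ lk (selfcup m) _ = idm (Eo P m).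
Proof.
have := bend_phi_hat (fmx S (@ridxV m)).
have -> : bend_phi (fmx S (@ridxV m)) = rk kap0 _.
  rewrite bend_phiE phi_runit -compA (Qm_fmxK (@ridxK _) (@ridxVK _)).
  exact: compm1.
move/(congr1 (fun x => (rk kap0 _)^† ∘ x)).
rewrite rkD_rk ?kapD_kap // => ->; rewrite !compA rkD_tens1 hat_ridxV.
have -> // : (Qm (capmx S m) ∘ phi m m)^† ∘ kap0 = selfcup m.
by rewrite selfcupE dag_comp Qm_cap dagK.
Qed.

Lemma bend_phi_adj n m k (M : Mx n (m * k)) : bend_phi (adj M) =
  ((bend_phi M)^† ⊠ idm _) ∘ (assoc _ _ _)^† ∘ rk (selfcup k) _.
Proof.
rewrite bend_phiE adj_bend !Qm_mul !compA phiD_nat Qm1 Qm_dag.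
rewrite -[X in X ∘ _ ∘ _]compA phi_assocV !compA tens_inter comp1m.
rewrite -[X in X ∘ _]compA phiD_nat Qm1 phi_runit.
rewrite !compA (pre (Qm_fmxK (@ridxK _) (@ridxVK _))) compm1.
by rewrite !(pre (tens1_rk _ _ _)) selfcupE compA bend_phiE dag_comp dagK.
Qed.

Lemma bend_phi_comp n m p k l (M : Mx n (m * k)) (N : Mx m (p * l)) :
  bend_phi (M *m kron N 1%:M *m fmx S (@aidx p l k))%R =
  (idm _ ⊠ phi l k) ∘ assoc _ _ _ ∘ (bend_phi N ⊠ idm _) ∘ bend_phi M.
Proof.
rewrite !bend_phiE !Qm_mul !compA phi_assocD -!compA; do 2!congr (_ ∘ _).
rewrite [(phi _ _)^† ∘ (_ ∘ _)]compA phiD_nat Qm1 !compA; do 2!congr (_ ∘ _).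
by rewrite tens_inter comp1m.
Qed.

Lemma bend_phi_tens a n m k (N : Mx n (m * k)) :
  bend_phi (kron (1%:M : Mx a a) N *m fmx S (@aidxV a m k))%R =
  (phi a m ⊠ idm _) ∘ (assoc _ _ _)^† ∘ (idm _ ⊠ bend_phi N) ∘ (phi a n)^†.
Proof.
rewrite !bend_phiE !Qm_mul !compA phi_assocV -!compA phiD_nat Qm1.
by rewrite [(idm _ ⊠ _) ∘ (_ ∘ _)]compA tens_inter comp1m.
Qed.

Lemma bend_phi_pure n m (M : Mx n m) :
  bend_phi (M *m fmx S (@ridxV m))%R = rk kap0 _ ∘ Qm M.
Proof.
rewrite bend_phiE Qm_mul phi_runit compA -[_ ∘ Qm (fmx _ _)]compA.
by rewrite (Qm_fmxK (@ridxK _) (@ridxVK _)) compm1.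
Qed.

Lemma bend_phi_disc n : bend_phi (fmx S (@lidxV n) : Mx n (1 * n)) = lk kap0 _.
Proof.
by rewrite bend_phiE phi_lunit -compA (Qm_fmxK (@lidxK _) (@lidxVK _)) compm1.
Qed.

Lemma selfcup_swap m : swap _ _ ∘ selfcup m = selfcup m.
Proof.
rewrite selfcupE !compA phi_swap -[_ ∘ Qm (cupmx _ _)]compA -Qm_mul; congr (_ ∘ Qm _ ∘ _).
apply/matrixP => i v; case: {v}(mxtens_indexP v) => j k.
by rewrite (fmx_mulr _ (@sidxK _ _) (@sidxK _ _)) idxE !cupmxE eq_sym.
Qed.

Lemma selfcup_snakeV m :
  (lk (swap _ _ ∘ selfcup m) _)^† ∘ (assoc _ _ _)^† ∘ rk (selfcup m) _ = idm (Eo P m).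
Proof.
rewrite selfcup_swap; apply: dag_inj; rewrite !dag_comp !dagK dag1 compA.
exact: selfcup_snake.
Qed.

(** The states [(rk p _)^† ∘ c] are the conjugates of the states [p], and conjugation reverses inner
    products. *)
Lemma ket_snake (X X' : P) (c : hom Iob (X' ⊗ X)) :
  (lk (swap _ _ ∘ c) X)^† ∘ (assoc _ _ _)^† ∘ rk c X = idm X ->
  forall p q : hom Iob X, c^† ∘ rk p _ ∘ ((rk q _)^† ∘ c) = q^† ∘ p.
Proof.
move=> sn p q; rewrite -[p in RHS]comp1m -sn compA -[in RHS]compA -lk_ket.
rewrite -[in RHS]compA [(assoc _ _ _)^† ∘ _]compA assocV_lk !compA.
rewrite -[q^† ∘ _]dag_comp lk_ket dag_comp -[X in X ∘ _ = _]compA.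
rewrite -[RHS]compA.
rewrite -[RHS]compA [(rk q _)^† ∘ _]compA rkD_nat dag_comp dag_swap !compA.
by rewrite (pre (swap_lk _ _)).
Qed.

Lemma kapD_kap0 n (i j : 'I_n) : i != j -> (kap P i)^† ∘ kap P j = zm _ _.
Proof.
move=> ij; rewrite /kap -und_pmd -und_pmc eps_ortho (negPf ij).
exact: und_pt.
Qed.

Lemma basis_iso n Y (u : hom (Eo P n) Y) :
  (forall i j, (u ∘ kap P i)^† ∘ (u ∘ kap P j) = (kap P i)^† ∘ kap P j) ->
  u^† ∘ u = idm _.
Proof.
elim: n u => [|n IH] u uk; first exact: from_zobE.
apply: pb_iso.
- apply: IH => i j; have := uk (lift ord0 i) (lift ord0 j); rewrite !kap_lift !compA.
  by move=> ->; rewrite dag_comp (pre (ilD_il _)) compm1.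
- by have := uk ord0 ord0; rewrite kapD_kap kap_0.
(* The zero endomorphism is taken as the idempotent: a map that vanishes on the basis is zero. *)
- have zz : zm (Iob : P) Iob ∘ zm Iob Iob = zm Iob Iob := zm_comp _ _.
  rewrite -[LHS](range_basis zz) ?zm_comp // => i.
  rewrite !zm_comp -!compA -kap_lift -kap_0 uk.
  by rewrite kapD_kap0 // neq_lift.
Qed.

(* The transpose of a state along the self-duality [selfcup]. *)
Definition unbend m (D : P) (c : hom Iob (D ⊗ Eo P m)) : hom (Eo P m) D :=
  locked ((rk (selfcup m) _)^† ∘ assoc _ _ _ ∘ lk c _).
Lemma unbendE m (D : P) (c : hom Iob (D ⊗ Eo P m)) :
  unbend c = (rk (selfcup m) _)^† ∘ assoc _ _ _ ∘ lk c _.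
Proof. by rewrite /unbend -lock. Qed.

Lemma unbend_selfcup m : unbend (selfcup m) = idm _.
Proof. by rewrite unbendE selfcup_snake. Qed.

Lemma unbend_ket m (D : P) (c : hom Iob (D ⊗ Eo P m)) (p : hom Iob (Eo P m)) :
  unbend c ∘ p = (rk ((rk p _)^† ∘ selfcup m) _)^† ∘ c.
Proof.
rewrite unbendE -compA lk_ket compA -[_ ∘ rk p _]compA assoc_rk.
by rewrite rkD_tens1.
Qed.

(** This compares [Eo P m] with its chosen dual. On basis states the inner products are conjugated
    twice, once by each cup, and so are preserved. *)
Lemma unbend_cup_iso m : (unbend (cup (Eo P m)))^† ∘ unbend (cup (Eo P m)) = idm _.
Proof.
apply: basis_iso => i j; rewrite !unbend_ket dag_comp dagK ket_snake; last first.
  have := snake_kets (Eo P m).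
  by rewrite /cap /cap_of dag_comp dagK dag_swap.
by rewrite dag_comp dagK ket_snake // selfcup_snakeV.
Qed.

Lemma Qm0 n m : Qm (0%R : Mx n m) = zm _ _.
Proof.
rewrite /Qm (_ : fm _ = 0%R); first exact: und_pt.
apply: mf_inj; rewrite fmK; apply/matrixP => i j.
by rewrite mxE mfE pmc0l pmc0r.
Qed.

Lemma phi_swapE n m : phi m n ∘ swap _ _ = Qm (fmx S (@sidx n m)) ∘ phi n m.
Proof.
apply: (coiso_inj (_ : (phi n m)^† ∘ (phi n m)^†^† = idm _)).
  by rewrite dagK phi_iso.
by rewrite -[LHS]compA phi_swap compA phi_coiso comp1m -[RHS]compA phi_coiso compm1.
Qed.

Lemma phi_assocE n m p : Qm (fmx S (@aidx n m p)) ∘ phi (n * m) p ∘ (phi n m ⊠ idm _) =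
  phi n (m * p) ∘ (idm _ ⊠ phi m p) ∘ assoc _ _ _.
Proof.
rewrite -[LHS]compA -[LHS]comp1m -(phi_coiso P n (m * p)) -!compA.
rewrite [(phi _ _)^† ∘ (Qm _ ∘ _)]compA phi_assocD -!compA; do 2!congr (_ ∘ _).
by rewrite [(phi _ _)^† ∘ (phi _ _ ∘ _)]compA phi_iso comp1m tens_inter phi_iso
  comp1m tensm1 compm1.
Qed.

Lemma phi_lunitE n : Qm (fmx S (@lidx n)) ∘ phi 1 n = lunit _ ∘ (kap0^† ⊠ idm _).
Proof.
rewrite -[phi 1 n]dagK phi_lunit dag_comp compA -Qm_dag.
rewrite (dag_fmx _ (@lidxK _) (@lidxVK _)) (Qm_fmxK (@lidxK _) (@lidxVK _)) comp1m.
by rewrite lkE dag_comp dagK dag_tensm dag1.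
Qed.

Lemma phi_runitE n : Qm (fmx S (@ridx n)) ∘ phi n 1 = runit _ ∘ (idm _ ⊠ kap0^†).
Proof.
rewrite -[phi n 1]dagK phi_runit dag_comp compA -Qm_dag.
rewrite (dag_fmx _ (@ridxK _) (@ridxVK _)) (Qm_fmxK (@ridxK _) (@ridxVK _)) comp1m.
by rewrite rkE dag_comp dagK dag_tensm dag1.
Qed.

End Bending.

(** * The embedding *)

Section Embedding.
Variables (C : compact_dagger_theory) (E : environment_structure C).
Hypothesis HE : superposition_properties (env_cat E).

Local Notation P := (SupCategory HE).
Local Notation S := (scalars P).
Local Notation Mx m n := 'M[isr S]_(m, n).
Local Notation idx := (@mxtens_index _ _).
Local Notation uidx := (@mxtens_unindex _ _).
Local Notation phi := (@phi P).
Local Notation kap0 := (kap P (ord0 : 'I_1)).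

Definition pur (A B : C) (f : @hom P A B) : @hom C A B := locked (sval f).
Lemma purE (A B : C) (f : @hom P A B) : pur f = sval f.
Proof. by rewrite /pur -lock. Qed.

Lemma pur_inj (A B : C) (f g : @hom P A B) : pur f = pur g -> f = g.
Proof. by rewrite !purE; apply: sub_homP. Qed.
Lemma pur_pure (A B : C) (f : @hom C A B) : pure (env_sub E) f -> exists g, pur g = f.
Proof. by move=> pf; exists (exist _ f pf); rewrite purE. Qed.
Lemma pur1 (A : C) : pur (idm (A : P)) = idm A. Proof. exact: purE. Qed.
Lemma pur_comp (A B D : C) (g : @hom P B D) (f : @hom P A B) :
  pur (g ∘ f) = pur g ∘ pur f.
Proof. by rewrite !purE. Qed.
Lemma pur_dag (A B : C) (f : @hom P A B) : pur f^† = (pur f)^†.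
Proof. by rewrite !purE. Qed.
Lemma pur_tens (A B D X : C) (f : @hom P A B) (g : @hom P D X) :
  pur (f ⊠ g) = pur f ⊠ pur g.
Proof. by rewrite !purE. Qed.
Lemma pur_assoc (A B D : C) : pur (@assoc P A B D) = assoc A B D.
Proof. exact: purE. Qed.
Lemma pur_swap (A B : C) : pur (@swap P A B) = swap A B. Proof. exact: purE. Qed.
Lemma pur_cup (A : C) : pur (@cup P A) = cup A. Proof. exact: purE. Qed.
Lemma pur_lunit (A : C) : pur (@lunit P A) = lunit A. Proof. exact: purE. Qed.
Lemma pur_runit (A : C) : pur (@runit P A) = runit A. Proof. exact: purE. Qed.
Lemma pur_rk (X A : C) (p : @hom P Iob X) : pur (rk p A) = rk (pur p) A.
Proof. by rewrite !purE (rkE (C := P)) (rkE (C := C)). Qed.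
Lemma pur_lk (X A : C) (p : @hom P Iob X) : pur (lk p A) = lk (pur p) A.
Proof. by rewrite !purE (lkE (C := P)) (lkE (C := C)). Qed.

(** The dagger of discarding is a state, to which the calculus of [rk] and [lk] applies. *)
Definition codisc (A : C) : @hom C Iob A := (disc_mor (cdt_disc C) A)^†.

Lemma codiscD (A : C) : (codisc A)^† = disc_mor (cdt_disc C) A.
Proof. exact: dagK. Qed.

Lemma codiscI : codisc Iob = idm _.
Proof. by rewrite /codisc disc_mor_unit dag1. Qed.

Lemma codisc_tens (A B : C) : codisc (A ⊗ B) = rk (codisc B) A ∘ codisc A.
Proof.
rewrite /codisc disc_mor_tens dag_comp dag_tensm rkE -compA -runitV_nat compA.
by rewrite tens_inter comp1m compm1 lunitI.
Qed.

Lemma codisc_cup (A : C) : (lk (codisc (dual A)) A)^† ∘ cup A = codisc A.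
Proof. by rewrite /codisc -(cdt_cup A) lkE dag_comp !dagK dag_tensm dag1 dagK. Qed.

Lemma env_codisc (A B D : C) (f : @hom P A B) (g : @hom P A D) :
  f^† ∘ f = g^† ∘ g <-> (pur f)^† ∘ codisc B = (pur g)^† ∘ codisc D.
Proof.
have [h1 h2] := env_eq (svalP f) (svalP g); split=> [e|e].
  have /h1 h : (sval f)^† ∘ sval f = (sval g)^† ∘ sval g.
    by rewrite -!purE -!pur_dag -!pur_comp e.
  by apply: dag_inj; rewrite !dag_comp !dagK !purE.
apply: sub_homP; apply: h2; apply: dag_inj; rewrite !dag_comp -!purE.
exact: e.
Qed.

Lemma iso_codisc (A B : C) (f : @hom P A B) :
  f^† ∘ f = idm _ -> (pur f)^† ∘ codisc B = codisc A.
Proof.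
move=> i; have /env_codisc -> : f^† ∘ f = (idm (A : P))^† ∘ idm _.
  by rewrite i dag1 comp1m.
by rewrite pur1 dag1 comp1m.
Qed.

Local Notation Ec n := (Eo P n : obj C).

Definition Fm n m k (M : Mx n (m * k)) : @hom C (Ec n) (Ec m) :=
  (rk (codisc (Ec k)) (Ec m))^† ∘ pur (bend_phi M).

(** [fwd] and [bwd] show that [Fm K] and the discarded [hat K] determine each other; the environment
    axiom then speaks about the latter. *)
Lemma Fm_wd n m k l (M : Mx n (m * k)) (N : Mx n (m * l)) :
  dsum M = dsum N <-> Fm M = Fm N.
Proof.
have fwd k' (K : Mx n (m * k')) : (pur (Qm (hat K) ∘ phi m n))^† ∘ codisc _ =
    (idm _ ⊠ Fm K)^† ∘ pur (selfcup P m).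
  rewrite Qm_hat !pur_comp !pur_dag pur_lk pur_assoc pur_tens pur1.
  rewrite /Fm !dag_comp !dagK !dag_tensm !dag1 !dag_comp !dagK -!compA lk_ket.
  by rewrite [assoc _ _ _ ∘ (_ ∘ _)]compA assoc_rk compA tens_inter comp1m.
have bwd k' (K : Mx n (m * k')) : Fm K =
    runit _ ∘ (idm _ ⊠ ((pur (Qm (hat K) ∘ phi m n))^† ∘ codisc _)^†)
      ∘ pur (assoc _ _ _ ∘ lk (selfcup P m) _).
  rewrite /Fm bend_phi_hat -compA pur_comp compA; congr (_ ∘ _).
  rewrite rkE !dag_comp dagK dag_tensm dag1 dagK pur_tens pur1 -compA.
  by rewrite tens_inter comp1m.
have QQ k' (K : Mx n (m * k')) : (Qm (hat K) ∘ phi m n)^† ∘ (Qm (hat K) ∘ phi m n) =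
    (phi m n)^† ∘ Qm (hat K *m dagmx (hat K))%R ∘ phi m n.
  by rewrite dag_comp Qm_mul Qm_dag !compA.
rewrite dsum_hat; split=> e.
  by rewrite !bwd (_ : _ ∘ codisc _ = (pur (Qm (hat N) ∘ phi m n))^† ∘ codisc _) //;
    apply/env_codisc; rewrite !QQ e.
apply: Qm_pos; rewrite -!Qm_dag -!Qm_mul.
have /env_codisc : (pur (Qm (hat M) ∘ phi m n))^† ∘ codisc _ =
    (pur (Qm (hat N) ∘ phi m n))^† ∘ codisc _ by rewrite !fwd e.
rewrite !QQ => h.
have i : (phi m n)^†^† ∘ (phi m n)^† = idm _ by rewrite dagK phi_coiso.
by apply: (coiso_inj (phi_coiso P m n)); apply: (iso_inj i); rewrite !compA.
Qed.

(** The functor is handled through its graph, because [q] has many presentations [M] and each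
    closure property needs a presentation of its own. *)
Definition Fr n m (q : Mx (n * n) (m * m)) (h : @hom C (Ec n) (Ec m)) : Prop :=
  exists (k : nat) (M : Mx n (m * k)), q = dsum M /\ h = Fm M.

Lemma Fr_fun n m (q : Mx (n * n) (m * m)) h h' : Fr q h -> Fr q h' -> h = h'.
Proof. by move=> [k [M [-> ->]]] [l [N [/Fm_wd e ->]]]. Qed.

Lemma Fr_inj n m (q q' : Mx (n * n) (m * m)) h : Fr q h -> Fr q' h -> q = q'.
Proof. by move=> [k [M [-> ->]]] [l [N [-> /Fm_wd e]]]. Qed.

Lemma Fr_comp n m p (q : Mx (n * n) (m * m)) (r : Mx (m * m) (p * p)) f g :
  Fr q f -> Fr r g -> Fr (q *m r)%R (g ∘ f).
Proof.
move=> [k [M [-> ->]]] [l [N [-> ->]]].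
exists (l * k)%N, (M *m kron N 1%:M *m fmx S (@aidx p l k))%R.
split; first by rewrite dsum_comp.
rewrite /Fm bend_phi_comp !pur_comp pur_assoc !pur_tens !pur1 !compA rkD_tens1.
rewrite iso_codisc ?phi_iso // codisc_tens -tens1_rk dag_comp -assoc_rk dag_comp !compA.
by rewrite (pre (assocK _ _ _)) compm1 (pre (rkD_nat _ _)) !compA.
Qed.

(* [tau c] is determined by the effect [disc ∘ unbend c]; for [c = cup] and
   [c = selfcup] this is [disc], as both [unbend c] are isometries, and
   [tau cup = codisc] is the compactness axiom for discarding. *)
Lemma codisc_selfcup m : (rk (codisc (Ec m)) _)^† ∘ pur (selfcup P m) = codisc (Ec m).
Proof.
pose tau (D : C) (c : @hom P Iob (D ⊗ Ec m)) := (lk (codisc D) (Ec m))^† ∘ pur c.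
have unb (D : C) (c : @hom P Iob (D ⊗ Ec m)) :
    (pur (unbend c))^† ∘ codisc D = (lk (tau D c) _)^† ∘ pur (selfcup P m).
  rewrite unbendE !pur_comp !pur_dag pur_lk pur_rk pur_assoc !dag_comp dagK.
  rewrite -!compA -lk_ket [(assoc _ _ _)^† ∘ _]compA assocV_lk compA.
  by rewrite lkD_tens1.
have tauE (D : C) (c : @hom P Iob (D ⊗ Ec m)) :
    tau D c = (lk ((pur (unbend c))^† ∘ codisc D) _)^† ∘ pur (selfcup P m).
  rewrite unb -[LHS]comp1m.
  have := congr1 (@pur _ _) (selfcup_snakeV P m).
  rewrite selfcup_swap !pur_comp !pur_dag pur_lk pur_rk pur_assoc pur1 => <-.
  rewrite -[LHS]compA -lk_ket -[LHS]compA [(assoc _ _ _)^† ∘ _]compA assocV_lk.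
  by rewrite compA lkD_tens1.
have tg : tau _ (selfcup P m) = tau _ (cup (Eo P m)).
  rewrite !tauE unbend_selfcup (iso_codisc (unbend_cup_iso P m)) pur1 dag1 comp1m.
  by [].
rewrite -[LHS](_ : tau _ (selfcup P m) = _); last first.
  rewrite /tau -[in LHS]selfcup_swap pur_comp pur_swap compA -dag_swap.
  by rewrite -dag_comp swap_lk.
by rewrite tg /tau pur_cup codisc_cup.
Qed.

(** In [adj M] the environment wire is bent round, so discarding has to pass through [selfcup]; this
    is [codisc_selfcup]. *)
Lemma Fr_dag n m (q : Mx (n * n) (m * m)) f : Fr q f -> Fr (dagmx q) f^†.
Proof.
move=> [k [M [-> ->]]]; exists k, (adj M); split; first by rewrite dsum_adj.
rewrite /Fm bend_phi_adj !pur_comp pur_rk !pur_dag pur_assoc pur_tens pur1 pur_dag.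
rewrite !compA rkD_nat dag_comp dagK -!compA; congr (_ ∘ _).
by rewrite compA -dag_comp assoc_rk dag_tensm dag1 tens1_rk codisc_selfcup.
Qed.

Lemma Fr_pure n m (M : Mx n m) : Fr (dmx M) (pur (Qm M)).
Proof.
exists 1%N, (M *m fmx S (@ridxV m))%R; split; first by rewrite dsum_pure.
rewrite /Fm bend_phi_pure pur_comp pur_rk compA rkD_rk ?comp1m //.
rewrite -[LHS]dagK dag_comp dagK iso_codisc ?kapD_kap // codiscI dag1.
by [].
Qed.

Lemma Fr_disc n : Fr (@cpm_disc (Mat_dcompact S) n : Mx (n * n) (1 * 1))
  (pur kap0 ∘ (codisc (Ec n))^†).
Proof.
exists n, (fmx S (@lidxV n)); split; first by rewrite dsum_disc.
by rewrite /Fm bend_phi_disc pur_lk rkD_lk.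
Qed.

Lemma Fr_tensr a n m (r : Mx (n * n) (m * m)) h : Fr r h ->
  Fr (qtens (1%:M : Mx (a * a) (a * a)) r)
     (pur (phi a m) ∘ (idm _ ⊠ h) ∘ (pur (phi a n))^†).
Proof.
move=> [k [M [-> ->]]].
exists k, (kron (1%:M : Mx a a) M *m fmx S (@aidxV a m k))%R.
split; first by rewrite dsum_tens.
rewrite /Fm bend_phi_tens !pur_comp !pur_dag !pur_tens !pur1 pur_assoc !compA.
rewrite rkD_nat -[_ ∘ _^† ∘ _^†]compA -dag_comp assoc_rk dag_tensm dag1.
rewrite -[_ ∘ (idm _ ⊠ _) ∘ (idm _ ⊠ _)]compA tens_inter comp1m.
by [].
Qed.

Lemma Fr_tensl a n m (q : Mx (n * n) (m * m)) f : Fr q f ->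
  Fr (qtens q (1%:M : Mx (a * a) (a * a)))
     (pur (phi m a) ∘ (f ⊠ idm _) ∘ (pur (phi n a))^†).
Proof.
move=> /(Fr_tensr a) fr.
have -> : qtens q (1%:M : Mx (a * a) (a * a)) =
    (dmx (fmx S (@sidx n a)) *m qtens 1%:M q *m dmx (fmx S (@sidx a m)))%R.
  rewrite -qtens_swap -mulmxA -dmx_mul fmx_comp.
  rewrite (_ : dmx (fmx S _) = 1%:M)%R ?mulmx1 //.
  by rewrite -dmx1 fmx_id; congr dmx; apply: eq_fmx; apply: sidxK.
(* Tensoring on the other side is conjugation by swaps, which are images of pure morphisms. *)
have := Fr_comp (Fr_comp (Fr_pure (fmx S (@sidx n a))) fr) (Fr_pure (fmx S (@sidx a m))).
congr Fr; rewrite !compA -pur_comp -phi_swapE.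
rewrite -[X in X = _]compA -pur_dag -pur_comp -phi_swap !pur_comp pur_dag !pur_swap.
rewrite !compA; congr (_ ∘ _).
by rewrite (pre (swap_nat _ _)) !compA (pre (swapK _ _)) compm1.
Qed.

Lemma Fr_tens n m n' m' (q : Mx (n * n) (m * m)) (r : Mx (n' * n') (m' * m')) f g :
  Fr q f -> Fr r g ->
  Fr (qtens q r) (pur (phi m m') ∘ (f ⊠ g) ∘ (pur (phi n n'))^†).
Proof.
move=> fq fr; have := Fr_comp (Fr_tensl n' fq) (Fr_tensr m fr).
rewrite -qtens_mul mulmx1 mul1mx; congr Fr.
rewrite !compA (pre (_ : (pur (phi m n'))^† ∘ pur (phi m n') = idm _)); last first.
  by rewrite -pur_dag -pur_comp phi_iso pur1.
by rewrite compm1 -[_ ∘ (_ ⊠ g) ∘ _]compA -tens_split'.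
Qed.

End Embedding.

(** * The functor, its faithfulness, and the monoid of scalars *)

Section Functor.
Variables (C : compact_dagger_theory) (E : environment_structure C).
Hypothesis HE : superposition_properties (env_cat E).

Local Notation P := (SupCategory HE).
Local Notation S := (scalars P).
Local Notation Mx m n := 'M[isr S]_(m, n).
Local Notation kap0 := (kap P (ord0 : 'I_1)).
Local Notation Ec n := (Eo P n : obj C).

Lemma Fr_ex n m (q : Mx (n * n) (m * m)) : @is_cpm (Mat_dcompact S) n m q ->
  exists h : @hom C (Ec n) (Ec m), Fr q h.
Proof. by move/cpm_dsum => [k [M ->]]; exists (Fm M), k, M. Qed.

Definition Fmor (n m : nat) (f : Quant_hom S n m) : @hom C (Ec n) (Ec m) :=
  sval (cid (Fr_ex (svalP f))).

Lemma FmorP n m (f : Quant_hom S n m) : Fr (sval f) (Fmor f).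
Proof. exact: svalP (cid (Fr_ex (svalP f))). Qed.

Lemma Fmor_eq n m (f : Quant_hom S n m) h : Fr (sval f) h -> Fmor f = h.
Proof. exact: Fr_fun (FmorP f). Qed.

Lemma Fmor_pure n m (M : Mx n m) : Fmor (Quant_pure M) = pur (Qm M).
Proof. by apply: Fmor_eq; rewrite /= Mat_dblmE; apply: Fr_pure. Qed.

Lemma pur_unitary (A B : C) (f : @hom P A B) :
  f^† ∘ f = idm _ -> f ∘ f^† = idm _ -> unitary (pur f).
Proof.
move=> i j; split; rewrite /isometry -pur_dag -pur_comp ?i ?j; exact: pur1.
Qed.

Definition quant_functor : dsm_functor (Quant S) C.
Proof.
refine (@DsmFunctor (Quant S) C (fun n => Ec n) Fmor
  (fun n m => pur (phi P n m)) (pur kap0^†) _ _ _ _ _ _ _ _ _ _).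
- move=> n; apply: Fmor_eq; have := Fr_pure (1%:M%R : Mx n n).
  by rewrite dmx1 Qm1 pur1.
- by move=> n m p g f; apply: Fmor_eq; apply: Fr_comp; apply: FmorP.
- by move=> n m f; apply: Fmor_eq; apply: Fr_dag; apply: FmorP.
- by move=> n m; apply: pur_unitary; rewrite ?phi_iso ?phi_coiso.
- by apply: pur_unitary; rewrite dagK ?kap0_coiso ?kapD_kap.
- move=> n m n' m' f g.
  have fr : Fr (sval (@tensm (Quant S) _ _ _ _ f g)) _ := Fr_tens (FmorP f) (FmorP g).
  rewrite (Fmor_eq fr).
  by rewrite -[RHS]compA -pur_dag -pur_comp phi_iso pur1 compm1.
- move=> n m p; rewrite [Fmor _]Fmor_pure.
  have := congr1 (@pur _ _ _ _ _) (phi_assocE P n m p).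
  by rewrite !pur_comp !pur_tens !pur1 pur_assoc.
- move=> n; rewrite [Fmor _]Fmor_pure.
  have := congr1 (@pur _ _ _ _ _) (phi_lunitE P n).
  by rewrite !pur_comp !pur_tens !pur1 pur_lunit.
- move=> n; rewrite [Fmor _]Fmor_pure.
  have := congr1 (@pur _ _ _ _ _) (phi_runitE P n).
  by rewrite !pur_comp !pur_tens !pur1 pur_runit.
- move=> n m; rewrite [Fmor _]Fmor_pure.
  have := congr1 (@pur _ _ _ _ _) (phi_swapE P n m).
  by rewrite !pur_comp pur_swap => ->.
Defined.

(** A dilation writes [f] as a pure map followed by discarding, which leaves the discarding of a
    zero state; the environment axiom shows that this is zero, all [zm^† ∘ zm] on [Iob] being
    equal. *)
Lemma pur_zm_family : zero_family (fun A B : C => pur (zm (A : P) B)).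
Proof.
have cz (A B D : C) (f : @hom C B D) : f ∘ pur (zm (A : P) B) = pur (zm (A : P) D).
  have [X [g0 [pg dg]]] := env_dilation E f.
  have [g eg] := pur_pure HE pg.
  have dz : (codisc X)^† ∘ pur (zm (Iob : P) X) = pur (zm (Iob : P) Iob).
    have /env_codisc h : (zm (Iob : P) X)^† ∘ zm (Iob : P) X =
        (zm (Iob : P) Iob)^† ∘ zm Iob Iob.
      by rewrite !comp_zm.
    by apply: dag_inj; rewrite dag_comp dagK h codiscI compm1.
  have -> : f = (rk (codisc X) D)^† ∘ pur g.
    by rewrite eg rkE dag_comp dag_tensm dag1 dagK codiscD; apply/esym/dg.
  (* The zero map into [D ⊗ X] is factored through a zero state of [X], on which discarding can
     act. *)
  rewrite -compA -pur_comp comp_zm -(comp_zm (A : P) (rk (zm (Iob : P) X) (D : P))).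
  rewrite pur_comp pur_rk compA rkE dag_comp dagK dag_tensm dag1 rkE.
  rewrite compA -[runit D ∘ _ ∘ _]compA tens_inter comp1m dz.
  rewrite -(pur1 HE D) -pur_tens -(pur_runit HE D) -pur_dag -!pur_comp.
  by rewrite comp_zm.
move=> A B D; split=> [f|g]; last exact: cz.
by apply: dag_inj; rewrite dag_comp -!pur_dag !dag_zm cz.
Qed.

Definition quant_embedding : dt_embedding (Quant S) C.
Proof.
refine (@DtEmbedding (Quant S) C quant_functor _ _ _).
- move=> n m f g e; apply: cpm_homP.
  by apply: (Fr_inj (FmorP f)); rewrite -[Fmor f]/(fmor quant_functor f) e; apply: FmorP.
- move=> n.
  have fr : Fr (sval (@disc (Quant S) n)) _ := Fr_disc HE n.
  rewrite -[fmor _ _]/(Fmor (@disc (Quant S) n)) (Fmor_eq fr) compA.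
  rewrite -[phi0 _]/(pur kap0^†) -pur_comp (kapD_kap P) pur1 comp1m codiscD.
  by [].
- move=> n m f [z zf fz].
  (* The zero family is abstract; composing it with the zero matrix shows that [f] is the zero
     matrix. *)
  pose o : @hom (Quant S) n m := Quant_of (cpm_dmx (0%R : Mx n m)).
  have d0 : dmx (0%R : Mx n m) = 0%R.
    by apply/matrixP => i j; rewrite !mxE mulr0.
  have f0 : sval f = dmx (0%R : Mx n m).
    have [h _] := zf n m m; rewrite fz -(h o) d0 /= d0.
    exact: mul0mx.
  rewrite -[fmor _ _]/(Fmor f) (Fmor_eq (h := pur (Qm (0%R : Mx n m)))); last first.
    by rewrite f0; apply: Fr_pure.
  by rewrite Qm0; exists (fun A B : C => pur (zm (A : P) B)) => //; apply: pur_zm_family.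
Defined.

Lemma scalars_iso : scalars_iso_Spos (env_cat E) S.
Proof.
pose v (t : S) : S := (inv S t * t)%R.
have vE (t : S) : v t = pmc (pmd t) t by rewrite /v mulrC.
(* Lifts of one scalar differ by a phase, which [v] forgets; so the choice made by [lft] does not
   matter. *)
have vund (s t : S) : und s = und t -> v s = v t.
  by move=> e; rewrite !vE; apply: pm_pos; rewrite e.
pose f (r : @hom P Iob Iob) : Spos S :=
  exist _ (v (lft r)) (ex_intro _ (lft r : S) (erefl _)).
have SposE (x y : Spos S) : sval x = sval y -> x = y.
  by case: x y => x px [y py] /= e; subst y; congr exist; apply: Prop_irrelevance.
pose g (x : Spos S) : @hom P Iob Iob := und (sval (cid (svalP x)) : pm (Iob : P) Iob).
have fM (x y : @hom P Iob Iob) : f (x ∘ y) = SposM (f x) (f y).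
  apply: SposE => /=; rewrite (vund _ ((lft x : S) * (lft y : S))%R).
    by rewrite /v rmorphM mulrACA.
  by rewrite und_lft mulrC und_pmc !und_lft.
exists f; split.
- exists g => [r|x]; last first.
    apply: SposE; rewrite /= [RHS](svalP (cid (svalP x))).
    by apply: vund; rewrite und_lft.
  rewrite /g; case: cid => t /= et.
  (* Projected to the pure category, the equation compares [r^† ∘ r] with the same product for
     [und t]; as discarding on [Iob] is the identity, the environment axiom yields equality of the
     scalars themselves. *)
  have := congr1 (fun h : pm (Iob : P) Iob => und h)
    (etrans (esym (vE _)) (etrans et (vE t))).
  rewrite !und_pmc !und_pmd und_lft => /env_codisc.
  rewrite codiscI !compm1 => /dag_inj.
  by move/pur_inj.
- apply: SposE; rewrite /= (vund _ (1%R : S)) ?und_lft ?und1 //.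
  by rewrite /v mulr1 rmorph1.
- exact: fM.
Qed.

End Functor.

Theorem corollary3p3 (C : compact_dagger_theory) (E : environment_structure C)
  (HE : superposition_properties (env_cat E)) :
  exists S : involutive_semiring,
    inhabited (dt_embedding (Quant S) C) /\ scalars_iso_Spos (env_cat E) S.
Proof.
exists (scalars (SupCategory HE)); split; last exact: scalars_iso.
exact: inhabits (quant_embedding HE).
Qed.
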